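(* Let $q\in\mathbb C$ with $\operatorname{Re} q>0$, and let $G_r\in\mathcal J_r$ with $r\ge\frac{6}{\operatorname{Re} q}$. Denote $$\gamma_r:=\frac{1-A(r\operatorname{Re} q)}{1+A(r\operatorname{Re} q)} .$$ Then for the semigroup $\{u(t,\cdot)\}_{t\ge0}$ generated by $G_r$ the following assertions hold: (i) $u(t,\cdot)$ converges to $0$ as $t\to\infty$, uniformly on $\mathbb D$, with exponential squeezing coefficient $$\kappa(r):=\frac{\left(\operatorname{Re}(1+rq)^{\frac{1}{\gamma_r}}\right)^{\gamma_r}}{2^{1-\gamma_r}|1+rq|^2};$$ (ii) for every $z\in\mathbb D$, $u(\cdot,z)$ can be analytically extended to the sector $$\left\{t\in\mathbb C:\ |\arg t-\arg(1+rq)|<\frac{\pi\gamma_r}{2}\right\}.$$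
   Context: $\mathbb D=\{z\in\mathbb C:|z|<1\}$. The function $A$ of a real variable is $$A(x)=\frac{6x(1+x)}{(1+x)^3-3(5x-1)} .$$ A holomorphic $g:\mathbb D\to\mathbb C$ is a generator on $\mathbb D$ if for every $z\in\mathbb D$ the Cauchy problem $\frac{\partial u(t,z)}{\partial t}+g(u(t,z))=0$, $u(0,z)=z$, has a unique solution $u(t,z)\in\mathbb D$ for all $t\ge0$; the family $\{u(t,\cdot)\}_{t\ge0}$ of holomorphic self-maps of $\mathbb D$ is then the semigroup generated by $g$. A constant $\kappa>0$ is an exponential squeezing coefficient of a semigroup $\{u(t,\cdot)\}_{t\ge0}$ if $|u(t,z)|\le|z|e^{-\kappa t}$ for all $t>0$ and $z\in\mathbb D$. The analytic extension in (ii) is with respect to the semigroup parameter $t$, originally real and non-negative. Fix $q\in\mathbb C$ with $\operatorname{Re} q>0$. Consider generators $f$ on $\mathbb D$ with $f(0)=0$ and $f'(0)=q$; these are exactly the functions $f(z)=zp(z)$ with $p:\mathbb D\to\mathbb C$ holomorphic, $\operatorname{Re} p(z)\ge0$ on $\mathbb D$ and $p(0)=q$. It is known that for every such $f$ and every $r>0$ there is a unique holomorphic map $G_r:\mathbb D\to\mathbb D$ satisfying $G_r(w)+rf(G_r(w))=w$ for all $w\in\mathbb D$; it is univalent with $G_r(0)=0$, is written $G_r=(\mathrm{Id}+rf)^{-1}$, and is called the nonlinear resolvent of $f$ with parameter $r$. For $r>0$, $\mathcal J_r$ denotes the set of all resolvents $G_r=(\mathrm{Id}+rf)^{-1}$ of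 all such $f$ (with the fixed $q$). Every resolvent $G_r$ is itself a generator on $\mathbb D$, so the semigroup generated by $G_r$ (the case $g=G_r$) is well defined.
   Formalization: In (i), that κ(r) is an exponential squeezing coefficient is asserted only when |arg(1+rq)| < πγ_r/2; otherwise κ(r) may fail to be a positive real or the estimate may be false. Uniform convergence and (ii) need no such condition. *)

(* Defs.v *)
From Stdlib Require Import Reals.
From Coquelicot Require Import Coquelicot.

Open Scope R_scope.

Definition unit_disk (z : C) : Prop := Cmod z < 1.

Definition holomorphic_on (D : C -> Prop) (f : C -> C) : Prop :=
  forall z : C, D z ->
    ex_derive (K := C_AbsRing) (V := C_NormedModule) f z.

(* Only the values of [v] at [t >= 0] matter; filtering by [Rle 0] makes the
   derivative at [t = 0] one-sided. *)
Definition cauchy_solution (g : C -> C) (z : C) (v : R -> C) : Prop :=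
  v 0 = z /\
  forall t : R, 0 <= t ->
    unit_disk (v t) /\
    filterdiff (K := R_AbsRing) (U := R_NormedModule) (V := C_R_NormedModule)
      v (within (Rle 0) (locally t)) (fun s : R => scal s (Copp (g (v t)))).

Definition is_generator (g : C -> C) : Prop :=
  holomorphic_on unit_disk g /\
  forall z : C, unit_disk z ->
    exists v : R -> C, cauchy_solution g z v /\
      forall w : R -> C, cauchy_solution g z w ->
        forall t : R, 0 <= t -> w t = v t.

Definition generates_semigroup (g : C -> C) (u : R -> C -> C) : Prop :=
  forall z : C, unit_disk z -> cauchy_solution g z (fun t => u t z).

Definition is_resolvent (r : R) (f G : C -> C) : Prop :=
  holomorphic_on unit_disk G /\
  forall w : C, unit_disk w ->
    unit_disk (G w) /\ (G w + r * f (G w))%C = w.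

Definition resolvent_class (q : C) (r : R) (G : C -> C) : Prop :=
  exists f : C -> C,
    is_generator f /\ f (RtoC 0) = RtoC 0 /\
    is_derive (K := C_AbsRing) (V := C_NormedModule) f (RtoC 0) q /\
    is_resolvent r f G.

Definition converges_uniformly_to_0 (u : R -> C -> C) : Prop :=
  forall eps : R, 0 < eps ->
    exists T : R, forall t : R, 0 <= t -> T <= t ->
      forall z : C, unit_disk z -> Cmod (u t z) < eps.

Definition exponential_squeezing_coefficient
    (u : R -> C -> C) (kappa : R) : Prop :=
  0 < kappa /\
  forall (t : R) (z : C), 0 < t -> unit_disk z ->
    Cmod (u t z) <= Cmod z * exp (- (kappa * t)).

(* Principal argument, in (-PI, PI]; meaningful for z <> 0 only. *)
Definition Carg (z : C) : R :=
  if Rle_dec 0 (Im z) then acos (Re z / Cmod z) else - acos (Re z / Cmod z).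

(* Principal branch of z ^ a for real a and z <> 0. *)
Definition Cpower (z : C) (a : R) : C :=
  (Rpower (Cmod z) a * cos (a * Carg z), Rpower (Cmod z) a * sin (a * Carg z)).

Definition sector (theta alpha : R) (t : C) : Prop :=
  t <> RtoC 0 /\ Rabs (Carg t - theta) < alpha.

Definition Cconnected (D : C -> Prop) : Prop :=
  forall A B : C -> Prop, open A -> open B ->
    (forall t, D t -> A t \/ B t) ->
    (exists t, D t /\ A t) -> (exists t, D t /\ B t) ->
    exists t, D t /\ A t /\ B t.

(* [v] is given on [0, +oo), which [S] need not meet.  The extension lives on
   one connected open set containing both, so that it is determined by [v]. *)
Definition extends_analytically_to (S : C -> Prop) (v : R -> C) : Prop :=
  exists (D : C -> Prop) (U : C -> C),
    open D /\ Cconnected D /\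
    (forall t : C, S t -> D t) /\
    (forall t : R, 0 <= t -> D (RtoC t) /\ U (RtoC t) = v t) /\
    holomorphic_on D U.

Definition A (x : R) : R :=
  6 * x * (1 + x) / ((1 + x) ^ 3 - 3 * (5 * x - 1)).

Definition gamma_ (q : C) (r : R) : R :=
  (1 - A (r * Re q)) / (1 + A (r * Re q)).

(* Under [Rabs (Carg (1 + r * q)) < PI * gamma_ q r / 2] the base of the outer
   power is positive; Stdlib's [Rpower] is meaningless on a nonpositive base. *)
Definition kappa_ (q : C) (r : R) : R :=
  Rpower (Re (Cpower (1 + r * q)%C (1 / gamma_ q r))) (gamma_ q r) /
  (Rpower 2 (1 - gamma_ q r) * Cmod (1 + r * q)%C ^ 2).

(* Main.v *)
(** Write [f z = z p z]. Flowing along [f] for a fixed time is a holomorphic self-map of the disk fixing 0,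
    so by Schwarz's lemma it does not increase moduli; hence [Re p >= 0]. Put [x = r Re q]. For [z = G w] we
    have [z (1 + r p z) = w], so Harnack's inequality gives [|z| < 1 / (x - 1)], and there
    [1 + r p z = (1 + r q)(1 + e)] with [|e| <= 2 x / ((x - 2)(x + 1))]. Thus
    [G w / w = 1 / ((1 + r q)(1 + e))] has argument so close to [- arg (1 + r q)], compared with
    [1 - gamma], that log-concavity of the cosine yields [Re (G w / w) >= kappa], and that
    [Re (t G w / w) >= 0] for [t] in the sector. The first bound is the squeezing estimate. By the second,
    the Euler iterates of the complex-time flow stay in a compact part of the disk for [t] near the
    sector or the half-line, and their limit is the analytic extension.

    Cauchy's formula comes from Goursat's bisection argument, applied on the rectangle [[l0, 1] x [0, 2 PI]]
    to the map [(l, h) |-> a + l (rho exp(i h) - a)] that shrinks a circle to the point [a]. *)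

Require Import Defs.
From Stdlib Require Import Reals Lra Lia Psatz Classical ClassicalEpsilon.
From Coquelicot Require Import Coquelicot.

Open Scope R_scope.

(** * Complex derivatives and integrals along real intervals *)

(** The obstacle is that [is_generator] only promises real-time trajectories inside the disk:
    [Re p >= 0] and every dependence on a complex parameter must be extracted from them. One device
    serves both ends. Euler iterates with [2 ^ k] steps are holomorphic in the step and in the
    starting point, and uniformly bounded holomorphic functions hand their Taylor estimates on to
    pointwise limits. With the time fixed, the flow becomes holomorphic in the initial point; with
    the point fixed, it becomes holomorphic in time. The constant [gamma] enters the geometry only
    through [0 < gamma < 1] and [9/4 * delta <= 1 - gamma]. The factor [1 + e] turns the argument by
    at most [11/10 * delta], which is less than half of [1 - gamma]. This leaves room for the
    modulus of [1 + e] in the squeezing estimate and for the right angle in the sector estimate. The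
    sector need not meet the half-line of real times. The extension lives near a convex cone that
    contains both, and this is what makes its domain connected. *)

Definition cdiff (f : C -> C) (z l : C) : Prop :=
  forall eps, 0 < eps -> exists d, 0 < d /\ forall w, Cmod (w - z)%C < d ->
    Cmod (f w - f z - l * (w - z))%C <= eps * Cmod (w - z)%C.

(** Estimates are carried out in epsilon-delta form; this equivalence leads back to
    [holomorphic_on]. *)
Lemma cdiff_is_derive (f : C -> C) (z l : C) :
  cdiff f z l <-> is_derive (K := C_AbsRing) (V := C_NormedModule) f z l.
Proof.
  split.
  - intros H; split.
    + apply is_linear_scal_l.
    + intros x Hx eps.
      assert (Ex : z = x) by (apply (is_filter_lim_locally_unique (V := AbsRing_NormedModule C_AbsRing)); exact Hx).
      rewrite <- Ex in *.
      destruct (H eps (cond_pos eps)) as [d [Hd Hw]].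
      exists (mkposreal d Hd). intros y Hy.
      change (Cmod (f y - f z - (y - z) * l)%C <= eps * Cmod (y - z)%C).
      rewrite (Cmult_comm (y - z) l).
      apply Hw. exact Hy.
  - intros [_ H] eps Heps.
    destruct (H z (fun P HP => HP) (mkposreal eps Heps)) as [d Hd].
    exists d; split; [apply cond_pos|].
    intros w Hw. specialize (Hd w Hw).
    change (Cmod (f w - f z - (w - z) * l)%C <= eps * Cmod (w - z)%C) in Hd.
    rewrite (Cmult_comm (w - z) l) in Hd.
    exact Hd.
Qed.

(* [C_NormedModule] and [AbsRing_NormedModule C_AbsRing] carry different uniform structures; Coquelicot's
   product and chain rules need the latter. *)
Lemma cdiff_is_derive_AbsRing (f : C -> C) (z l : C) :
  cdiff f z l <-> is_derive (K := C_AbsRing) (V := AbsRing_NormedModule C_AbsRing) f z l.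
Proof.
  split.
  - intros H; split.
    + apply is_linear_scal_l.
    + intros x Hx eps.
      assert (Ex : z = x) by (apply (is_filter_lim_locally_unique (V := AbsRing_NormedModule C_AbsRing)); exact Hx).
      rewrite <- Ex in *.
      destruct (H eps (cond_pos eps)) as [d [Hd Hw]].
      exists (mkposreal d Hd). intros y Hy.
      change (Cmod (f y - f z - (y - z) * l)%C <= eps * Cmod (y - z)%C).
      rewrite (Cmult_comm (y - z) l).
      apply Hw. exact Hy.
  - intros [_ H] eps Heps.
    destruct (H z (fun P HP => HP) (mkposreal eps Heps)) as [d Hd].
    exists d; split; [apply cond_pos|].
    intros w Hw. specialize (Hd w Hw).
    change (Cmod (f w - f z - (w - z) * l)%C <= eps * Cmod (w - z)%C) in Hd.
    rewrite (Cmult_comm (w - z) l) in Hd.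
    exact Hd.
Qed.

Lemma Cmod_sub_le (x y : C) : Cmod x <= Cmod y + Cmod (x - y)%C.
Proof.
  replace x with (y + (x - y))%C at 1 by ring. apply Cmod_triangle.
Qed.

Lemma Cmod_minus_sym (x y : C) : Cmod (x - y)%C = Cmod (y - x)%C.
Proof.
  replace (x - y)%C with (- (y - x))%C by ring. apply Cmod_opp.
Qed.

(** Gives continuity, and keeps the difference quotient at [z] bounded near [z], which is what
    Cauchy's theorem needs at the centre. *)
Lemma cdiff_lip (f : C -> C) (z l : C) : cdiff f z l ->
  exists d, 0 < d /\ forall w, Cmod (w - z)%C < d ->
    Cmod (f w - f z)%C <= (Cmod l + 1) * Cmod (w - z)%C.
Proof.
  intros H. destruct (H 1 Rlt_0_1) as [d [Hd Hw]].
  exists d; split; auto. intros w Hz. specialize (Hw w Hz).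
  pose proof (Cmod_sub_le (f w - f z) (l * (w - z)))%C as Ht.
  rewrite Cmod_mult in Ht. lra.
Qed.

Lemma cdiff_const (c z : C) : cdiff (fun _ => c) z 0.
Proof.
  intros eps Heps; exists 1; split; [lra|]. intros w _.
  replace (c - c - 0 * (w - z))%C with (RtoC 0) by ring. rewrite Cmod_0.
  apply Rmult_le_pos; [lra|apply Cmod_ge_0].
Qed.

Lemma cdiff_id (z : C) : cdiff (fun w => w) z 1.
Proof.
  intros eps Heps; exists 1; split; [lra|]. intros w _.
  replace (w - z - 1 * (w - z))%C with (RtoC 0) by ring. rewrite Cmod_0.
  apply Rmult_le_pos; [lra|apply Cmod_ge_0].
Qed.

Lemma cdiff_plus (f g : C -> C) (z l m : C) :
  cdiff f z l -> cdiff g z m -> cdiff (fun w => f w + g w)%C z (l + m)%C.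
Proof.
  intros Hf Hg eps Heps.
  destruct (Hf (eps / 2)) as [d1 [Hd1 H1]]; [lra|].
  destruct (Hg (eps / 2)) as [d2 [Hd2 H2]]; [lra|].
  exists (Rmin d1 d2); split; [now apply Rmin_pos|].
  intros w Hw.
  specialize (H1 w (Rlt_le_trans _ _ _ Hw (Rmin_l _ _))).
  specialize (H2 w (Rlt_le_trans _ _ _ Hw (Rmin_r _ _))).
  replace (f w + g w - (f z + g z) - (l + m) * (w - z))%C
    with ((f w - f z - l * (w - z)) + (g w - g z - m * (w - z)))%C by ring.
  eapply Rle_trans; [apply Cmod_triangle|]. lra.
Qed.

Lemma cdiff_mult (f g : C -> C) (z l m : C) :
  cdiff f z l -> cdiff g z m ->
  cdiff (fun w => f w * g w)%C z (l * g z + f z * m)%C.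
Proof.
  intros Hf Hg.
  apply cdiff_is_derive_AbsRing.
  apply (is_derive_mult (K := C_AbsRing) f g z l m).
  - now apply cdiff_is_derive_AbsRing.
  - now apply cdiff_is_derive_AbsRing.
  - exact Cmult_comm.
Qed.

Lemma cdiff_comp (f g : C -> C) (z l m : C) :
  cdiff f (g z) l -> cdiff g z m -> cdiff (fun w => f (g w)) z (m * l)%C.
Proof.
  intros Hf Hg.
  apply cdiff_is_derive.
  apply (is_derive_comp (K := C_AbsRing) (V := C_NormedModule) f g z l m).
  - now apply cdiff_is_derive.
  - now apply cdiff_is_derive_AbsRing.
Qed.

Lemma cdiff_ext_loc (f g : C -> C) (z l : C) (d : R) : 0 < d ->
  (forall w, Cmod (w - z)%C < d -> f w = g w) -> cdiff f z l -> cdiff g z l.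
Proof.
  intros Hd E H eps Heps. destruct (H eps Heps) as [d1 [Hd1 H1]].
  exists (Rmin d1 d); split; [now apply Rmin_pos|].
  intros w Hw. rewrite <- !E.
  - apply H1. eapply Rlt_le_trans; [exact Hw|apply Rmin_l].
  - replace (z - z)%C with (RtoC 0) by ring. now rewrite Cmod_0.
  - eapply Rlt_le_trans; [exact Hw|apply Rmin_r].
Qed.

Lemma RtoC_neq (x y : R) : x <> y -> RtoC x <> RtoC y.
Proof. intros H E. now apply H, RtoC_inj. Qed.

Lemma Ceq_0_minus (x y : C) : (x - y = 0)%C -> x = y.
Proof. intros H. replace x with (x - y + y)%C by ring. rewrite H. ring. Qed.

Lemma cdiff_inv (z : C) : z <> 0 -> cdiff Cinv z (- / (z * z))%C.
Proof.
  intros Hz eps Heps.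
  pose proof (proj1 (Cmod_gt_0 z) Hz) as Hm.
  set (a := Cmod z) in *.
  (* The first radius keeps [Cmod w >= a / 2]; the second then absorbs the factor
     [1 / (a * a * Cmod w)] of the remainder. *)
  exists (Rmin (a / 2) (eps * a ^ 3 / 2)). split.
  { apply Rmin_pos; [lra|]. assert (0 < a ^ 3) by (apply pow_lt; lra).
    assert (0 < eps * a ^ 3) by (apply Rmult_lt_0_compat; lra). lra. }
  intros w Hw.
  assert (H1 : Cmod (w - z)%C < a / 2) by (eapply Rlt_le_trans; [exact Hw|apply Rmin_l]).
  assert (H2 : Cmod (w - z)%C < eps * a ^ 3 / 2) by (eapply Rlt_le_trans; [exact Hw|apply Rmin_r]).
  assert (Hwm : a / 2 <= Cmod w).
  { pose proof (Cmod_sub_le z w). rewrite Cmod_minus_sym in H. unfold a in *. lra. }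
  assert (Hw0 : w <> 0) by (apply Cmod_gt_0; lra).
  replace (/ w - / z - - / (z * z) * (w - z))%C
    with ((w - z) * ((w - z) * / (z * z * w)))%C by (field; auto).
  rewrite Cmod_mult, Rmult_comm. apply Rmult_le_compat_r; [apply Cmod_ge_0|].
  rewrite Cmod_mult, Cmod_inv by (repeat apply Cmult_neq_0; auto).
  rewrite !Cmod_mult. fold a.
  apply Rmult_le_reg_r with (a * a * Cmod w).
  { repeat apply Rmult_lt_0_compat; lra. }
  rewrite Rmult_assoc, Rinv_l by (apply Rgt_not_eq; repeat apply Rmult_lt_0_compat; lra).
  rewrite Rmult_1_r. apply Rlt_le. eapply Rlt_le_trans; [exact H2|].
  assert (0 < a * a) by nra.
  assert (0 < eps * (a * a)) by (apply Rmult_lt_0_compat; lra).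
  replace (eps * a ^ 3 / 2) with (eps * (a * a) * (a / 2)) by field.
  replace (eps * (a * a * Cmod w)) with (eps * (a * a) * Cmod w) by ring.
  apply Rmult_le_compat_l; lra.
Qed.

Lemma cdiff_div (f g : C -> C) (z l m : C) : g z <> 0 ->
  cdiff f z l -> cdiff g z m -> exists k, cdiff (fun w => f w / g w)%C z k.
Proof.
  intros Hz Hf Hg. eexists.
  apply (cdiff_mult f (fun w => / g w)%C z l).
  - exact Hf.
  - apply (cdiff_comp Cinv g z). apply cdiff_inv; auto. exact Hg.
Qed.

Lemma cdiff_unique (f : C -> C) (z l m : C) : cdiff f z l -> cdiff f z m -> l = m.
Proof.
  intros H1 H2. apply cdiff_is_derive in H1. apply cdiff_is_derive in H2.
  apply is_C_derive_unique in H1. apply is_C_derive_unique in H2. congruence.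
Qed.

Lemma holomorphic_cdiff (D : C -> Prop) (f : C -> C) :
  holomorphic_on D f <-> forall z, D z -> exists l, cdiff f z l.
Proof.
  split; intros H z Dz; destruct (H z Dz) as [l Hl]; exists l; now apply cdiff_is_derive.
Qed.

(** * Continuous curves in the plane and their integrals *)

Definition ccont (f : R -> C) (x : R) : Prop :=
  continuous (T := R_UniformSpace) (U := C_R_CompleteNormedModule) f x.

Lemma ccont_eps (f : R -> C) (x : R) :
  (forall eps, 0 < eps -> exists d, 0 < d /\ forall y, Rabs (y - x) < d -> Cmod (f y - f x)%C < eps) ->
  ccont f x.
Proof.
  intros H. apply filterlim_locally. intros eps.
  destruct (H eps (cond_pos eps)) as [d [Hd Hy]].
  exists (mkposreal d Hd). intros y By.
  apply C_NormedModule_mixin_compat1. apply (Hy y By).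
Qed.

Lemma ccont_eps_inv (f : R -> C) (x : R) : ccont f x ->
  forall eps, 0 < eps -> exists d, 0 < d /\ forall y, Rabs (y - x) < d -> Cmod (f y - f x)%C < eps.
Proof.
  intros H eps Heps.
  assert (He : 0 < eps / 2) by lra.
  pose proof (proj1 (filterlim_locally f (f x)) H (mkposreal _ He)) as [d Hd].
  exists d; split; [apply cond_pos|]. intros y Hy.
  specialize (Hd y Hy).
  apply C_NormedModule_mixin_compat2 in Hd. simpl in Hd.
  eapply Rlt_le_trans; [exact Hd|].
  assert (sqrt 2 <= 2). { rewrite <- (sqrt_square 2) at 2 by lra. apply sqrt_le_1_alt. lra. }
  nra.
Qed.

Lemma ccont_const (c : C) (x : R) : ccont (fun _ => c) x.
Proof. apply continuous_const. Qed.

Lemma ccont_plus (f g : R -> C) (x : R) : ccont f x -> ccont g x -> ccont (fun y => f y + g y)%C x.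
Proof. intros; now apply (continuous_plus (V := C_R_NormedModule) f g). Qed.

Lemma ccont_pair (f g : R -> R) (x : R) : continuous f x -> continuous g x ->
  ccont (fun y => (f y, g y) : C) x.
Proof.
  intros Hf Hg. apply filterlim_locally. intros eps.
  pose proof (proj1 (filterlim_locally f (f x)) Hf eps) as H1.
  pose proof (proj1 (filterlim_locally g (g x)) Hg eps) as H2.
  generalize (filter_and _ _ H1 H2). apply filter_imp. intros y [A1 A2]. split; auto.
Qed.

Lemma ccont_Re (f : R -> C) (x : R) : ccont f x -> continuous (fun y => Re (f y)) x.
Proof.
  intros H. apply filterlim_locally. intros eps.
  pose proof (proj1 (filterlim_locally f (f x)) H eps) as H1.
  revert H1. apply filter_imp. intros y [A1 A2]. exact A1.
Qed.
Lemma ccont_Im (f : R -> C) (x : R) : ccont f x -> continuous (fun y => Im (f y)) x.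
Proof.
  intros H. apply filterlim_locally. intros eps.
  pose proof (proj1 (filterlim_locally f (f x)) H eps) as H1.
  revert H1. apply filter_imp. intros y [A1 A2]. exact A2.
Qed.

Lemma ccont_ext (f g : R -> C) (x : R) : (forall y, f y = g y) -> ccont f x -> ccont g x.
Proof. intros E. apply continuous_ext. exact E. Qed.

Lemma ccont_mult (f g : R -> C) (x : R) : ccont f x -> ccont g x -> ccont (fun y => f y * g y)%C x.
Proof.
  intros Hf Hg.
  apply ccont_pair.
  - apply (continuous_minus (V := R_NormedModule)
     (fun y => Re (f y) * Re (g y)) (fun y => Im (f y) * Im (g y)));
    apply (continuous_mult (K := R_AbsRing)); auto using ccont_Re, ccont_Im.
  - apply (continuous_plus (V := R_NormedModule)
     (fun y => Re (f y) * Im (g y)) (fun y => Im (f y) * Re (g y)));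
    apply (continuous_mult (K := R_AbsRing)); auto using ccont_Re, ccont_Im.
Qed.

Lemma ccont_cdiff_comp (f : C -> C) (g : R -> C) (x : R) (l : C) :
  cdiff f (g x) l -> ccont g x -> ccont (fun y => f (g y)) x.
Proof.
  intros Hf Hg. apply ccont_eps. intros eps Heps.
  destruct (cdiff_lip _ _ _ Hf) as [d [Hd H]].
  pose proof (Cmod_ge_0 l) as Hl.
  assert (He : 0 < Rmin d (eps / (Cmod l + 1))).
  { apply Rmin_pos; auto. apply Rdiv_lt_0_compat; lra. }
  destruct (ccont_eps_inv _ _ Hg _ He) as [d1 [Hd1 H1]].
  exists d1; split; auto. intros y Hy. specialize (H1 y Hy).
  eapply Rle_lt_trans; [apply H; eapply Rlt_le_trans; [exact H1|apply Rmin_l]|].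
  assert (Cmod (g y - g x)%C < eps / (Cmod l + 1)) by (eapply Rlt_le_trans; [exact H1|apply Rmin_r]).
  apply Rmult_lt_compat_l with (r := Cmod l + 1) in H0; [|lra].
  replace ((Cmod l + 1) * (eps / (Cmod l + 1))) with eps in H0 by (field; lra). exact H0.
Qed.

Lemma Cmod_continuity_pt (f : R -> C) (x : R) : ccont f x -> continuity_pt (fun t => Cmod (f t)) x.
Proof.
  intros H eps Heps. destruct (ccont_eps_inv _ _ H eps Heps) as [d [Hd Hdd]].
  exists d. split; auto. intros y [_ Hy]. specialize (Hdd y Hy).
  eapply Rle_lt_trans; [|exact Hdd].
  unfold dist, R_met; simpl; unfold R_dist.
  pose proof (Cmod_sub_le (f y) (f x)).
  pose proof (Cmod_sub_le (f x) (f y)) as H1. rewrite Cmod_minus_sym in H1.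
  apply Rabs_le. lra.
Qed.

Definition CInt (f : R -> C) (a b : R) : C := RInt (V := C_R_CompleteNormedModule) f a b.

Definition ccont_on (f : R -> C) (a b : R) := forall x, a <= x <= b -> ccont f x.

Lemma is_CInt (f : R -> C) (a b : R) : a <= b -> ccont_on f a b ->
  is_RInt (V := C_R_NormedModule) f a b (CInt f a b).
Proof.
  intros Hab H. apply (RInt_correct (V := C_R_CompleteNormedModule)).
  apply ex_RInt_continuous. intros x Hx. rewrite Rmin_left, Rmax_right in Hx by auto.
  apply H; auto.
Qed.

Lemma CInt_le (f : R -> C) (a b M : R) : a <= b -> ccont_on f a b ->
  (forall x, a <= x <= b -> Cmod (f x) <= M) -> Cmod (CInt f a b) <= (b - a) * M.
Proof.
  intros Hab Hc HM. rewrite Cmod_norm.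
  apply (norm_RInt_le_const (V := C_R_NormedModule) f a b).
  - exact Hab.
  - intros x Hx. rewrite <- Cmod_norm. auto.
  - now apply is_CInt.
Qed.

Lemma CInt_ext (f g : R -> C) (a b : R) : a <= b -> (forall x, a <= x <= b -> f x = g x) ->
  CInt f a b = CInt g a b.
Proof.
  intros Hab H. apply (RInt_ext (V := C_R_CompleteNormedModule)).
  intros x Hx. rewrite Rmin_left, Rmax_right in Hx by auto. apply H; lra.
Qed.

Lemma CInt_Chasles (f : R -> C) (a b c : R) : a <= b <= c -> ccont_on f a c ->
  CInt f a c = (CInt f a b + CInt f b c)%C.
Proof.
  intros Hab H. symmetry. apply (RInt_Chasles (V := C_R_CompleteNormedModule)).
  - eexists. apply is_CInt; [lra|]. intros x Hx; apply H; lra.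
  - eexists. apply is_CInt; [lra|]. intros x Hx; apply H; lra.
Qed.

Lemma CInt_unique (f : R -> C) (a b : R) (l : C) :
  is_RInt (V := C_R_NormedModule) f a b l -> CInt f a b = l.
Proof. apply (is_RInt_unique (V := C_R_CompleteNormedModule)). Qed.

Lemma CInt_plus (f g : R -> C) (a b : R) : a <= b -> ccont_on f a b -> ccont_on g a b ->
  CInt (fun x => f x + g x)%C a b = (CInt f a b + CInt g a b)%C.
Proof.
  intros Hab Hf Hg. apply CInt_unique.
  apply (is_RInt_plus (V := C_R_NormedModule)); now apply is_CInt.
Qed.

(** The integral lives in a module over the reals, so a complex factor is pulled out
    componentwise. *)
Lemma CInt_scal (c : C) (f : R -> C) (a b : R) : a <= b -> ccont_on f a b ->
  CInt (fun x => c * f x)%C a b = (c * CInt f a b)%C.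
Proof.
  intros Hab Hf. apply CInt_unique.
  pose proof (is_CInt f a b Hab Hf) as H.
  pose proof (is_RInt_fct_extend_fst (U := R_NormedModule) (V := R_NormedModule) f a b _ H) as H1.
  pose proof (is_RInt_fct_extend_snd (U := R_NormedModule) (V := R_NormedModule) f a b _ H) as H2.
  destruct c as [p q].
  apply (is_RInt_fct_extend_pair (U := R_NormedModule) (V := R_NormedModule)).
  - apply (is_RInt_minus (V := R_NormedModule) (fun t => p * fst (f t)) (fun t => q * snd (f t))).
    + now apply (is_RInt_scal (V := R_NormedModule)).
    + now apply (is_RInt_scal (V := R_NormedModule)).
  - apply (is_RInt_plus (V := R_NormedModule) (fun t => p * snd (f t)) (fun t => q * fst (f t))).
    + now apply (is_RInt_scal (V := R_NormedModule)).
    + now apply (is_RInt_scal (V := R_NormedModule)).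
Qed.

Lemma CInt_conj (f : R -> C) (a b : R) : a <= b -> ccont_on f a b ->
  CInt (fun x => Cconj (f x)) a b = Cconj (CInt f a b).
Proof.
  intros Hab Hf. apply CInt_unique.
  pose proof (is_CInt f a b Hab Hf) as H.
  pose proof (is_RInt_fct_extend_fst (U := R_NormedModule) (V := R_NormedModule) f a b _ H) as H1.
  pose proof (is_RInt_fct_extend_snd (U := R_NormedModule) (V := R_NormedModule) f a b _ H) as H2.
  apply (is_RInt_fct_extend_pair (U := R_NormedModule) (V := R_NormedModule)).
  - exact H1.
  - now apply (is_RInt_opp (V := R_NormedModule)).
Qed.

Lemma CInt_const (c : C) (a b : R) : CInt (fun _ => c) a b = (RtoC (b - a) * c)%C.
Proof.
  apply CInt_unique.
  replace (RtoC (b - a) * c)%C with (scal (V := C_R_NormedModule) (b - a) c).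
  apply (is_RInt_const (V := C_R_NormedModule)).
  destruct c as [p q]. unfold scal; simpl. unfold prod_scal, scal; simpl. unfold mult; simpl.
  unfold Cmult; simpl. f_equal; ring.
Qed.

(** * Goursat's bisection argument *)

Lemma nested_intervals_point (u v : nat -> R) :
  (forall n, u n <= u (S n)) -> (forall n, v (S n) <= v n) -> (forall n, u n <= v n) ->
  exists x, forall n, u n <= x <= v n.
Proof.
  intros Hu Hv Huv.
  assert (Hum : forall n m, (n <= m)%nat -> u n <= u m).
  { intros n m Hnm. induction Hnm; [lra|]. specialize (Hu m). lra. }
  assert (Hvm : forall n m, (n <= m)%nat -> v m <= v n).
  { intros n m Hnm. induction Hnm; [lra|]. specialize (Hv m). lra. }
  assert (Hall : forall n m, u n <= v m).
  { intros n m. pose proof (Hum n (max n m) (Nat.le_max_l _ _)).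
    pose proof (Hvm m (max n m) (Nat.le_max_r _ _)). specialize (Huv (max n m)). lra. }
  destruct (completeness (fun x => exists n, x = u n)) as [x [Hx1 Hx2]].
  - exists (v 0%nat). intros y [n ->]. apply Hall.
  - exists (u 0%nat). now exists 0%nat.
  - exists x. intros n. split.
    + apply Hx1. now exists n.
    + apply Hx2. intros y [m ->]. apply Hall.
Qed.

Lemma half_pow_small (B d : R) : 0 <= B -> 0 < d -> exists k : nat, B * (/ 2) ^ k < d.
Proof.
  intros HB Hd.
  destruct (pow_lt_1_zero (/ 2)) with (y := d / (B + 1)) as [N HN].
  - rewrite Rabs_pos_eq; lra.
  - apply Rdiv_lt_0_compat; lra.
  - exists N. specialize (HN N (le_n _)).
    assert (0 < (/ 2) ^ N) by (apply pow_lt; lra).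
    rewrite Rabs_pos_eq in HN by lra.
    apply Rmult_lt_compat_l with (r := B + 1) in HN; [|lra].
    replace ((B + 1) * (d / (B + 1))) with d in HN by (field; lra). nra.
Qed.

(** The fourth quarter is the default when the first three are small; additivity of [J] and the
    triangle inequality then force it to be large. *)
Definition bisect_cell (J : R -> R -> R -> R -> C) (c x y s t : R) : R * R :=
  let big x y := Rle_dec (c * (s / 2 + t / 2) ^ 2) (Cmod (J x y (s / 2) (t / 2))) in
  if big x y then (x, y) else
  if big (x + s / 2) y then (x + s / 2, y) else
  if big x (y + t / 2) then (x, y + t / 2) else (x + s / 2, y + t / 2).

Fixpoint bisect_corner (J : R -> R -> R -> R -> C) (c x y s t : R) (k : nat) : R * R :=
  match k with
  | O => (x, y)
  | S k => let p := bisect_corner J c x y s t k in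
      bisect_cell J c (fst p) (snd p) (s * (/ 2) ^ k) (t * (/ 2) ^ k)
  end.

(** Stated for any additive function [J] of rectangles. Halving both sides divides [(s + t) ^ 2] by
    4, so one of the four quarters has a ratio of [Cmod J] to [(s + t) ^ 2] at least as large as the
    whole. The nested quarters shrink to a point, where the local hypothesis makes that ratio
    arbitrarily small. *)
Lemma goursat (J : R -> R -> R -> R -> C) (x0 y0 s0 t0 : R) :
  0 < s0 -> 0 < t0 ->
  (forall x y s t, 0 < s -> 0 < t -> x0 <= x -> x + s <= x0 + s0 -> y0 <= y -> y + t <= y0 + t0 ->
    J x y s t = Cplus (Cplus (J x y (s / 2) (t / 2)) (J (x + s / 2) y (s / 2) (t / 2)))
      (Cplus (J x (y + t / 2) (s / 2) (t / 2)) (J (x + s / 2) (y + t / 2) (s / 2) (t / 2)))) ->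
  (forall u v eps, x0 <= u <= x0 + s0 -> y0 <= v <= y0 + t0 -> 0 < eps -> exists d, 0 < d /\
    forall x y s t, 0 < s -> 0 < t -> s + t < d ->
      x0 <= x -> x + s <= x0 + s0 -> y0 <= y -> y + t <= y0 + t0 ->
      x <= u <= x + s -> y <= v <= y + t -> Cmod (J x y s t) <= eps * (s + t) ^ 2) ->
  J x0 y0 s0 t0 = 0.
Proof.
  intros Hs Ht Hadd Hloc.
  apply Cmod_eq_0. apply NNPP. intros Hne.
  assert (Hm : 0 < Cmod (J x0 y0 s0 t0)) by (pose proof (Cmod_ge_0 (J x0 y0 s0 t0)); lra).
  set (c := Cmod (J x0 y0 s0 t0) / (s0 + t0) ^ 2).
  assert (Hst : 0 < (s0 + t0) ^ 2) by (apply pow_lt; lra).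
  assert (Hc : 0 < c) by (apply Rdiv_lt_0_compat; lra).
  set (S_ := fun k => s0 * (/ 2) ^ k). set (T_ := fun k => t0 * (/ 2) ^ k).
  set (p := bisect_corner J c x0 y0 s0 t0).
  assert (Hpos : forall k, 0 < (/ 2) ^ k) by (intros; apply pow_lt; lra).
  assert (HS : forall k, 0 < S_ k) by (intros; apply Rmult_lt_0_compat; auto).
  assert (HT : forall k, 0 < T_ k) by (intros; apply Rmult_lt_0_compat; auto).
  assert (HS1 : forall k, S_ (S k) = S_ k / 2) by (intros; unfold S_; simpl; field).
  assert (HT1 : forall k, T_ (S k) = T_ k / 2) by (intros; unfold T_; simpl; field).
  assert (Hcell : forall x y s t, 0 < s -> 0 < t -> x0 <= x -> x + s <= x0 + s0 -> y0 <= y -> y + t <= y0 + t0 ->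
    c * (s + t) ^ 2 <= Cmod (J x y s t) ->
    let q := bisect_cell J c x y s t in
    (x <= fst q <= x + s / 2) /\ (y <= snd q <= y + t / 2) /\
    c * (s / 2 + t / 2) ^ 2 <= Cmod (J (fst q) (snd q) (s / 2) (t / 2))).
  { intros x y s t Hs' Ht' A1 A2 A3 A4 HJ. unfold bisect_cell.
    repeat (match goal with |- context [Rle_dec ?a ?b] => destruct (Rle_dec a b) end;
      [simpl; repeat split; lra|]); simpl.
    repeat split; try lra.
    rewrite (Hadd x y s t) in HJ; auto.
    match type of HJ with context [Cmod (?a + ?b + (?d + ?e))%C] =>
      pose proof (Cmod_triangle (a + b)%C (d + e)%C);
      pose proof (Cmod_triangle d e);
      pose proof (Cmod_triangle a b) end.
    nra. }
  assert (Hinv : forall k, (x0 <= fst (p k) /\ fst (p k) + S_ k <= x0 + s0) /\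
     (y0 <= snd (p k) /\ snd (p k) + T_ k <= y0 + t0) /\
     c * (S_ k + T_ k) ^ 2 <= Cmod (J (fst (p k)) (snd (p k)) (S_ k) (T_ k))).
  { induction k as [|k [[B1 B2] [[B3 B4] B5]]].
    - unfold p, S_, T_; simpl. rewrite !Rmult_1_r. repeat split; try lra.
      unfold c. apply Req_le. field. lra.
    - destruct (Hcell _ _ _ _ (HS k) (HT k) B1 B2 B3 B4 B5) as [E1 [E2 E3]].
      rewrite HS1, HT1. change (p (S k)) with (bisect_cell J c (fst (p k)) (snd (p k)) (S_ k) (T_ k)).
      pose proof (HS k). pose proof (HT k).
      repeat split; try lra. }
  assert (Hstep : forall k, (fst (p k) <= fst (p (S k)) <= fst (p k) + S_ k / 2) /\
      (snd (p k) <= snd (p (S k)) <= snd (p k) + T_ k / 2)).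
  { intros k. destruct (Hinv k) as [[B1 B2] [[B3 B4] B5]].
    destruct (Hcell _ _ _ _ (HS k) (HT k) B1 B2 B3 B4 B5) as [E1 [E2 E3]].
    change (p (S k)) with (bisect_cell J c (fst (p k)) (snd (p k)) (S_ k) (T_ k)). auto. }
  destruct (nested_intervals_point (fun k => fst (p k)) (fun k => fst (p k) + S_ k)) as [u Hu].
  { intros k; destruct (Hstep k); lra. }
  { intros k; destruct (Hstep k); rewrite HS1; lra. }
  { intros k; pose proof (HS k); lra. }
  destruct (nested_intervals_point (fun k => snd (p k)) (fun k => snd (p k) + T_ k)) as [v Hv].
  { intros k; destruct (Hstep k); lra. }
  { intros k; destruct (Hstep k); rewrite HT1; lra. }
  { intros k; pose proof (HT k); lra. }
  (* Half of the ratio [c] preserved by the bisection is enough for the contradiction. *)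
  destruct (Hloc u v (c / 2)) as [d [Hd Hd1]].
  { specialize (Hu 0%nat). unfold p, S_ in Hu; simpl in Hu. lra. }
  { specialize (Hv 0%nat). unfold p, T_ in Hv; simpl in Hv. lra. }
  { lra. }
  destruct (half_pow_small (s0 + t0) d) as [k Hk]; [lra|auto|].
  destruct (Hinv k) as [[B1 B2] [[B3 B4] B5]].
  assert (Hsum : S_ k + T_ k = (s0 + t0) * (/ 2) ^ k) by (unfold S_, T_; ring).
  pose proof (HS k) as HSk. pose proof (HT k) as HTk.
  assert (H1 := Hd1 (fst (p k)) (snd (p k)) (S_ k) (T_ k) HSk HTk ltac:(lra) B1 B2 B3 B4 (Hu k) (Hv k)).
  assert (0 < (S_ k + T_ k) ^ 2) by (apply pow_lt; lra).
  nra.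
Qed.

(** * Differentiable curves and integrals along them *)

Definition rdiff (f : R -> C) (x : R) (l : C) : Prop :=
  is_derive (K := R_AbsRing) (V := R_NormedModule) (fun y => Re (f y)) x (Re l) /\
  is_derive (K := R_AbsRing) (V := R_NormedModule) (fun y => Im (f y)) x (Im l).

Lemma rdiff_const (c : C) (x : R) : rdiff (fun _ => c) x 0.
Proof. split; apply (is_derive_const (V := R_NormedModule)). Qed.

Lemma rdiff_eq (f : R -> C) (x : R) (l m : C) : rdiff f x l -> l = m -> rdiff f x m.
Proof. now intros H <-. Qed.

Lemma rdiff_plus (f g : R -> C) (x : R) (l m : C) :
  rdiff f x l -> rdiff g x m -> rdiff (fun y => f y + g y)%C x (l + m)%C.
Proof.
  intros [A B] [A' B']. split.
  - now apply (is_derive_plus (V := R_NormedModule) (fun y => Re (f y)) (fun y => Re (g y))).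
  - now apply (is_derive_plus (V := R_NormedModule) (fun y => Im (f y)) (fun y => Im (g y))).
Qed.

Lemma rdiff_mult (f g : R -> C) (x : R) (l m : C) :
  rdiff f x l -> rdiff g x m -> rdiff (fun y => f y * g y)%C x (l * g x + f x * m)%C.
Proof.
  intros [A B] [A' B'].
  pose proof (fun a b c d e f => is_derive_mult (K := R_AbsRing) a b c d e f) as MU.
  split.
  - eapply (is_derive_ext (V := R_NormedModule)
      (fun y => Re (f y) * Re (g y) - Im (f y) * Im (g y))); [reflexivity|].
    evar_last.
    { apply (is_derive_minus (V := R_NormedModule)
       (fun y => Re (f y) * Re (g y)) (fun y => Im (f y) * Im (g y)));
      eapply (is_derive_mult (K := R_AbsRing)); eauto using Rmult_comm; intros; apply Rmult_comm. }
    unfold minus, plus, opp, mult, Re, Im; simpl; ring.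
  - eapply (is_derive_ext (V := R_NormedModule)
      (fun y => Re (f y) * Im (g y) + Im (f y) * Re (g y))); [reflexivity|].
    evar_last.
    { apply (is_derive_plus (V := R_NormedModule)
       (fun y => Re (f y) * Im (g y)) (fun y => Im (f y) * Re (g y)));
      eapply (is_derive_mult (K := R_AbsRing)); eauto using Rmult_comm; intros; apply Rmult_comm. }
    unfold minus, plus, opp, mult, Re, Im; simpl; ring.
Qed.

Lemma rdiff_ccont (f : R -> C) (x : R) (l : C) : rdiff f x l -> ccont f x.
Proof.
  intros [A B].
  apply ccont_ext with (fun y => (Re (f y), Im (f y)) : C).
  { intros y. now destruct (f y). }
  apply ccont_pair;
  [apply (ex_derive_continuous (fun y => Re (f y)))
  |apply (ex_derive_continuous (fun y => Im (f y)))]; eexists; eauto.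
Qed.

Lemma is_derive_rdiff (f : R -> C) (x : R) (l : C) : rdiff f x l ->
  is_derive (K := R_AbsRing) (V := C_R_NormedModule) f x l.
Proof.
  intros [A B].
  assert (E : forall z : C, z = plus (scal (V := C_R_NormedModule) (Re z) (1 : C))
                                (scal (V := C_R_NormedModule) (Im z) Ci)).
  { intros [a b]. unfold plus, scal, Ci, RtoC, prod_plus, prod_scal; simpl.
    unfold prod_plus, prod_scal, plus, scal, mult; simpl. unfold mult; simpl. f_equal; ring. }
  rewrite (E l).
  apply (is_derive_ext (V := C_R_NormedModule) _ _ _ _ (fun y => eq_sym (E (f y)))).
  apply (is_derive_plus (V := C_R_NormedModule)).
  - apply (is_derive_scal_l (V := C_R_NormedModule) (fun y => Re (f y))). exact A.
  - apply (is_derive_scal_l (V := C_R_NormedModule) (fun y => Im (f y))). exact B.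
Qed.

Lemma CInt_derive (f df : R -> C) (a b : R) : a <= b ->
  (forall x, a <= x <= b -> rdiff f x (df x)) -> ccont_on df a b ->
  CInt df a b = (f b - f a)%C.
Proof.
  intros Hab Hd Hc. apply CInt_unique.
  apply (is_RInt_derive (V := C_R_CompleteNormedModule)); intros x Hx;
  rewrite Rmin_left, Rmax_right in Hx by auto.
  - now apply is_derive_rdiff, Hd.
  - now apply Hc.
Qed.

(** The mean value inequality, obtained by integrating the derivative, since a plane curve need not
    have an intermediate point. *)
Lemma curve_lipschitz (f df : R -> C) (a b W : R) : a <= b ->
  (forall x, a <= x <= b -> rdiff f x (df x)) -> ccont_on df a b ->
  (forall x, a <= x <= b -> Cmod (df x) <= W) ->
  Cmod (f b - f a)%C <= (b - a) * W.
Proof.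
  intros Hab Hd Hc HW. rewrite <- (CInt_derive f df a b); auto.
  now apply CInt_le.
Qed.

(** A primitive of the affine map sending [z] to [p + q * (z - c)]. *)
Definition quad_prim (p q c z : C) : C := (p * z + q / 2 * ((z - c) * (z - c)))%C.

(** The affine approximation of [g] integrates exactly to a difference of end values of [quad_prim];
    only the error [E] remains, weighted by the speed [W]. *)
Lemma path_integral_close (g : C -> C) (gam dgam : R -> C) (a b E W : R) (p q c : C) :
  a <= b ->
  (forall x, a <= x <= b -> rdiff gam x (dgam x)) -> ccont_on dgam a b ->
  ccont_on (fun x => g (gam x)) a b ->
  (forall x, a <= x <= b -> Cmod (dgam x) <= W) ->
  (forall x, a <= x <= b -> Cmod (g (gam x) - (p + q * (gam x - c)))%C <= E) ->
  Cmod (CInt (fun x => g (gam x) * dgam x)%C a b - (quad_prim p q c (gam b) - quad_prim p q c (gam a)))%C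
    <= (b - a) * (E * W).
Proof.
  intros Hab Hd Hc Hg HW HE.
  assert (Hcg : ccont_on gam a b) by (intros x Hx; eapply rdiff_ccont; eauto).
  assert (Hcl : ccont_on (fun x => (p + q * (gam x - c)) * dgam x)%C a b).
  { intros x Hx. apply ccont_mult; auto. apply ccont_plus; [apply ccont_const|].
    apply ccont_mult; [apply ccont_const|]. apply ccont_plus; auto. apply ccont_const. }
  rewrite <- (CInt_derive (fun x => quad_prim p q c (gam x)) (fun x => (p + q * (gam x - c)) * dgam x)%C); auto.
  - replace (CInt (fun x : R => g (gam x) * dgam x)%C a b - CInt (fun x : R => (p + q * (gam x - c)) * dgam x)%C a b)%C
    with (CInt (fun x => g (gam x) * dgam x + -(1) * ((p + q * (gam x - c)) * dgam x))%C a b).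
    + apply CInt_le; auto.
      * intros x Hx. apply ccont_plus. now apply ccont_mult; auto.
        apply ccont_mult; auto. apply ccont_const.
      * intros x Hx. replace (g (gam x) * dgam x + - (1) * ((p + q * (gam x - c)) * dgam x))%C
          with ((g (gam x) - (p + q * (gam x - c))) * dgam x)%C by ring.
        rewrite Cmod_mult. apply Rmult_le_compat; auto using Cmod_ge_0.
    + rewrite CInt_plus; auto.
      * rewrite CInt_scal; auto. ring.
      * intros x Hx. now apply ccont_mult; auto.
      * intros x Hx. apply ccont_mult; auto. apply ccont_const.
  - intros x Hx. unfold quad_prim.
    pose proof (rdiff_plus gam (fun _ => -c)%C x _ _ (Hd x Hx) (rdiff_const _ _)) as H1.
    eapply rdiff_eq.
    + apply (rdiff_plus (fun x => p * gam x)%C (fun x => q / 2 * ((gam x - c) * (gam x - c)))%C).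
      * apply (rdiff_mult (fun _ => p) gam). apply rdiff_const. eauto.
      * apply (rdiff_mult (fun _ => q / 2)%C (fun x => (gam x - c) * (gam x - c))%C). apply rdiff_const.
        apply (rdiff_mult (fun x => gam x - c)%C (fun x => gam x - c)%C); apply H1.
    + field.
Qed.

Definition cis (t : R) : C := (cos t, sin t).

Lemma rdiff_cis (t : R) : rdiff cis t (Ci * cis t)%C.
Proof.
  split; simpl.
  - evar_last; [apply is_derive_cos|]. change (- sin t = 0 * cos t - 1 * sin t). ring.
  - evar_last; [apply is_derive_sin|]. change (cos t = 0 * sin t + 1 * cos t). ring.
Qed.

Lemma Cmod_cis (t : R) : Cmod (cis t) = 1.
Proof.
  unfold Cmod, cis; simpl. transitivity (sqrt 1); [f_equal|apply sqrt_1].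
  pose proof (sin2_cos2 t). unfold Rsqr in *. lra.
Qed.

Lemma cis_conj (t : R) : (cis t * Cconj (cis t) = 1)%C.
Proof.
  rewrite <- Cmod2_conj, Cmod_cis. f_equal. ring.
Qed.

Lemma cis_neq_0 (t : R) : cis t <> 0.
Proof. apply Cmod_gt_0. rewrite Cmod_cis. lra. Qed.

Lemma cis_lipschitz (s t : R) : Cmod (cis s - cis t)%C <= Rabs (s - t).
Proof.
  assert (H : forall a b, a <= b -> Cmod (cis b - cis a)%C <= (b - a) * 1).
  { intros a b Hab. apply curve_lipschitz with (df := fun t => (Ci * cis t)%C); auto.
    - intros; apply rdiff_cis.
    - intros x _; apply ccont_mult; [apply ccont_const|]. eapply rdiff_ccont, rdiff_cis.
    - intros x _. rewrite Cmod_mult, Cmod_Ci, Cmod_cis. lra. }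
  destruct (Rle_dec t s).
  - rewrite Rabs_pos_eq by lra. specialize (H t s). lra.
  - rewrite Cmod_minus_sym, Rabs_left by lra. specialize (H s t). lra.
Qed.

(** The integral of the form [P dl + Q dh] counterclockwise around the rectangle with corner
    [(x, y)] and sides [s], [t]. *)
Definition boundary_int (P Q : R -> R -> C) (x y s t : R) : C :=
  Cminus (Cplus (CInt (fun l => P l y) x (x + s)) (CInt (Q (x + s)) y (y + t)))
    (Cplus (CInt (fun l => P l (y + t)) x (x + s)) (CInt (Q x) y (y + t))).

(** Each inner edge is run through twice, in opposite directions. *)
Lemma boundary_int_split (P Q : R -> R -> C) (x y s t : R) :
  0 < s -> 0 < t ->
  (forall l h, x <= l <= x + s -> y <= h <= y + t -> ccont (fun l => P l h) l /\ ccont (Q l) h) ->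
  boundary_int P Q x y s t =
    Cplus (Cplus (boundary_int P Q x y (s / 2) (t / 2)) (boundary_int P Q (x + s / 2) y (s / 2) (t / 2)))
      (Cplus (boundary_int P Q x (y + t / 2) (s / 2) (t / 2))
             (boundary_int P Q (x + s / 2) (y + t / 2) (s / 2) (t / 2))).
Proof.
  intros Hs Ht Hc. unfold boundary_int.
  replace (x + s / 2 + s / 2) with (x + s) by field.
  replace (y + t / 2 + t / 2) with (y + t) by field.
  assert (HP : forall h, y <= h <= y + t ->
    CInt (fun l => P l h) x (x + s) = (CInt (fun l => P l h) x (x + s / 2)%R + CInt (fun l => P l h) (x + s / 2)%R (x + s)%R)%C).
  { intros h Hh. apply CInt_Chasles; [lra|]. intros l Hl. apply (proj1 (Hc l h Hl Hh)). }
  assert (HQ : forall l, x <= l <= x + s ->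
    CInt (Q l) y (y + t) = (CInt (Q l) y (y + t / 2)%R + CInt (Q l) (y + t / 2)%R (y + t)%R)%C).
  { intros l Hl. apply CInt_Chasles; [lra|]. intros h Hh. apply (proj2 (Hc l h Hl Hh)). }
  rewrite (HP y), (HP (y + t)), (HQ x), (HQ (x + s)) by lra.
  repeat match goal with |- context [CInt ?f ?a ?b] => generalize (CInt f a b); intro end. ring.
Qed.

(* The homothety of centre [a] and ratio [l] carries the circle of radius [rho] about 0 to
   [fun h => shrunk a rho l h]. *)
Definition spoke (a : C) (rho h : R) : C := (rho * cis h - a)%C.
Definition shrunk (a : C) (rho l h : R) : C := (a + l * spoke a rho h)%C.

Lemma rdiff_spoke (a : C) (rho h : R) : rdiff (spoke a rho) h (rho * (Ci * cis h))%C.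
Proof.
  eapply rdiff_eq.
  - apply rdiff_plus; [apply rdiff_mult; [apply rdiff_const|apply rdiff_cis]|apply rdiff_const].
  - cbv beta. ring.
Qed.

Lemma rdiff_shrunk_angle (a : C) (rho l h : R) :
  rdiff (shrunk a rho l) h (l * rho * (Ci * cis h))%C.
Proof.
  eapply rdiff_eq.
  - apply rdiff_plus; [apply rdiff_const|apply rdiff_mult; [apply rdiff_const|apply rdiff_spoke]].
  - cbv beta. ring.
Qed.

Lemma rdiff_RtoC (x : R) : rdiff RtoC x 1.
Proof.
  split.
  - change (is_derive (K := R_AbsRing) (V := R_NormedModule) (fun y : R => y) x 1). apply (is_derive_id (K := R_AbsRing)).
  - change (is_derive (K := R_AbsRing) (V := R_NormedModule) (fun y : R => 0) x 0). apply (is_derive_const (K := R_AbsRing) (V := R_NormedModule)).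
Qed.

Lemma rdiff_shrunk_ratio (a : C) (rho l h : R) :
  rdiff (fun l => shrunk a rho l h) l (spoke a rho h).
Proof.
  eapply rdiff_eq.
  - apply rdiff_plus; [apply rdiff_const|apply rdiff_mult; [apply rdiff_RtoC|apply rdiff_const]].
  - cbv beta. ring.
Qed.

Lemma Cmod_spoke_le (a : C) (rho h : R) : 0 <= rho -> Cmod (spoke a rho h) <= rho + Cmod a.
Proof.
  intros Hr. unfold spoke. eapply Rle_trans; [apply Cmod_triangle|].
  rewrite Cmod_opp, Cmod_mult, Cmod_cis, Cmod_R, Rabs_pos_eq; lra.
Qed.

Lemma shrunk_lipschitz (a : C) (rho l h u v : R) : 0 <= rho -> 0 <= u <= 1 ->
  Cmod (shrunk a rho l h - shrunk a rho u v)%C <= (rho + Cmod a) * (Rabs (l - u) + Rabs (h - v)).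
Proof.
  intros Hr Hu.
  replace (shrunk a rho l h - shrunk a rho u v)%C
    with (RtoC (l - u) * spoke a rho h + u * (rho * (cis h - cis v)))%C.
  2: { unfold shrunk, spoke. rewrite RtoC_minus. ring. }
  eapply Rle_trans; [apply Cmod_triangle|]. rewrite !Cmod_mult, !Cmod_R.
  rewrite (Rabs_pos_eq u), (Rabs_pos_eq rho) by lra.
  pose proof (Cmod_spoke_le a rho h Hr). pose proof (cis_lipschitz h v).
  pose proof (Cmod_ge_0 a). pose proof (Rabs_pos (l - u)). pose proof (Rabs_pos (h - v)).
  pose proof (Cmod_ge_0 (cis h - cis v)%C).
  assert (Rabs (l - u) * Cmod (spoke a rho h) <= Rabs (l - u) * (rho + Cmod a)) by (apply Rmult_le_compat_l; auto).
  assert (rho * Cmod (cis h - cis v)%C <= rho * Rabs (h - v)) by (apply Rmult_le_compat_l; auto).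
  assert (0 <= rho * Cmod (cis h - cis v)%C) by (apply Rmult_le_pos; auto).
  assert (0 <= Cmod a * Rabs (h - v)) by (apply Rmult_le_pos; auto).
  nra.
Qed.

(** The form [g(z) dz] is pulled back to the rectangle of parameters, where [goursat] makes its
    boundary integral vanish. The edges at angles 0 and [2 * PI] cancel by periodicity, leaving the
    two circles. The ratio stays at least [l0 > 0] because [g] will be a difference quotient,
    singular at [a]. *)
Lemma circle_shrink (g : C -> C) (a : C) (rho l0 : R) : 0 < rho -> 0 < l0 < 1 ->
  (forall l h, l0 <= l <= 1 -> exists k, cdiff g (shrunk a rho l h) k) ->
  CInt (fun h => g (rho * cis h) * (rho * (Ci * cis h)))%C 0 (2 * PI) =
  CInt (fun h => g (shrunk a rho l0 h) * (l0 * rho * (Ci * cis h)))%C 0 (2 * PI).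
Proof.
  intros Hr Hl0 Hg.
  pose proof PI_RGT_0 as HPI.
  set (P := fun l h => (g (shrunk a rho l h) * spoke a rho h)%C).
  set (Q := fun l h => (g (shrunk a rho l h) * (l * rho * (Ci * cis h)))%C).
  assert (HgP : forall l h, l0 <= l <= 1 -> ccont (fun l => g (shrunk a rho l h)) l).
  { intros l h Hl. destruct (Hg l h Hl) as [k Hk].
    eapply ccont_cdiff_comp with (g := fun l => shrunk a rho l h); eauto. eapply rdiff_ccont, rdiff_shrunk_ratio. }
  assert (HgQ : forall l h, l0 <= l <= 1 -> ccont (fun h => g (shrunk a rho l h)) h).
  { intros l h Hl. destruct (Hg l h Hl) as [k Hk].
    eapply ccont_cdiff_comp; eauto. eapply rdiff_ccont, rdiff_shrunk_angle. }
  assert (HdP : forall h x, ccont (fun _ : R => spoke a rho h) x) by (intros; apply ccont_const).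
  assert (HdQ : forall (l : R) h, ccont (fun h => l * rho * (Ci * cis h))%C h).
  { intros. apply ccont_mult; [apply ccont_const|]. apply ccont_mult; [apply ccont_const|].
    eapply rdiff_ccont, rdiff_cis. }
  set (W := rho + Cmod a).
  assert (HW : 0 < W) by (pose proof (Cmod_ge_0 a); unfold W; lra).
  assert (HdPb : forall h, Cmod (spoke a rho h) <= W) by (intros; apply Cmod_spoke_le; lra).
  assert (HdQb : forall (l : R) h, l0 <= l <= 1 -> Cmod (l * rho * (Ci * cis h))%C <= W).
  { intros l h Hl. rewrite !Cmod_mult, !Cmod_R, Cmod_Ci, Cmod_cis, !Rabs_pos_eq by lra.
    pose proof (Cmod_ge_0 a). unfold W. nra. }
  assert (HJ : boundary_int P Q l0 0 (1 - l0) (2 * PI) = 0).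
  { apply goursat; [lra|lra| |].
    - intros x y s t Hs Ht A1 A2 A3 A4. apply boundary_int_split; auto.
      intros l h Hl Hh. split.
      + apply ccont_mult; auto. apply HgP. lra.
      + apply ccont_mult; auto. apply HgQ. lra.
    - intros u v eps Hu Hv Heps.
      destruct (Hg u v) as [k Hk]; [lra|].
      set (zs := shrunk a rho u v) in *.
      (* The four edges have errors [s] or [t] times [e1 * W ^ 2 * (s + t)], each occurring twice;
         the sum is [2 * e1 * W ^ 2 * (s + t) ^ 2]. *)
      set (e1 := eps / (2 * W ^ 2)).
      assert (HW2 : 0 < W ^ 2) by (apply pow_lt; auto).
      assert (He1 : 0 < e1) by (apply Rdiv_lt_0_compat; lra).
      destruct (Hk e1 He1) as [d [Hd Hdd]].
      exists (d / W). split; [now apply Rdiv_lt_0_compat|].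
      intros x y s t Hs Ht Hst A1 A2 A3 A4 Hxu Hyv.
      assert (HWst : W * (s + t) < d).
      { apply Rmult_lt_compat_l with (r := W) in Hst; auto.
        replace (W * (d / W)) with d in Hst by (field; lra). exact Hst. }
      assert (HE : forall l h, x <= l <= x + s -> y <= h <= y + t ->
        Cmod (g (shrunk a rho l h) - (g zs + k * (shrunk a rho l h - zs)))%C <= e1 * (W * (s + t))).
      { intros l h Hl Hh.
        assert (Hdist : Cmod (shrunk a rho l h - zs)%C <= W * (s + t)).
        { eapply Rle_trans; [apply shrunk_lipschitz; lra|]. fold W.
          apply Rmult_le_compat_l; [lra|]. apply Rplus_le_compat; apply Rabs_le; lra. }
        replace (g (shrunk a rho l h) - (g zs + k * (shrunk a rho l h - zs)))%C
          with (g (shrunk a rho l h) - g zs - k * (shrunk a rho l h - zs))%C by ring.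
        eapply Rle_trans; [apply Hdd; lra|]. apply Rmult_le_compat_l; lra. }
      assert (EP : forall h, y <= h <= y + t ->
        Cmod (CInt (fun l => P l h) x (x + s)%R - (quad_prim (g zs) k zs (shrunk a rho (x + s) h)
          - quad_prim (g zs) k zs (shrunk a rho x h)))%C <= s * (e1 * (W * (s + t)) * W)).
      { intros h Hh. replace s with (x + s - x) at 3 by ring.
        apply path_integral_close with (g := g) (gam := fun l => shrunk a rho l h) (dgam := fun _ => spoke a rho h); auto.
        - lra.
        - intros; apply rdiff_shrunk_ratio.
        - intros l Hl; apply HdP.
        - intros l Hl; apply HgP; lra. }
      assert (EQ : forall l, x <= l <= x + s ->
        Cmod (CInt (Q l) y (y + t)%R - (quad_prim (g zs) k zs (shrunk a rho l (y + t))
          - quad_prim (g zs) k zs (shrunk a rho l y)))%C <= t * (e1 * (W * (s + t)) * W)).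
      { intros l Hl. replace t with (y + t - y) at 3 by ring.
        apply path_integral_close with (g := g) (gam := shrunk a rho l) (dgam := fun h => (l * rho * (Ci * cis h))%C); auto.
        - lra.
        - intros; apply rdiff_shrunk_angle.
        - intros h Hh; apply HdQ.
        - intros h Hh; apply HgQ; lra.
        - intros h Hh; apply HdQb; lra. }
      pose proof (EP y ltac:(lra)) as E1. pose proof (EP (y + t) ltac:(lra)) as E2.
      pose proof (EQ x ltac:(lra)) as E3. pose proof (EQ (x + s) ltac:(lra)) as E4.
      unfold boundary_int.
      (* Around the closed boundary the corner values of [quad_prim] cancel, so the boundary
         integral is a combination of the four errors alone. *)
      match type of E1 with Cmod ?X1 <= _ => match type of E2 with Cmod ?X2 <= _ =>
      match type of E3 with Cmod ?X3 <= _ => match type of E4 with Cmod ?X4 <= _ =>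
        match goal with |- Cmod ?X <= _ => replace X with (X1 + X4 - (X2 + X3))%C by (unfold Cminus; ring) end;
        pose proof (Cmod_triangle (X1 + X4) (- (X2 + X3)))%C as T1; rewrite Cmod_opp in T1;
        pose proof (Cmod_triangle X1 X4) as T2; pose proof (Cmod_triangle X2 X3) as T3
      end end end end.
      replace (eps * (s + t) ^ 2) with (2 * (s * (e1 * (W * (s + t)) * W)) + 2 * (t * (e1 * (W * (s + t)) * W))).
      2: { unfold e1. field. lra. }
      unfold Cminus in *. lra. }
  unfold boundary_int in HJ.
  replace (l0 + (1 - l0)) with 1 in HJ by ring. rewrite Rplus_0_l in HJ.
  assert (Hcis : cis (2 * PI) = cis 0) by (unfold cis; rewrite cos_2PI, sin_2PI, cos_0, sin_0; reflexivity).
  assert (HP2 : CInt (fun l => P l (2 * PI)) l0 1 = CInt (fun l => P l 0) l0 1).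
  { apply CInt_ext; [lra|]. intros l _. unfold P, shrunk, spoke. now rewrite Hcis. }
  rewrite HP2 in HJ.
  assert (HQ1 : CInt (fun h => g (rho * cis h) * (rho * (Ci * cis h)))%C 0 (2 * PI) = CInt (Q 1) 0 (2 * PI)).
  { apply CInt_ext; [lra|]. intros h _. unfold Q, shrunk, spoke. f_equal; [f_equal; ring|ring]. }
  rewrite HQ1. apply Ceq_0_minus. rewrite <- HJ. unfold Q. ring.
Qed.

(** * Cauchy's formula and its consequences *)

Lemma ccont_cis (h : R) : ccont cis h.
Proof. eapply rdiff_ccont, rdiff_cis. Qed.

Lemma Cmod_circle (rho h : R) : 0 <= rho -> Cmod (rho * cis h)%C = rho.
Proof. intros. rewrite Cmod_mult, Cmod_cis, Cmod_R, Rabs_pos_eq; lra. Qed.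

Lemma circle_sub_ge (rho h : R) (a : C) : 0 <= rho -> rho - Cmod a <= Cmod (rho * cis h - a)%C.
Proof.
  intros Hr. pose proof (Cmod_sub_le (rho * cis h)%C a). rewrite Cmod_circle in H by auto. lra.
Qed.

Lemma circle_neq (rho h : R) (a : C) : Cmod a < rho -> (rho * cis h - a)%C <> 0.
Proof.
  intros Ha. apply Cmod_gt_0. pose proof (Cmod_ge_0 a). pose proof (circle_sub_ge rho h a). lra.
Qed.

Lemma ccont_inv (f : R -> C) (x : R) : f x <> 0 -> ccont f x -> ccont (fun y => / f y)%C x.
Proof.
  intros Hx Hf. apply (ccont_cdiff_comp Cinv f x (- / (f x * f x))%C); auto. now apply cdiff_inv.
Qed.

(** For [z = rho * cis h] this is the density in [h] of the form [dz / (Ci * (z - a))]. *)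
Definition cauchy_kernel (rho : R) (a : C) (h : R) : C := (rho * cis h / (rho * cis h - a))%C.

Lemma ccont_circle (rho h : R) : ccont (fun h => rho * cis h)%C h.
Proof. apply ccont_mult; [apply ccont_const|apply ccont_cis]. Qed.

Lemma ccont_cauchy_kernel (rho : R) (a : C) (h : R) : Cmod a < rho -> ccont (cauchy_kernel rho a) h.
Proof.
  intros Ha. apply ccont_mult; [apply ccont_circle|].
  apply (ccont_inv (fun h => rho * cis h - a)%C); [now apply circle_neq|].
  apply ccont_plus; [apply ccont_circle|apply ccont_const].
Qed.

Definition holo_ball (f : C -> C) (rho : R) : Prop :=
  forall z, Cmod z <= rho -> exists k, cdiff f z k.

Lemma holo_ball_ccont (f : C -> C) (rho h : R) : 0 <= rho -> holo_ball f rho -> ccont (fun h => f (rho * cis h)%C) h.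
Proof.
  intros Hr Hf. destruct (Hf (rho * cis h)%C) as [k Hk]. { rewrite Cmod_circle; lra. }
  eapply (ccont_cdiff_comp f (fun h => rho * cis h)%C); eauto. apply ccont_circle.
Qed.

(** The difference quotient of [f] at [a] stays bounded near [a], so its integral over the circle
    shrunk by [l] is of order [l]; it does not depend on [l], hence it is 0. The mean of the kernel
    is left as a factor, to be evaluated afterwards by this same lemma. *)
Lemma cauchy_theorem (f : C -> C) (rho : R) (a : C) : holo_ball f rho -> Cmod a < rho ->
  CInt (fun h => f (rho * cis h) * cauchy_kernel rho a h)%C 0 (2 * PI) =
  (f a * CInt (cauchy_kernel rho a) 0 (2 * PI)%R)%C.
Proof.
  intros Hf Ha.
  pose proof (Cmod_ge_0 a) as Ha0. pose proof PI_RGT_0 as HPI.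
  assert (Hr : 0 < rho) by lra.
  set (g := fun z => ((f z - f a) / (z - a))%C).
  assert (Hsp : forall h, spoke a rho h <> 0) by (intros; now apply circle_neq).
  assert (Hg : forall l h, 0 < l <= 1 -> exists k, cdiff g (shrunk a rho l h) k).
  { intros l h Hl. destruct (Hf (shrunk a rho l h)) as [k Hk].
    - unfold shrunk, spoke. replace (a + l * (rho * cis h - a))%C with (RtoC (1 - l) * a + l * (rho * cis h))%C
        by (rewrite RtoC_minus; ring).
      eapply Rle_trans; [apply Cmod_triangle|]. rewrite (Cmod_mult (RtoC (1 - l))), (Cmod_mult (RtoC l)).
      rewrite Cmod_circle, !Cmod_R, !Rabs_pos_eq by lra. nra.
    - eapply cdiff_div.
      + unfold shrunk. replace (a + l * spoke a rho h - a)%C with (l * spoke a rho h)%C by ring.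
        apply Cmult_neq_0; auto. apply RtoC_neq. lra.
      + apply cdiff_plus; [exact Hk|apply cdiff_const].
      + apply cdiff_plus; [apply cdiff_id|apply cdiff_const]. }
  destruct (Hf a) as [k Hk]; [lra|].
  destruct (cdiff_lip _ _ _ Hk) as [d [Hd Hlip]].
  set (B := Cmod k + 1) in *.
  assert (HB : 0 < B) by (pose proof (Cmod_ge_0 k); unfold B; lra).
  set (X := CInt (fun h => g (rho * cis h) * (rho * (Ci * cis h)))%C 0 (2 * PI)).
  set (W := rho + Cmod a). assert (HW : 0 < W) by (unfold W; lra).
  assert (HX : forall l, 0 < l < 1 -> l * W < d -> Cmod X <= 2 * PI * (B * (l * rho))).
  { intros l Hl HlW. unfold X. rewrite (circle_shrink g a rho l); auto.
    2: { intros; apply Hg; lra. }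
    replace (2 * PI) with (2 * PI - 0) at 2 by ring. apply CInt_le; [lra| |].
    - intros h _. destruct (Hg l h) as [k' Hk']; [lra|]. apply ccont_mult.
      + eapply ccont_cdiff_comp; eauto. eapply rdiff_ccont, rdiff_shrunk_angle.
      + apply ccont_mult; [apply ccont_const|apply ccont_mult; [apply ccont_const|apply ccont_cis]].
    - intros h _. rewrite Cmod_mult. apply Rmult_le_compat; auto using Cmod_ge_0.
      + unfold g. rewrite Cmod_div.
        2: { unfold shrunk. replace (a + l * spoke a rho h - a)%C with (l * spoke a rho h)%C by ring.
             apply Cmult_neq_0; auto. apply RtoC_neq. lra. }
        assert (Hp : 0 < Cmod (shrunk a rho l h - a)%C).
        { unfold shrunk. replace (a + l * spoke a rho h - a)%C with (l * spoke a rho h)%C by ring.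
          apply Cmod_gt_0. apply Cmult_neq_0; auto. apply RtoC_neq. lra. }
        apply Rmult_le_reg_r with (1 := Hp). unfold Rdiv. rewrite Rmult_assoc, Rinv_l, Rmult_1_r by lra.
        apply Hlip. unfold shrunk. replace (a + l * spoke a rho h - a)%C with (l * spoke a rho h)%C by ring.
        rewrite Cmod_mult, Cmod_R, Rabs_pos_eq by lra.
        pose proof (Cmod_spoke_le a rho h). fold W in H. nra.
      + rewrite !Cmod_mult, !Cmod_R, Cmod_Ci, Cmod_cis, !Rabs_pos_eq by lra. lra. }
  assert (HX0 : X = 0).
  { apply Cmod_eq_0. apply NNPP. intros Hne.
    assert (Hpos : 0 < Cmod X) by (pose proof (Cmod_ge_0 X); lra).
    (* The three entries make [l] less than 1, bring the shrunk circle into the range of [Hlip], and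
       push the bound in [HX] down to half of [Cmod X]. *)
    set (l := Rmin (1 / 2) (Rmin (d / (2 * W)) (Cmod X / (4 * PI * B * rho)))).
    assert (HD : 0 < 4 * PI * B * rho)
      by (apply Rmult_lt_0_compat; [apply Rmult_lt_0_compat; lra|lra]).
    assert (Hl0 : 0 < l). { repeat apply Rmin_pos; try lra; apply Rdiv_lt_0_compat; lra. }
    assert (Hl1 : l <= 1 / 2) by apply Rmin_l.
    assert (Hl2 : l <= d / (2 * W)) by (eapply Rle_trans; [apply Rmin_r|apply Rmin_l]).
    assert (Hl3 : l <= Cmod X / (4 * PI * B * rho)) by (eapply Rle_trans; [apply Rmin_r|apply Rmin_r]).
    assert (Hm : l * W < d).
    { apply Rmult_le_compat_r with (r := W) in Hl2; [|lra].
      replace (d / (2 * W) * W) with (d / 2) in Hl2 by (field; lra). lra. }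
    specialize (HX l ltac:(lra) Hm).
    apply Rmult_le_compat_r with (r := 4 * PI * B * rho) in Hl3; [|lra].
    replace (Cmod X / (4 * PI * B * rho) * (4 * PI * B * rho)) with (Cmod X) in Hl3 by (field; lra).
    replace (2 * PI * (B * (l * rho))) with (l * (4 * PI * B * rho) / 2) in HX by field. lra. }
  assert (Hk1 : ccont_on (cauchy_kernel rho a) 0 (2 * PI)) by (intros h _; now apply ccont_cauchy_kernel).
  assert (Hfk : ccont_on (fun h => f (rho * cis h) * cauchy_kernel rho a h)%C 0 (2 * PI)).
  { intros h Hh. apply ccont_mult; auto. apply holo_ball_ccont; auto; lra. }
  apply Ceq_0_minus.
  replace (CInt (fun h => f (rho * cis h) * cauchy_kernel rho a h)%C 0 (2 * PI) - f a * CInt (cauchy_kernel rho a) 0 (2 * PI)%R)%C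
    with (CInt (fun h => f (rho * cis h) * cauchy_kernel rho a h + - f a * cauchy_kernel rho a h)%C 0 (2 * PI)%R).
  2: { rewrite CInt_plus; try lra; auto. rewrite CInt_scal; try lra; auto. ring.
       intros h Hh. apply ccont_mult; auto. apply ccont_const. }
  replace (CInt (fun h => f (rho * cis h) * cauchy_kernel rho a h + - f a * cauchy_kernel rho a h)%C 0 (2 * PI)%R)
    with (- Ci * X)%C. { rewrite HX0. ring. }
  unfold X. rewrite <- CInt_scal; [|lra|].
  - apply CInt_ext; [lra|]. intros h _. unfold g, cauchy_kernel.
    assert (E : (Ci * Ci = - (1))%C) by (unfold Ci, Cmult, RtoC, Copp; simpl; f_equal; ring).
    pose proof (circle_neq rho h a Ha).
    replace (- Ci * ((f (rho * cis h) - f a) / (rho * cis h - a) * (rho * (Ci * cis h))))%C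
     with (- (Ci * Ci) * ((f (rho * cis h) - f a) / (rho * cis h - a) * (rho * cis h)))%C by ring.
    rewrite E. field. auto.
  - intros h _. destruct (Hg 1 h) as [k' Hk']; [lra|]. apply ccont_mult.
    + replace (shrunk a rho 1 h) with (rho * cis h)%C in Hk' by (unfold shrunk, spoke; ring).
      eapply (ccont_cdiff_comp g (fun h => rho * cis h)%C); eauto. apply ccont_circle.
    + apply ccont_mult; [apply ccont_const|apply ccont_mult; [apply ccont_const|apply ccont_cis]].
Qed.

(* Conjugating the kernel on the circle gives [1 / (1 - z conj a / rho^2)], which is holomorphic
   on the closed disk, so its mean is its value at 0. *)
Lemma CInt_cauchy_kernel (rho : R) (a : C) : Cmod a < rho ->
  CInt (cauchy_kernel rho a) 0 (2 * PI) = RtoC (2 * PI).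
Proof.
  intros Ha. pose proof (Cmod_ge_0 a) as Ha0. pose proof PI_RGT_0 as HPI.
  assert (Hrho : RtoC rho <> 0) by (apply RtoC_neq; lra).
  set (k := fun z => (/ (1 - Cconj a / (rho * rho) * z))%C).
  assert (Hnz : forall z, Cmod z <= rho -> (1 - Cconj a / (rho * rho) * z)%C <> 0).
  { intros z Hz E. assert (H1 : (Cconj a / (rho * rho) * z)%C = 1) by (symmetry; apply Ceq_0_minus; exact E).
    apply (f_equal Cmod) in H1. rewrite Cmod_1, Cmod_mult, Cmod_div, Cmod_mult, Cmod_conj, Cmod_R, Rabs_pos_eq in H1
      by (try lra; apply Cmult_neq_0; auto).
    assert (Cmod a / (rho * rho) * Cmod z <= Cmod a / (rho * rho) * rho).
    { apply Rmult_le_compat_l; auto. apply Rdiv_le_0_compat; nra. }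
    replace (Cmod a / (rho * rho) * rho) with (Cmod a / rho) in H by (field; lra).
    assert (Cmod a / rho < 1). { apply Rmult_lt_reg_r with rho; [lra|]. unfold Rdiv. rewrite Rmult_assoc, Rinv_l; lra. }
    lra. }
  assert (Hk : holo_ball k rho).
  { intros z Hz. eexists. apply (cdiff_comp Cinv (fun z => 1 - Cconj a / (rho * rho) * z)%C).
    - apply cdiff_inv; auto.
    - apply (cdiff_plus (fun _ => RtoC 1) (fun z => - (Cconj a / (rho * rho) * z))%C).
      + apply cdiff_const.
      + eapply (cdiff_ext_loc (fun z => (- (Cconj a / (rho * rho))) * z)%C) with (d := 1); [lra| |].
        * intros. ring.
        * apply cdiff_mult; [apply cdiff_const|apply cdiff_id]. }
  assert (H0 : Cmod 0 < rho) by (rewrite Cmod_0; lra).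
  pose proof (cauchy_theorem k rho 0 Hk H0) as HC.
  assert (E0 : forall h, cauchy_kernel rho 0 h = 1).
  { intros h. unfold cauchy_kernel. pose proof (circle_neq rho h 0 H0).
    replace (rho * cis h - 0)%C with (rho * cis h)%C in * by ring. field. split; [apply cis_neq_0|auto]. }
  rewrite (CInt_ext (cauchy_kernel rho 0) (fun _ => RtoC 1)) in HC by (auto; lra).
  rewrite CInt_const in HC.
  replace (k 0) with (RtoC 1) in HC.
  2: { unfold k. field. auto. }
  apply (f_equal Cconj) in HC.
  rewrite <- CInt_conj in HC; [|lra|].
  - rewrite <- (CInt_ext (cauchy_kernel rho a)) in HC; [rewrite HC|lra|].
    + rewrite Rminus_0_r. unfold Cconj, Cmult, RtoC; simpl. f_equal; ring.
    + intros h _. rewrite E0. unfold k, cauchy_kernel.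
      pose proof (circle_neq rho h a Ha) as Hn.
      assert (Hz : Cmod (rho * cis h)%C <= rho) by (rewrite Cmod_circle; lra).
      pose proof (Hnz _ Hz) as Hn2.
      rewrite Cmult_1_r, Cinv_conj by auto.
      pose proof (cis_conj h) as Hc.
      assert (Hcc : Cconj (1 - Cconj a / (rho * rho) * (rho * cis h))%C = ((rho * cis h - a) * / (rho * cis h))%C).
      { replace (Cconj a / (rho * rho) * (rho * cis h))%C with (RtoC (/ rho) * (Cconj a * cis h))%C
          by (rewrite RtoC_inv by lra; field; auto).
        rewrite Cminus_conj, !Cmult_conj, Cconj_conj.
        replace (Cconj (RtoC (/ rho))) with (RtoC (/ rho)) by (unfold Cconj, RtoC; simpl; f_equal; ring).
        replace (Cconj (RtoC 1)) with (RtoC 1) by (unfold Cconj, RtoC; simpl; f_equal; ring).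
        assert (Hci : Cconj (cis h) = (/ cis h)%C).
        { replace (/ cis h)%C with (/ cis h * (cis h * Cconj (cis h)))%C by (rewrite Hc; ring). field. apply cis_neq_0. }
        rewrite Hci, RtoC_inv by lra. field. split; [apply cis_neq_0|auto]. }
      rewrite Hcc. field. repeat split; auto. apply cis_neq_0.
  - intros h _. apply ccont_mult.
    + apply holo_ball_ccont; auto; lra.
    + now apply ccont_cauchy_kernel.
Qed.

Lemma cauchy_formula (f : C -> C) (rho : R) (a : C) : holo_ball f rho -> Cmod a < rho ->
  CInt (fun h => f (rho * cis h) * cauchy_kernel rho a h)%C 0 (2 * PI) = (RtoC (2 * PI) * f a)%C.
Proof.
  intros Hf Ha. rewrite cauchy_theorem, CInt_cauchy_kernel; auto. ring.
Qed.

Lemma cauchy_bound (f : C -> C) (rho M : R) (a : C) : holo_ball f rho -> Cmod a < rho ->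
  (forall h, 0 <= h <= 2 * PI -> Cmod (f (rho * cis h)%C) <= M) -> Cmod (f a) <= M * (rho / (rho - Cmod a)).
Proof.
  intros Hf Ha HM. pose proof (Cmod_ge_0 a) as Ha0. pose proof PI_RGT_0 as HPI.
  assert (HM0 : 0 <= M) by (eapply Rle_trans; [apply Cmod_ge_0|apply (HM 0); pose proof PI_RGT_0; lra]).
  pose proof (cauchy_formula f rho a Hf Ha) as HC.
  apply (f_equal Cmod) in HC. rewrite Cmod_mult, Cmod_R, Rabs_pos_eq in HC by lra.
  assert (Hb : Cmod (CInt (fun h => f (rho * cis h) * cauchy_kernel rho a h)%C 0 (2 * PI)) <=
    (2 * PI - 0) * (M * (rho / (rho - Cmod a)))).
  { apply CInt_le; [lra| |].
    - intros h _. apply ccont_mult; [apply holo_ball_ccont; auto; lra|now apply ccont_cauchy_kernel].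
    - intros h Hh. rewrite Cmod_mult. apply Rmult_le_compat; auto using Cmod_ge_0.
      unfold cauchy_kernel. rewrite Cmod_div by now apply circle_neq.
      rewrite Cmod_circle by lra. apply Rmult_le_compat_l; [lra|].
      apply Rinv_le_contravar; [lra|]. apply circle_sub_ge; lra. }
  rewrite HC in Hb. rewrite Rminus_0_r in Hb. apply Rmult_le_reg_l in Hb; lra.
Qed.

Lemma cdiff_pow (f : C -> C) (z l : C) (n : nat) : cdiff f z l -> exists k, cdiff (fun w => f w ^ n)%C z k.
Proof.
  intros Hf. induction n as [|n [k Hk]].
  - exists 0. apply (cdiff_const 1).
  - eexists. apply (cdiff_mult f (fun w => f w ^ n)%C z); eauto.
Qed.

(* Applying the crude bound to the powers of [f] removes the constant. *)
Lemma maximum_principle (f : C -> C) (rho M : R) (a : C) : holo_ball f rho -> Cmod a < rho ->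
  (forall h, 0 <= h <= 2 * PI -> Cmod (f (rho * cis h)%C) <= M) -> Cmod (f a) <= M.
Proof.
  intros Hf Ha HM. pose proof (Cmod_ge_0 a) as Ha0.
  assert (HM0 : 0 <= M) by (eapply Rle_trans; [apply Cmod_ge_0|apply (HM 0); pose proof PI_RGT_0; lra]).
  set (c := rho / (rho - Cmod a)).
  assert (Hc : 0 < c) by (apply Rdiv_lt_0_compat; lra).
  assert (Hn : forall n, Cmod (f a) ^ n <= M ^ n * c).
  { intros n. rewrite <- Cmod_pow. apply (cauchy_bound (fun z => f z ^ n)%C rho (M ^ n) a); auto.
    - intros z Hz. destruct (Hf z Hz) as [k Hk]. eapply cdiff_pow; eauto.
    - intros h Hh. rewrite Cmod_pow. apply pow_incr. split; auto using Cmod_ge_0. }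
  apply Rnot_lt_le. intros Hlt.
  destruct (Req_dec M 0) as [->|HMn].
  { specialize (Hn 1%nat). simpl in Hn. lra. }
  assert (HMp : 0 < M) by lra.
  set (y := Cmod (f a) / M - 1).
  assert (Hy : 0 < y).
  { unfold y. apply Rmult_lt_compat_r with (r := / M) in Hlt; [|now apply Rinv_0_lt_compat].
    rewrite Rinv_r in Hlt by lra. unfold Rdiv. lra. }
  destruct (INR_archimed y c) as [n Hnn]; auto.
  specialize (Hn n). pose proof (poly n y Hy) as Hp.
  replace (Cmod (f a)) with (M * (1 + y)) in Hn by (unfold y; field; lra).
  rewrite Rpow_mult_distr in Hn. apply Rmult_le_reg_l in Hn; [|now apply pow_lt].
  lra.
Qed.

(** * Taylor estimates, removable singularities and Schwarz's lemma *)

Lemma CInt_lincomb (c2 c3 c4 : C) (F1 F2 F3 F4 : R -> C) (a b : R) : a <= b ->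
  (forall h, ccont F1 h) -> (forall h, ccont F2 h) -> (forall h, ccont F3 h) -> (forall h, ccont F4 h) ->
  CInt (fun h => F1 h + (c2 * F2 h + (c3 * F3 h + c4 * F4 h)))%C a b =
  (CInt F1 a b + (c2 * CInt F2 a b + (c3 * CInt F3 a b + c4 * CInt F4 a b)))%C.
Proof.
  intros Hab C1 C2 C3 C4.
  assert (cs : forall (c : C) phi, (forall h, ccont phi h) -> forall h, ccont (fun h => c * phi h)%C h)
    by (intros; apply ccont_mult; auto; apply ccont_const).
  rewrite (CInt_plus F1 (fun h => c2 * F2 h + (c3 * F3 h + c4 * F4 h))%C); auto.
  2,3: intros h _; auto.
  2: apply (ccont_plus (fun h => c2 * F2 h)%C (fun h => c3 * F3 h + c4 * F4 h)%C); auto;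
     apply (ccont_plus (fun h => c3 * F3 h)%C (fun h => c4 * F4 h)%C); auto.
  rewrite (CInt_plus (fun h => c2 * F2 h)%C (fun h => c3 * F3 h + c4 * F4 h)%C); auto.
  2,3: intros h _; auto.
  2: apply (ccont_plus (fun h => c3 * F3 h)%C (fun h => c4 * F4 h)%C); auto.
  rewrite (CInt_plus (fun h => c3 * F3 h)%C (fun h => c4 * F4 h)%C); auto.
  2,3: intros h _; auto.
  rewrite !CInt_scal; auto; intros h _; auto.
Qed.

(** Cauchy's formula with the kernel expanded in powers of [b / zeta] up to degree 2. The
    coefficients are means of [f(zeta) / zeta] and [f(zeta) / zeta ^ 2]; the remainder of the kernel
    is [b ^ 3 / (zeta ^ 2 * (zeta - b))], where [Cmod (zeta - b) >= rho / 2]. *)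
Lemma taylor3 (f : C -> C) (rho M : R) : 0 < rho -> holo_ball f rho ->
  (forall h, Cmod (f (rho * cis h)%C) <= M) ->
  exists f1 f2, Cmod f1 <= M / rho /\ Cmod f2 <= M / rho ^ 2 /\
    forall b, Cmod b <= rho / 2 ->
      Cmod (f b - f 0 - b * f1 - b * b * f2)%C <= 2 * M * Cmod b ^ 3 / rho ^ 3.
Proof.
  intros Hr Hf HM. pose proof PI_RGT_0 as HPI.
  assert (HM0 : 0 <= M) by (eapply Rle_trans; [apply Cmod_ge_0|apply (HM 0)]).
  assert (Hz : forall h, (rho * cis h)%C <> 0).
  { intros h. apply Cmod_gt_0. rewrite Cmod_circle; lra. }
  set (F := fun h => f (rho * cis h)%C).
  assert (HF : forall h, ccont F h) by (intros; apply holo_ball_ccont; auto; lra).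
  set (Z := fun h => (/ (rho * cis h))%C).
  assert (HZ : forall h, ccont Z h) by (intros; apply (ccont_inv (fun h => rho * cis h)%C); [auto|apply ccont_circle]).
  assert (HZm : forall h, Cmod (Z h) = / rho) by (intros; unfold Z; rewrite Cmod_inv, Cmod_circle by (auto; lra); auto).
  assert (H2PI : RtoC (2 * PI) <> 0) by (apply RtoC_neq; lra).
  set (D := fun I : C => (/ RtoC (2 * PI) * I)%C).
  assert (HD : forall phi N, (forall h, ccont phi h) -> (forall h, Cmod (phi h) <= N) ->
    Cmod (D (CInt phi 0 (2 * PI))) <= N).
  { intros phi N Hc HN. unfold D. rewrite Cmod_mult, Cmod_inv, Cmod_R, Rabs_pos_eq by (auto; lra).
    assert (Cmod (CInt phi 0 (2 * PI)) <= (2 * PI - 0) * N) by (apply CInt_le; [lra|intros x _; auto|intros; auto]).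
    apply Rmult_le_reg_l with (2 * PI); [lra|]. rewrite <- Rmult_assoc, Rinv_r by lra. lra. }
  exists (D (CInt (fun h => F h * Z h)%C 0 (2 * PI))), (D (CInt (fun h => F h * (Z h * Z h))%C 0 (2 * PI))).
  split; [|split].
  - apply HD; intros h; [now apply ccont_mult|]. rewrite Cmod_mult, HZm. unfold Rdiv.
    apply Rmult_le_compat_r; [apply Rlt_le, Rinv_0_lt_compat; lra|apply HM].
  - apply HD; intros h; [apply ccont_mult; auto; now apply ccont_mult|]. rewrite !Cmod_mult, HZm.
    replace (M / rho ^ 2) with (M * (/ rho * / rho)) by (field; lra).
    apply Rmult_le_compat_r; [|apply HM]. apply Rlt_le, Rmult_lt_0_compat; apply Rinv_0_lt_compat; lra.
  - intros b Hb.
    pose proof (Cmod_ge_0 b) as Hb0.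
    assert (Hb1 : Cmod b < rho) by lra.
    assert (H00 : Cmod 0 < rho) by (rewrite Cmod_0; lra).
    pose proof (cauchy_formula f rho b Hf Hb1) as Cb.
    pose proof (cauchy_formula f rho 0 Hf H00) as C0.
    rewrite (CInt_ext _ F) in C0; [|lra|].
    2: { intros h _. unfold F, cauchy_kernel. replace (rho * cis h - 0)%C with (rho * cis h)%C by ring.
         field. split; [apply cis_neq_0|apply RtoC_neq; lra]. }
    set (K := cauchy_kernel rho b) in *.
    assert (HK : forall h, ccont K h) by (intros; now apply ccont_cauchy_kernel).
    assert (E : (f b - f 0 - b * D (CInt (fun h => F h * Z h)%C 0 (2 * PI)%R)
       - b * b * D (CInt (fun h => F h * (Z h * Z h))%C 0 (2 * PI)%R))%C =
       D (CInt (fun h => F h * K h + (- (1) * F h + (- b * (F h * Z h) + - (b * b) * (F h * (Z h * Z h)))))%C 0 (2 * PI))).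
    { assert (c1 : forall h, ccont (fun h => F h * K h)%C h) by (intros; now apply ccont_mult).
      assert (c3 : forall h, ccont (fun h => F h * Z h)%C h) by (intros; now apply ccont_mult).
      assert (c4 : forall h, ccont (fun h => F h * (Z h * Z h))%C h) by (intros; apply ccont_mult; auto; now apply ccont_mult).
      rewrite (CInt_lincomb (- (1))%C (- b)%C (- (b * b))%C (fun h => F h * K h)%C F (fun h => F h * Z h)%C
        (fun h => F h * (Z h * Z h))%C); auto; [|lra].
      change (fun h : R => (F h * K h)%C) with (fun h : R => (f (rho * cis h)%C * K h)%C).
      rewrite Cb, C0. unfold D. field. exact H2PI. }
    rewrite E. apply HD.
    + intros h. apply ccont_plus; [now apply ccont_mult|].
      apply ccont_plus; [now apply ccont_mult; [apply ccont_const|]|].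
      apply ccont_plus; (apply ccont_mult; [apply ccont_const|]); apply ccont_mult; auto; now apply ccont_mult.
    + intros h.
      pose proof (circle_neq rho h b Hb1) as Hn.
      replace (F h * K h + (- (1) * F h + (- b * (F h * Z h) + - (b * b) * (F h * (Z h * Z h)))))%C
        with (F h * (b * b * b * (Z h * Z h * / (rho * cis h - b))))%C.
      2: { unfold K, cauchy_kernel, Z. field.
        repeat split; auto; try apply cis_neq_0; apply RtoC_neq; lra. }
      rewrite !Cmod_mult, HZm, Cmod_inv by auto.
      replace (2 * M * Cmod b ^ 3 / rho ^ 3) with (M * (Cmod b * Cmod b * Cmod b * (/ rho * / rho * / (rho / 2)))) by (field; lra).
      apply Rmult_le_compat; [apply Cmod_ge_0| |apply HM|].
      * repeat apply Rmult_le_pos; auto; try (apply Rlt_le, Rinv_0_lt_compat; lra).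
        apply Rlt_le, Rinv_0_lt_compat. apply Cmod_gt_0; auto.
      * apply Rmult_le_compat_l; [repeat apply Rmult_le_pos; auto|].
        apply Rmult_le_compat_l; [apply Rlt_le, Rmult_lt_0_compat; apply Rinv_0_lt_compat; lra|].
        apply Rinv_le_contravar; [lra|]. pose proof (circle_sub_ge rho h b). lra.
Qed.

(* In this form the Taylor estimate survives pointwise limits. *)
Lemma taylor2 (f : C -> C) (c : C) (rho M : R) : 0 < rho ->
  (forall z, Cmod (z - c)%C <= rho -> exists k, cdiff f z k) ->
  (forall z, Cmod (z - c)%C <= rho -> Cmod (f z) <= M) ->
  exists l, Cmod l <= M / rho /\ forall b, Cmod (b - c)%C <= rho / 2 ->
    Cmod (f b - f c - l * (b - c))%C <= 2 * M * Cmod (b - c)%C ^ 2 / rho ^ 2.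
Proof.
  intros Hr Hf HM.
  assert (HM0 : 0 <= M).
  { eapply Rle_trans; [apply Cmod_ge_0|apply (HM c)]. replace (c - c)%C with (RtoC 0) by ring. rewrite Cmod_0; lra. }
  destruct (taylor3 (fun z => f (c + z)%C) rho M Hr) as [f1 [f2 [H1 [H2 H3]]]].
  - intros z Hz. destruct (Hf (c + z)%C) as [k Hk]. { replace (c + z - c)%C with z by ring. auto. }
    eexists. apply (cdiff_comp f (fun z => c + z)%C); eauto.
    apply (cdiff_plus (fun _ => c)); [apply cdiff_const|apply cdiff_id].
  - intros h. apply HM. replace (c + rho * cis h - c)%C with (rho * cis h)%C by ring.
    rewrite Cmod_circle; lra.
  - exists f1. split; auto. intros b Hb. specialize (H3 (b - c)%C Hb).
    replace (c + (b - c))%C with b in H3 by ring. replace (c + 0)%C with c in H3 by ring.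
    set (y := Cmod (b - c)%C) in *. assert (Hy : 0 <= y) by apply Cmod_ge_0.
    pose proof (Cmod_sub_le (f b - f c - f1 * (b - c))%C ((b - c) * (b - c) * f2)%C) as HT.
    rewrite !Cmod_mult in HT. fold y in HT.
    replace (f b - f c - f1 * (b - c) - (b - c) * (b - c) * f2)%C
      with (f b - f c - (b - c) * f1 - (b - c) * (b - c) * f2)%C in HT by ring.
    assert (y * y * Cmod f2 <= y * y * (M / rho ^ 2)) by (apply Rmult_le_compat_l; auto; nra).
    assert (Hrp : 0 < rho ^ 3) by (apply pow_lt; lra).
    assert (2 * M * y ^ 3 / rho ^ 3 <= y * y * (M / rho ^ 2)).
    { apply Rmult_le_reg_r with (rho ^ 3); auto.
      replace (2 * M * y ^ 3 / rho ^ 3 * rho ^ 3) with (M * (y * y) * (2 * y)) by (field; lra).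
      replace (y * y * (M / rho ^ 2) * rho ^ 3) with (M * (y * y) * rho) by (field; lra).
      apply Rmult_le_compat_l; [apply Rmult_le_pos; auto; nra|lra]. }
    replace (2 * M * y ^ 2 / rho ^ 2) with (y * y * (M / rho ^ 2) + y * y * (M / rho ^ 2)) by (field; lra). lra.
Qed.

(** Points closer than half the gap [r2 - r1] are compared by Taylor's estimate; for the others the
    trivial bound [2 * M] suffices. The constant [4 * M / (r2 - r1)] covers both. *)
Lemma holomorphic_lipschitz (f : C -> C) (r1 r2 M : R) : r1 < r2 -> 0 <= M ->
  (forall z, Cmod z <= r2 -> exists k, cdiff f z k) ->
  (forall z, Cmod z <= r2 -> Cmod (f z) <= M) ->
  exists L, 0 <= L /\ forall a b, Cmod a <= r1 -> Cmod b <= r1 ->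
    Cmod (f b - f a)%C <= L * Cmod (b - a)%C.
Proof.
  intros Hr HM0 Hf HM.
  set (rho := r2 - r1). assert (Hrho : 0 < rho) by (unfold rho; lra).
  assert (HMr : 0 <= M / rho) by (apply Rdiv_le_0_compat; auto).
  exists (4 * (M / rho)). split; [lra|]. intros a b Ha Hb.
  assert (Hin : forall z, Cmod (z - a)%C <= rho -> Cmod z <= r2).
  { intros z Hz. pose proof (Cmod_sub_le z a). unfold rho in *. lra. }
  set (y := Cmod (b - a)%C). assert (Hy : 0 <= y) by apply Cmod_ge_0.
  destruct (Rle_dec y (rho / 2)) as [Hle|Hgt].
  - destruct (taylor2 f a rho M Hrho) as [l [Hl HT]]; auto.
    specialize (HT b Hle). fold y in HT.
    pose proof (Cmod_sub_le (f b - f a)%C (l * (b - a))%C) as H. rewrite Cmod_mult in H. fold y in H.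
    assert (Cmod l * y <= M / rho * y) by (apply Rmult_le_compat_r; auto).
    assert (2 * M * y ^ 2 / rho ^ 2 <= M / rho * y).
    { replace (2 * M * y ^ 2 / rho ^ 2) with (M / rho * y * (2 * y / rho)) by (field; lra).
      rewrite <- (Rmult_1_r (M / rho * y)) at 2. apply Rmult_le_compat_l; [now apply Rmult_le_pos|].
      apply Rmult_le_reg_r with rho; auto. unfold Rdiv. rewrite Rmult_assoc, Rinv_l; lra. }
    assert (0 <= M / rho * y) by now apply Rmult_le_pos. lra.
  - assert (Cmod (f b - f a)%C <= 2 * M).
    { unfold Cminus. eapply Rle_trans; [apply Cmod_triangle|]. rewrite Cmod_opp.
      pose proof (HM a). pose proof (HM b). unfold rho in *. lra. }
    assert (2 * M <= 4 * (M / rho) * y).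
    { replace (2 * M) with (4 * (M / rho) * (rho / 2)) by (field; lra).
      apply Rmult_le_compat_l; lra. }
    lra.
Qed.

(** Compactness is needed only for the angle: the modulus attains its maximum on a larger circle,
    and the maximum principle carries this bound inside. *)
Lemma holo_ball_bounded (f : C -> C) (r : R) : 0 < r ->
  (exists r', r < r' /\ holo_ball f r') -> exists M, 0 <= M /\ forall z, Cmod z <= r -> Cmod (f z) <= M.
Proof.
  intros Hr [r' [Hr' Hf]]. pose proof PI_RGT_0.
  assert (Hc : forall h, ccont (fun h => f (r' * cis h)%C) h) by (intros; apply holo_ball_ccont; auto; lra).
  destruct (continuity_ab_maj (fun h => Cmod (f (r' * cis h)%C)) 0 (2 * PI)) as [hm [Hm _]]; [lra| |].
  - intros h _. apply (Cmod_continuity_pt (fun h => f (r' * cis h)%C)), Hc.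
  - set (M := Cmod (f (r' * cis hm)%C)) in *.
    exists M. split; [apply Cmod_ge_0|]. intros z Hz. apply maximum_principle with r'; auto; lra.
Qed.

(** Removability of the singularity at 0. The difference quotient of [f z / z] at 0 divides the
    Taylor remainder by the square of [z], which is why an expansion with a cubic remainder is
    needed; its quadratic coefficient is the derivative of [p] at 0. *)
Lemma divide_by_z (f : C -> C) (q : C) : holomorphic_on unit_disk f -> f 0 = 0 -> cdiff f 0 q ->
  exists p, holomorphic_on unit_disk p /\ p 0 = q /\ forall z, f z = (z * p z)%C.
Proof.
  intros Hf Hf0 Hq. rewrite holomorphic_cdiff in Hf.
  set (p := fun z : C => if Ceq_dec z 0 then q else (f z / z)%C).
  assert (Hp0 : p 0 = q) by (unfold p; destruct Ceq_dec; [auto|tauto]).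
  assert (Hpn : forall z : C, z <> 0 -> p z = (f z / z)%C) by (intros; unfold p; destruct Ceq_dec; [contradiction|reflexivity]).
  exists p. split; [|split; auto].
  2: { intros z. unfold p. destruct Ceq_dec as [->|Hz]; [rewrite Hf0; ring|now field]. }
  rewrite holomorphic_cdiff. intros z Hz.
  destruct (Ceq_dec z 0) as [->|Hnz].
  - destruct (holo_ball_bounded f (1/4)) as [M [HM0 HM]]; [lra| |].
    { exists (1/2). split; [lra|]. intros w Hw. apply Hf. unfold unit_disk; lra. }
    destruct (taylor3 f (1/4) M) as [f1 [f2 [_ [_ HT]]]]; [lra| | |].
    { intros w Hw. apply Hf. unfold unit_disk; lra. }
    { intros h. apply HM. rewrite Cmod_circle; lra. }
    (* Identifies the linear Taylor coefficient with [q] by uniqueness of the derivative. *)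
    assert (Hf2 : cdiff f 0 f1).
    { intros eps Heps.
      set (N := Cmod f2 + 2 * M / (1/4)^3 + 1).
      assert (HN : 0 < N) by (pose proof (Cmod_ge_0 f2); unfold N; assert (0 <= 2 * M / (1/4)^3) by (apply Rdiv_le_0_compat; lra); lra).
      exists (Rmin (1/8) (eps / N)). split; [apply Rmin_pos; [lra|now apply Rdiv_lt_0_compat]|].
      intros w Hw. replace (w - 0)%C with w in * by ring.
      pose proof (Rlt_le_trans _ _ _ Hw (Rmin_l _ _)) as H1. pose proof (Rlt_le_trans _ _ _ Hw (Rmin_r _ _)) as H2.
      specialize (HT w ltac:(lra)).
      pose proof (Cmod_sub_le (f w - f 0 - f1 * w)%C (w * w * f2)%C) as H3.
      replace (f w - f 0 - f1 * w - w * w * f2)%C with (f w - f 0 - w * f1 - w * w * f2)%C in H3 by ring.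
      rewrite !Cmod_mult in H3. pose proof (Cmod_ge_0 w) as Hw0.
      assert (Cmod w * N <= eps).
      { apply Rmult_lt_compat_r with (r := N) in H2; auto. replace (eps / N * N) with eps in H2 by (field; lra). lra. }
      assert (HMM : 2 * M * Cmod w ^ 3 / (1 / 4) ^ 3 <= Cmod w * Cmod w * (2 * M / (1 / 4) ^ 3)).
      { replace (2 * M * Cmod w ^ 3 / (1 / 4) ^ 3) with (Cmod w * Cmod w * (2 * M / (1 / 4) ^ 3) * Cmod w) by (field).
        rewrite <- (Rmult_1_r (Cmod w * Cmod w * (2 * M / (1 / 4) ^ 3))) at 2.
        apply Rmult_le_compat_l; [|lra]. repeat apply Rmult_le_pos; auto; lra. }
      eapply Rle_trans; [exact H3|].
      apply Rle_trans with (Cmod w * (Cmod w * N)).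
      + unfold N. pose proof (Cmod_ge_0 f2). nra.
      + rewrite Rmult_comm. apply Rmult_le_compat_r; auto. }
    rewrite (cdiff_unique _ _ _ _ Hf2 Hq) in *.
    exists f2. intros eps Heps.
    set (N := 2 * M / (1/4)^3 + 1).
    assert (HN : 0 < N) by (unfold N; assert (0 <= 2 * M / (1/4)^3) by (apply Rdiv_le_0_compat; lra); lra).
    exists (Rmin (1/8) (eps / N)). split; [apply Rmin_pos; [lra|now apply Rdiv_lt_0_compat]|].
    intros w Hw. replace (w - 0)%C with w in * by ring.
    pose proof (Rlt_le_trans _ _ _ Hw (Rmin_l _ _)) as H1. pose proof (Rlt_le_trans _ _ _ Hw (Rmin_r _ _)) as H2.
    pose proof (Cmod_ge_0 w) as Hw0.
    destruct (Ceq_dec w 0) as [->|Hwn].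
    { replace (p 0 - p 0 - f2 * 0)%C with (RtoC 0) by ring. rewrite Cmod_0. lra. }
    specialize (HT w ltac:(lra)).
    rewrite Hp0, Hpn by auto.
    replace (f w / w - q - f2 * w)%C with (/ w * (f w - f 0 - w * q - w * w * f2))%C by (rewrite Hf0; field; auto).
    rewrite Cmod_mult, Cmod_inv by auto.
    assert (Hwp : 0 < Cmod w) by now apply Cmod_gt_0.
    apply Rmult_le_reg_l with (Cmod w); auto. rewrite <- Rmult_assoc, Rinv_r, Rmult_1_l by lra.
    eapply Rle_trans; [exact HT|].
    assert (Cmod w * N <= eps).
    { apply Rmult_lt_compat_r with (r := N) in H2; auto. replace (eps / N * N) with eps in H2 by (field; lra). lra. }
    replace (2 * M * Cmod w ^ 3 / (1 / 4) ^ 3) with (Cmod w * Cmod w * (Cmod w * (2 * M / (1 / 4) ^ 3))) by field.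
    replace (Cmod w * (eps * Cmod w)) with (Cmod w * Cmod w * eps) by ring.
    apply Rmult_le_compat_l; [nra|]. unfold N in *. nra.
  - destruct (Hf z Hz) as [k Hk].
    destruct (cdiff_div f (fun w => w) z k 1) as [l Hl]; auto using cdiff_id.
    exists l. apply (cdiff_ext_loc (fun w => f w / w)%C) with (d := Cmod z); auto.
    { now apply Cmod_gt_0. }
    intros w Hw. symmetry. apply Hpn. intros ->. replace (0 - z)%C with (- z)%C in Hw by ring.
    rewrite Cmod_opp in Hw. lra.
Qed.

(** The quotient [p = f / z] is at most [1 / rho] on the circle of radius [rho], hence inside it;
    then [rho] tends to 1. *)
Lemma schwarz (f : C -> C) : holomorphic_on unit_disk f -> f 0 = 0 ->
  (forall z, unit_disk z -> Cmod (f z) <= 1) -> forall z, unit_disk z -> Cmod (f z) <= Cmod z.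
Proof.
  intros Hf Hf0 Hb z Hz.
  assert (Hd0 : unit_disk 0) by (unfold unit_disk; rewrite Cmod_0; lra).
  destruct (proj1 (holomorphic_cdiff _ _) Hf 0 Hd0) as [q Hq].
  destruct (divide_by_z f q Hf Hf0 Hq) as [p [Hp [_ Hfp]]].
  rewrite holomorphic_cdiff in Hp.
  assert (Hpb : forall rho, Cmod z < rho < 1 -> Cmod (p z) <= / rho).
  { intros rho Hr. pose proof (Cmod_ge_0 z). apply maximum_principle with rho; [|lra|].
    - intros w Hw. apply Hp. unfold unit_disk; lra.
    - intros h _. assert (Hm : Cmod (rho * cis h)%C = rho) by (apply Cmod_circle; lra).
      assert (Hu : unit_disk (rho * cis h)%C) by (unfold unit_disk; lra).
      specialize (Hb _ Hu). rewrite Hfp, Cmod_mult, Hm in Hb.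
      apply Rmult_le_reg_l with rho; [lra|]. rewrite Rinv_r; lra. }
  assert (Cmod (p z) <= 1).
  { apply Rnot_lt_le. intros Hlt. unfold unit_disk in Hz.
    set (c := Cmod (p z)) in *. assert (Hic : / c < 1) by (rewrite <- Rinv_1; apply Rinv_lt_contravar; lra).
    assert (0 < / c) by (apply Rinv_0_lt_compat; lra).
    (* A radius beyond [Cmod z] whose inverse is still below [c]; it exists because [c > 1]. *)
    set (rho := (1 + Rmax (Cmod z) (/ c)) / 2).
    assert (Hmx : Rmax (Cmod z) (/ c) < 1) by (apply Rmax_lub_lt; lra).
    pose proof (Rmax_l (Cmod z) (/ c)). pose proof (Rmax_r (Cmod z) (/ c)).
    specialize (Hpb rho ltac:(unfold rho; lra)).
    assert (/ rho < c). { rewrite <- (Rinv_inv c). apply Rinv_lt_contravar; [|unfold rho; lra].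
      apply Rmult_lt_0_compat; unfold rho; lra. }
    lra. }
  rewrite Hfp, Cmod_mult. pose proof (Cmod_ge_0 z). nra.
Qed.

(** * Euler iterates and their limits *)

Definition cconv (u : nat -> C) (l : C) : Prop :=
  forall eps, 0 < eps -> exists N, forall k, (N <= k)%nat -> Cmod (u k - l)%C < eps.

(** [Lim_seq] is total, so the limit can be named before convergence is known; it is meaningful only
    through [limC_correct]. *)
Definition limC (u : nat -> C) : C :=
  (real (Lim_seq (fun k => Re (u k))), real (Lim_seq (fun k => Im (u k)))).

Lemma im_le_Cmod (z : C) : Rabs (Im z) <= Cmod z.
Proof. eapply Rle_trans; [apply Rmax_r|apply Rmax_Cmod]. Qed.

Lemma is_lim_seq_eps (u : nat -> R) (l : R) :
  (forall eps, 0 < eps -> exists N, forall k, (N <= k)%nat -> Rabs (u k - l) < eps) -> is_lim_seq u l.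
Proof.
  intros H. apply is_lim_seq_spec. intros eps. destruct (H eps (cond_pos eps)) as [N HN].
  exists N. exact HN.
Qed.

Lemma limC_correct (u : nat -> C) (l : C) : cconv u l -> limC u = l.
Proof.
  intros H. unfold limC. destruct l as [a b].
  rewrite (is_lim_seq_unique (fun k => Re (u k)) a), (is_lim_seq_unique (fun k => Im (u k)) b); auto;
  apply is_lim_seq_eps; intros eps Heps; destruct (H eps Heps) as [N HN]; exists N; intros k Hk;
  specialize (HN k Hk).
  - eapply Rle_lt_trans; [|exact HN]. apply (im_le_Cmod (u k - (a, b))%C).
  - eapply Rle_lt_trans; [|exact HN]. apply (re_le_Cmod (u k - (a, b))%C).
Qed.

Lemma ccauchy_cconv (u : nat -> C) :
  (forall eps, 0 < eps -> exists N, forall j k, (N <= j)%nat -> (N <= k)%nat -> Cmod (u j - u k)%C < eps) ->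
  exists l, cconv u l.
Proof.
  intros H.
  assert (H1 : ex_finite_lim_seq (fun k => Re (u k))).
  { apply ex_lim_seq_cauchy_corr. intros eps. destruct (H eps (cond_pos eps)) as [N HN].
    exists N. intros n m Hn Hm. eapply Rle_lt_trans; [|apply (HN n m Hn Hm)]. apply (re_le_Cmod (u n - u m)%C). }
  assert (H2 : ex_finite_lim_seq (fun k => Im (u k))).
  { apply ex_lim_seq_cauchy_corr. intros eps. destruct (H eps (cond_pos eps)) as [N HN].
    exists N. intros n m Hn Hm. eapply Rle_lt_trans; [|apply (HN n m Hn Hm)]. apply (im_le_Cmod (u n - u m)%C). }
  destruct H1 as [a Ha], H2 as [b Hb]. exists (a, b). intros eps Heps.
  apply is_lim_seq_spec in Ha. apply is_lim_seq_spec in Hb.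
  assert (He : 0 < eps / 2) by lra.
  destruct (Ha (mkposreal _ He)) as [N1 H1]. destruct (Hb (mkposreal _ He)) as [N2 H2].
  exists (max N1 N2). intros k Hk. specialize (H1 k ltac:(lia)). specialize (H2 k ltac:(lia)). simpl in H1, H2.
  eapply Rle_lt_trans; [apply Cmod_2Rmax|].
  assert (sqrt 2 < 2). { rewrite <- (sqrt_square 2) at 2 by lra. apply sqrt_lt_1_alt. lra. }
  assert (0 <= sqrt 2) by apply sqrt_pos.
  assert (Rmax (Rabs (fst (u k - (a, b))%C)) (Rabs (snd (u k - (a, b))%C)) < eps / 2).
  { apply Rmax_lub_lt; [exact H1|exact H2]. }
  assert (0 <= Rmax (Rabs (fst (u k - (a, b))%C)) (Rabs (snd (u k - (a, b))%C))).
  { eapply Rle_trans; [apply Rabs_pos|apply Rmax_l]. }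
  nra.
Qed.

Lemma cconv_dist_le (u : nat -> C) (l c : C) (B : R) (N : nat) : cconv u l ->
  (forall k, (N <= k)%nat -> Cmod (u k - c)%C <= B) -> Cmod (l - c)%C <= B.
Proof.
  intros H HB. apply Rnot_lt_le. intros Hlt.
  destruct (H (Cmod (l - c)%C - B)) as [N1 H1]; [lra|].
  specialize (H1 (max N N1) ltac:(lia)). specialize (HB (max N N1) ltac:(lia)).
  pose proof (Cmod_triangle (u (max N N1) - c)%C (l - u (max N N1))%C) as HT.
  replace (u (max N N1) - c + (l - u (max N N1)))%C with (l - c)%C in HT by ring.
  rewrite (Cmod_minus_sym l (u (max N N1))) in HT. lra.
Qed.

Lemma cconv_plus (u v : nat -> C) (l m : C) : cconv u l -> cconv v m -> cconv (fun k => u k + v k)%C (l + m)%C.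
Proof.
  intros Hu Hv eps Heps. destruct (Hu (eps / 2)) as [N1 H1]; [lra|]. destruct (Hv (eps / 2)) as [N2 H2]; [lra|].
  exists (max N1 N2). intros k Hk. specialize (H1 k ltac:(lia)). specialize (H2 k ltac:(lia)).
  replace (u k + v k - (l + m))%C with (u k - l + (v k - m))%C by ring.
  eapply Rle_lt_trans; [apply Cmod_triangle|]. lra.
Qed.

Lemma cconv_scal (u : nat -> C) (l c : C) : cconv u l -> cconv (fun k => c * u k)%C (c * l)%C.
Proof.
  intros Hu eps Heps. pose proof (Cmod_ge_0 c) as Hc.
  destruct (Hu (eps / (Cmod c + 1))) as [N1 H1]; [apply Rdiv_lt_0_compat; lra|].
  exists N1. intros k Hk. specialize (H1 k Hk).
  replace (c * u k - c * l)%C with (c * (u k - l))%C by ring. rewrite Cmod_mult.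
  apply Rle_lt_trans with ((Cmod c + 1) * Cmod (u k - l)%C).
  - apply Rmult_le_compat_r; [apply Cmod_ge_0|lra].
  - apply Rmult_lt_compat_l with (r := Cmod c + 1) in H1; [|lra].
    replace ((Cmod c + 1) * (eps / (Cmod c + 1))) with eps in H1 by (field; lra). exact H1.
Qed.

Lemma geometric_cconv (u : nat -> C) (B : R) (k0 : nat) : 0 <= B ->
  (forall k, (k0 <= k)%nat -> Cmod (u (S k) - u k)%C <= B * (/ 2) ^ k) -> exists l, cconv u l.
Proof.
  intros HB Hu.
  assert (Hsum : forall k m, (k0 <= k)%nat -> Cmod (u (k + m)%nat - u k)%C <= 2 * B * (/ 2) ^ k - 2 * B * (/ 2) ^ (k + m)).
  { intros k m Hk. induction m as [|m IH].
    - rewrite Nat.add_0_r. replace (u k - u k)%C with (RtoC 0) by ring. rewrite Cmod_0. lra.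
    - rewrite Nat.add_succ_r. replace (u (S (k + m)) - u k)%C with (u (S (k + m)) - u (k + m)%nat + (u (k + m)%nat - u k))%C by ring.
      eapply Rle_trans; [apply Cmod_triangle|]. specialize (Hu (k + m)%nat ltac:(lia)). simpl. lra. }
  apply ccauchy_cconv. intros eps Heps.
  destruct (half_pow_small (4 * B + 1) eps) as [N HN]; [lra|auto|].
  assert (Hpos : forall n, 0 < (/ 2) ^ n) by (intros; apply pow_lt; lra).
  assert (Hanti : forall n m, (/ 2) ^ (n + m) <= (/ 2) ^ n).
  { intros n m. induction m; [rewrite Nat.add_0_r; lra|]. rewrite Nat.add_succ_r. simpl. pose proof (Hpos (n + m)%nat). lra. }
  exists (max k0 N). intros j k Hj Hk.
  set (n := max k0 N) in *.
  replace (u j - u k)%C with (u (n + (j - n))%nat - u n - (u (n + (k - n))%nat - u n))%C.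
  2: { replace (n + (j - n))%nat with j by lia. replace (n + (k - n))%nat with k by lia. ring. }
  unfold Cminus at 1. eapply Rle_lt_trans; [apply Cmod_triangle|]. rewrite Cmod_opp.
  pose proof (Hsum n (j - n)%nat ltac:(lia)). pose proof (Hsum n (k - n)%nat ltac:(lia)).
  pose proof (Hpos (n + (j - n))%nat). pose proof (Hpos (n + (k - n))%nat).
  pose proof (Hanti N (n - N)%nat). replace (N + (n - N))%nat with n in H3 by lia.
  pose proof (Hpos n). pose proof (Hpos N).
  assert (0 <= B * (/ 2) ^ (n + (j - n))) by (apply Rmult_le_pos; lra).
  assert (0 <= B * (/ 2) ^ (n + (k - n))) by (apply Rmult_le_pos; lra).
  assert (B * (/ 2) ^ n <= B * (/ 2) ^ N) by (apply Rmult_le_compat_l; lra).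
  lra.
Qed.

(* The quadratic remainder bound is uniform in [k], so the Taylor coefficients form a Cauchy sequence. *)
Lemma bounded_limit_cdiff (F : nat -> C -> C) (G : C -> C) (c : C) (rho M : R) (k0 : nat) : 0 < rho ->
  (forall k z, (k0 <= k)%nat -> Cmod (z - c)%C <= rho -> (exists l, cdiff (F k) z l) /\ Cmod (F k z) <= M) ->
  (forall z, Cmod (z - c)%C <= rho -> cconv (fun k => F k z) (G z)) ->
  exists l, cdiff G c l.
Proof.
  intros Hr HF HG.
  assert (Hcc : Cmod (c - c)%C <= rho) by (replace (c - c)%C with (RtoC 0) by ring; rewrite Cmod_0; lra).
  assert (HM0 : 0 <= M).
  { destruct (HF k0 c (le_n _) Hcc) as [_ H]. eapply Rle_trans; [apply Cmod_ge_0|exact H]. }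
  set (K := 2 * M / rho ^ 2).
  assert (Hr2 : 0 < rho ^ 2) by (apply pow_lt; auto).
  assert (HK : 0 <= K) by (apply Rdiv_le_0_compat; lra).
  assert (HT : forall k, exists l, (k0 <= k)%nat -> forall b, Cmod (b - c)%C <= rho / 2 ->
     Cmod (F k b - F k c - l * (b - c))%C <= K * Cmod (b - c)%C ^ 2).
  { intros k. destruct (Nat.le_gt_cases k0 k) as [Hk|Hk]; [|exists 0; intros; lia].
    destruct (taylor2 (F k) c rho M Hr) as [l [_ Hl]].
    - intros z Hz. apply (HF k z Hk Hz).
    - intros z Hz. apply (HF k z Hk Hz).
    - exists l. intros _ b Hb. specialize (Hl b Hb). unfold K.
      replace (2 * M / rho ^ 2 * Cmod (b - c)%C ^ 2) with (2 * M * Cmod (b - c)%C ^ 2 / rho ^ 2) by (field; lra). exact Hl. }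
  set (L := fun k => proj1_sig (constructive_indefinite_description _ (HT k))).
  assert (HL : forall k, (k0 <= k)%nat -> forall b, Cmod (b - c)%C <= rho / 2 ->
     Cmod (F k b - F k c - L k * (b - c))%C <= K * Cmod (b - c)%C ^ 2).
  { intros k. exact (proj2_sig (constructive_indefinite_description _ (HT k))). }
  destruct (ccauchy_cconv L) as [l Hl].
  { intros eps Heps.
    (* The coefficient [L k] is read off from the values at [c] and [c + y]. Here [y] is so small
       that two Taylor remainders amount to less than [eps * y / 2]; the convergence errors at the
       two points fill the other half. *)
    set (y := Rmin (rho / 2) (eps / (4 * (K + 1)))).
    assert (Hy : 0 < y) by (apply Rmin_pos; [lra|apply Rdiv_lt_0_compat; lra]).
    assert (Hy1 : y <= rho / 2) by apply Rmin_l.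
    assert (Hy2 : 4 * K * y < eps).
    { assert (y <= eps / (4 * (K + 1))) by apply Rmin_r.
      apply Rmult_le_compat_l with (r := 4 * (K + 1)) in H; [|lra].
      replace (4 * (K + 1) * (eps / (4 * (K + 1)))) with eps in H by (field; lra). lra. }
    set (b := (c + y)%C).
    assert (Hb : (b - c)%C = RtoC y) by (unfold b; ring).
    assert (Hbm : Cmod (b - c)%C = y) by (rewrite Hb, Cmod_R, Rabs_pos_eq; lra).
    assert (Hd : 0 < eps * y / 8) by (apply Rdiv_lt_0_compat; [apply Rmult_lt_0_compat; lra|lra]).
    destruct (HG b ltac:(lra) _ Hd) as [N1 H1]. destruct (HG c Hcc _ Hd) as [N2 H2].
    exists (max k0 (max N1 N2)). intros j k Hj Hk.
    pose proof (HL j ltac:(lia) b ltac:(lra)) as Aj. pose proof (HL k ltac:(lia) b ltac:(lra)) as Ak.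
    pose proof (H1 j ltac:(lia)) as Bj. pose proof (H1 k ltac:(lia)) as Bk.
    pose proof (H2 j ltac:(lia)) as Cj. pose proof (H2 k ltac:(lia)) as Ck.
    rewrite Hbm in Aj, Ak. rewrite Hb in Aj, Ak.
    apply Rmult_lt_reg_r with y; auto.
    replace (Cmod (L j - L k)%C * y) with (Cmod ((L j - L k) * y)%C) by (rewrite Cmod_mult, Cmod_R, (Rabs_pos_eq y) by lra; auto).
    set (X1 := (F j b - F j c - L j * y)%C) in *. set (X2 := (F k b - F k c - L k * y)%C) in *.
    replace ((L j - L k) * y)%C with (X2 - X1 + ((F j b - G b) - (F k b - G b) - ((F j c - G c) - (F k c - G c))))%C
      by (unfold X1, X2; ring).
    pose proof (Cmod_triangle (X2 - X1)%C ((F j b - G b) - (F k b - G b) - ((F j c - G c) - (F k c - G c)))%C) as T0.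
    pose proof (Cmod_triangle X2 (- X1)%C) as T1. rewrite Cmod_opp in T1.
    pose proof (Cmod_triangle ((F j b - G b) - (F k b - G b))%C (- ((F j c - G c) - (F k c - G c)))%C) as T2. rewrite Cmod_opp in T2.
    pose proof (Cmod_triangle (F j b - G b)%C (- (F k b - G b))%C) as T3. rewrite Cmod_opp in T3.
    pose proof (Cmod_triangle (F j c - G c)%C (- (F k c - G c))%C) as T4. rewrite Cmod_opp in T4.
    unfold Cminus in *.
    assert (2 * (K * y ^ 2) < eps * y / 2). { replace (2 * (K * y ^ 2)) with (4 * K * y * (y / 2)) by field. nra. }
    lra. }
  exists l. intros eps Heps.
  exists (Rmin (rho / 2) (eps / (K + 1))). split; [apply Rmin_pos; [lra|apply Rdiv_lt_0_compat; lra]|].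
  intros b Hb. pose proof (Rlt_le_trans _ _ _ Hb (Rmin_l _ _)) as H1. pose proof (Rlt_le_trans _ _ _ Hb (Rmin_r _ _)) as H2.
  set (y := Cmod (b - c)%C) in *. assert (Hy : 0 <= y) by apply Cmod_ge_0.
  apply Rle_trans with (K * y ^ 2).
  - replace (G b - G c - l * (b - c))%C with (G b + (- (1) * G c + - (b - c) * l) - 0)%C by ring.
    apply cconv_dist_le with (u := fun k => (F k b + (- (1) * F k c + - (b - c) * L k))%C) (N := k0).
    + apply (cconv_plus (fun k => F k b) (fun k => (- (1) * F k c + - (b - c) * L k)%C)); [apply HG; unfold y in *; lra|].
      apply (cconv_plus (fun k => (- (1) * F k c)%C) (fun k => (- (b - c) * L k)%C)); [|now apply cconv_scal].
      apply (cconv_scal (fun k => F k c)); auto.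
    + intros k Hk. replace (F k b + (- (1) * F k c + - (b - c) * L k) - 0)%C with (F k b - F k c - L k * (b - c))%C by ring.
      apply HL; auto; unfold y in *; lra.
  - apply Rmult_lt_compat_l with (r := K + 1) in H2; [|lra].
    replace ((K + 1) * (eps / (K + 1))) with eps in H2 by (field; lra). nra.
Qed.

(** * The Euler scheme with complex step for the equation [u' = - f(u)] *)

Fixpoint euler (f : C -> C) (h : C) (n : nat) (z : C) : C :=
  match n with
  | O => z
  | S n => (euler f h n z - h * f (euler f h n z))%C
  end.

Lemma pow_1_plus_le_exp (x : R) (n : nat) : 0 <= x -> (1 + x) ^ n <= exp (INR n * x).
Proof.
  intros Hx. induction n as [|n IH].
  - simpl. rewrite Rmult_0_l, exp_0. lra.
  - rewrite S_INR, Rmult_plus_distr_r, Rmult_1_l, exp_plus. simpl. rewrite Rmult_comm.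
    apply Rmult_le_compat; auto; try lra; [apply pow_le; lra|apply exp_ineq1_le].
Qed.

Lemma exp_le_mono (x y : R) : x <= y -> exp x <= exp y.
Proof. intros [H| ->]; [left; now apply exp_increasing|lra]. Qed.

(** A discrete Gronwall argument. One step of size [h] against two of size [h / 2] creates an error
    [L * M * Cmod h ^ 2 / 4], and earlier errors grow by [1 + L * Cmod h] per step. *)
Lemma euler_halving (f : C -> C) (h z : C) (r L M : R) (n : nat) : 0 <= L ->
  (forall a b, Cmod a <= r -> Cmod b <= r -> Cmod (f b - f a)%C <= L * Cmod (b - a)%C) ->
  (forall a, Cmod a <= r -> Cmod (f a) <= M) ->
  (forall j, (j <= n)%nat -> Cmod (euler f h j z) <= r) ->
  (forall j, (j <= 2 * n)%nat -> Cmod (euler f (h / 2) j z) <= r) ->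
  Cmod (euler f (h / 2) (2 * n) z - euler f h n z)%C <=
    exp (INR n * (L * Cmod h)) * (INR n * (L * M * Cmod h ^ 2 / 4)).
Proof.
  intros HL0 HL HM Ha Hb.
  set (x := L * Cmod h). assert (Hx : 0 <= x) by (apply Rmult_le_pos; auto using Cmod_ge_0).
  assert (HM0 : 0 <= M) by (eapply Rle_trans; [apply Cmod_ge_0|apply (HM _ (Ha 0%nat ltac:(lia)))]).
  set (e := L * M * Cmod h ^ 2 / 4).
  assert (He : 0 <= e).
  { pose proof (Cmod_ge_0 h). unfold e. assert (0 <= Cmod h ^ 2) by (apply pow_le; auto).
    assert (0 <= L * M) by (apply Rmult_le_pos; auto). nra. }
  assert (Hind : forall j, (j <= n)%nat ->
    Cmod (euler f (h / 2) (2 * j) z - euler f h j z)%C <= (1 + x) ^ j * (INR j * e)).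
  { induction j as [|j IH]; intros Hj.
    - simpl. replace (z - z)%C with (RtoC 0) by ring. rewrite Cmod_0. lra.
    - specialize (IH ltac:(lia)).
      replace (2 * S j)%nat with (S (S (2 * j))) by lia.
      pose proof (Hb (2 * j)%nat ltac:(lia)) as R0. pose proof (Hb (S (2 * j)) ltac:(lia)) as R1.
      pose proof (Ha j ltac:(lia)) as R2.
      cbn [euler] in R1 |- *.
      set (B := euler f (h / 2) (2 * j) z) in *. set (a := euler f h j z) in *.
      set (B1 := (B - h / 2 * f B)%C) in *. set (d := Cmod (B - a)%C) in *.
      replace (B1 - h / 2 * f B1 - (a - h * f a))%C with
        (B - a - h / 2 * (f B - f a) - h / 2 * (f B1 - f a))%C by (unfold B1; field).
      assert (Hh2 : Cmod (h / 2)%C = Cmod h / 2).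
      { rewrite Cmod_div, Cmod_R, Rabs_pos_eq; try lra. apply RtoC_neq; lra. }
      pose proof (HL _ _ R2 R0) as L1. pose proof (HL _ _ R2 R1) as L2. fold d in L1.
      assert (HB1 : Cmod (B1 - a)%C <= d + Cmod h / 2 * M).
      { replace (B1 - a)%C with (B - a - h / 2 * f B)%C by (unfold B1; ring).
        unfold Cminus at 1. eapply Rle_trans; [apply Cmod_triangle|]. rewrite Cmod_opp, Cmod_mult, Hh2.
        apply Rplus_le_compat_l. apply Rmult_le_compat_l; [pose proof (Cmod_ge_0 h); lra|auto]. }
      pose proof (Cmod_triangle (B - a - h / 2 * (f B - f a))%C (- (h / 2 * (f B1 - f a)))%C) as T1.
      pose proof (Cmod_triangle (B - a)%C (- (h / 2 * (f B - f a)))%C) as T2.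
      rewrite Cmod_opp, Cmod_mult, Hh2 in T1, T2. fold d in T2.
      pose proof (Cmod_ge_0 h) as Hh0. assert (Hd : 0 <= d) by apply Cmod_ge_0.
      assert (Cmod h / 2 * Cmod (f B - f a)%C <= Cmod h / 2 * (L * d)) by (apply Rmult_le_compat_l; lra).
      assert (Cmod h / 2 * Cmod (f B1 - f a)%C <= Cmod h / 2 * (L * (d + Cmod h / 2 * M))).
      { apply Rmult_le_compat_l; [lra|]. eapply Rle_trans; [exact L2|]. apply Rmult_le_compat_l; auto. }
      assert (Cmod h / 2 * (L * (d + Cmod h / 2 * M)) = Cmod h / 2 * (L * d) + e) by (unfold e; field).
      assert (Cmod h / 2 * (L * d) + Cmod h / 2 * (L * d) = x * d) by (unfold x; field).
      apply Rle_trans with ((1 + x) * d + e).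
      { unfold Cminus in *. lra. }
      rewrite S_INR.
      assert (Hp : 1 <= (1 + x) ^ (S j)) by (apply pow_R1_Rle; lra).
      assert ((1 + x) * d <= (1 + x) * ((1 + x) ^ j * (INR j * e))) by (apply Rmult_le_compat_l; lra).
      replace ((1 + x) ^ S j * ((INR j + 1) * e)) with ((1 + x) * ((1 + x) ^ j * (INR j * e)) + (1 + x) ^ S j * e) by (simpl; ring).
      assert (1 * e <= (1 + x) ^ S j * e) by (apply Rmult_le_compat_r; auto). lra. }
  eapply Rle_trans; [apply (Hind n (le_n _))|]. apply Rmult_le_compat_r.
  - apply Rmult_le_pos; auto. apply pos_INR.
  - now apply pow_1_plus_le_exp.
Qed.

Lemma euler_cdiff (f tau zeta : C -> C) (c : C) (n : nat) (kt kz : C) :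
  holomorphic_on unit_disk f -> cdiff tau c kt -> cdiff zeta c kz ->
  (forall j, (j <= n)%nat -> unit_disk (euler f (tau c) j (zeta c))) ->
  exists l, cdiff (fun x => euler f (tau x) n (zeta x)) c l.
Proof.
  intros Hf Ht Hz. rewrite holomorphic_cdiff in Hf. induction n as [|n IH]; intros Hin.
  - eexists; exact Hz.
  - destruct IH as [l Hl]. { intros; apply Hin; lia. }
    destruct (Hf _ (Hin n ltac:(lia))) as [k Hk].
    assert (H1 : cdiff (fun x => f (euler f (tau x) n (zeta x))) c (l * k)%C).
    { apply (cdiff_comp f (fun x => euler f (tau x) n (zeta x))); auto. }
    pose proof (cdiff_mult tau _ c _ _ Ht H1) as H2.
    pose proof (cdiff_mult (fun _ => - (1))%C _ c _ _ (cdiff_const _ _) H2) as H3.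
    eexists. eapply cdiff_ext_loc with (d := 1); [lra| |exact (cdiff_plus _ _ _ _ _ Hl H3)].
    intros w _. cbn [euler]. ring.
Qed.

(** The numbers of steps are powers of two, so that consecutive levels differ by a halving of the
    step and converge geometrically. *)
Definition euler2 (f : C -> C) (tau : C) (k : nat) (z : C) : C :=
  euler f (tau * RtoC ((/ 2) ^ k))%C (2 ^ k) z.

(** All intermediate points are constrained, not only the last one: [f] is controlled only on closed
    disks inside the unit disk. *)
Definition euler2_bounded (f : C -> C) (tau z : C) (r : R) (k0 : nat) : Prop :=
  forall k, (k0 <= k)%nat -> forall j, (j <= 2 ^ k)%nat ->
    Cmod (euler f (tau * RtoC ((/ 2) ^ k))%C j z) <= r.

Lemma holomorphic_disk_bounds (f : C -> C) (r : R) : holomorphic_on unit_disk f -> 0 < r < 1 ->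
  exists L M, 0 <= L /\ 0 <= M /\
    (forall a b, Cmod a <= r -> Cmod b <= r -> Cmod (f b - f a)%C <= L * Cmod (b - a)%C) /\
    (forall a, Cmod a <= r -> Cmod (f a) <= M).
Proof.
  intros Hf Hr. rewrite holomorphic_cdiff in Hf.
  destruct (holo_ball_bounded f ((1 + r) / 2)) as [M [HM0 HM]]; [lra| |].
  { exists ((3 + r) / 4). split; [lra|]. intros z Hz. apply Hf. unfold unit_disk; lra. }
  destruct (holomorphic_lipschitz f r ((1 + r) / 2) M) as [L [HL0 HL]]; [lra|auto| |auto|].
  { intros z Hz. apply Hf. unfold unit_disk; lra. }
  exists L, M. repeat split; auto. intros a Ha. apply HM. lra.
Qed.

Lemma INR_pow2 (k : nat) : INR (2 ^ k) * (/ 2) ^ k = 1.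
Proof.
  rewrite pow_INR. change (INR 2) with 2. rewrite <- Rpow_mult_distr. rewrite Rinv_r by lra. apply pow1.
Qed.

Lemma euler2_cconv (f : C -> C) (tau z : C) (r : R) (k0 : nat) :
  holomorphic_on unit_disk f -> 0 < r < 1 -> euler2_bounded f tau z r k0 ->
  exists l, cconv (fun k => euler2 f tau k z) l.
Proof.
  intros Hf Hr Hb. destruct (holomorphic_disk_bounds f r Hf Hr) as [L [M [HL0 [HM0 [HL HM]]]]].
  apply geometric_cconv with (B := exp (L * Cmod tau) * (L * M * Cmod tau ^ 2 / 4)) (k0 := k0).
  - apply Rmult_le_pos; [left; apply exp_pos|]. assert (0 <= Cmod tau ^ 2) by (apply pow_le, Cmod_ge_0).
    assert (0 <= L * M) by (now apply Rmult_le_pos). nra.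
  - intros k Hk. unfold euler2.
    assert (E : (tau * RtoC ((/ 2) ^ S k) = tau * RtoC ((/ 2) ^ k) / 2)%C).
    { simpl. rewrite RtoC_mult, RtoC_inv by lra. field. }
    rewrite E. change (2 ^ S k)%nat with (2 * 2 ^ k)%nat.
    set (h := (tau * RtoC ((/ 2) ^ k))%C) in *.
    assert (Hh : Cmod h = Cmod tau * (/ 2) ^ k).
    { unfold h. rewrite Cmod_mult, Cmod_R, Rabs_pos_eq; auto. apply pow_le; lra. }
    pose proof (INR_pow2 k) as Hn.
    eapply Rle_trans; [apply (euler_halving f h z r L M (2 ^ k)); auto|].
    + intros j Hj. apply Hb; auto.
    + intros j Hj. rewrite <- E. apply Hb; [lia|]. simpl. lia.
    + rewrite Hh. set (n := INR (2 ^ k)) in *. set (p := (/ 2) ^ k) in *.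
      replace (n * (L * (Cmod tau * p))) with (L * Cmod tau * (n * p)) by ring. rewrite Hn, Rmult_1_r.
      replace (n * (L * M * (Cmod tau * p) ^ 2 / 4)) with (L * M * Cmod tau ^ 2 / 4 * (n * p) * p) by field.
      rewrite Hn. lra.
Qed.

(** Time and starting point both depend on [x], so that one statement covers holomorphy in the
    initial point ([tau] constant) and in time ([zeta] constant). Having the same [r] and [k0] for
    all nearby [x] supplies the uniform bound that the passage to the limit needs. *)
Lemma euler2_limit_cdiff (f tau zeta : C -> C) (c : C) (rho r : R) (k0 : nat) :
  holomorphic_on unit_disk f -> 0 < rho -> 0 < r < 1 ->
  (forall x, Cmod (x - c)%C <= rho -> (exists k, cdiff tau x k) /\ (exists k, cdiff zeta x k) /\
     euler2_bounded f (tau x) (zeta x) r k0) ->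
  exists l, cdiff (fun x => limC (fun k => euler2 f (tau x) k (zeta x))) c l.
Proof.
  intros Hf Hrho Hr H.
  apply (bounded_limit_cdiff (fun k x => euler2 f (tau x) k (zeta x)) _ c rho 1 k0); auto.
  - intros k x Hk Hx. destruct (H x Hx) as [[kt Ht] [[kz Hz] Hb]]. split.
    + unfold euler2. apply (euler_cdiff f (fun x => tau x * RtoC ((/ 2) ^ k))%C zeta x (2 ^ k) (kt * RtoC ((/ 2) ^ k) + tau x * 0)%C kz); auto.
      * apply cdiff_mult; auto. apply cdiff_const.
      * intros j Hj. unfold unit_disk. eapply Rle_lt_trans; [apply Hb; auto|lra].
    + unfold euler2. eapply Rle_trans; [apply Hb; auto|lra].
  - intros x Hx. destruct (H x Hx) as [_ [_ Hb]].
    destruct (euler2_cconv f (tau x) (zeta x) r k0 Hf Hr Hb) as [l Hl].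
    rewrite (limC_correct _ _ Hl). exact Hl.
Qed.

(** * Trajectories of generators *)

Lemma cauchy_solution_eps (g : C -> C) (z : C) (v : R -> C) (t : R) : cauchy_solution g z v -> 0 <= t ->
  forall eps, 0 < eps -> exists d, 0 < d /\ forall s, 0 <= s -> Rabs (s - t) < d ->
    Cmod (v s - v t + RtoC (s - t) * g (v t))%C <= eps * Rabs (s - t).
Proof.
  intros [_ H] Ht eps Heps. destruct (H t Ht) as [_ [_ Hd]].
  assert (Hlim : is_filter_lim (within (Rle 0) (locally t)) t).
  { intros P [d Hd']. exists d. intros y Hy _. now apply Hd'. }
  destruct (Hd t Hlim (mkposreal eps Heps)) as [d Hdd].
  exists d. split; [apply cond_pos|]. intros s Hs Hst. specialize (Hdd s Hst Hs).
  rewrite <- Cmod_norm in Hdd. simpl in Hdd.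
  change (norm (minus s t)) with (Rabs (s - t)) in Hdd.
  eapply Rle_trans; [|exact Hdd]. right. f_equal.
  destruct (v s) as [a b], (v t) as [a' b']. destruct (g (a', b')) as [p q].
  unfold minus, plus, opp, scal; simpl. unfold prod_plus, prod_opp, prod_scal, plus, opp, scal, mult; simpl.
  unfold mult, plus, opp; simpl.
  unfold Cminus, Cplus, Copp, Cmult, RtoC; simpl. f_equal; ring.
Qed.

Lemma rdiff_eps (f : R -> C) (x : R) (l : C) :
  (forall eps, 0 < eps -> exists d, 0 < d /\ forall s, Rabs (s - x) < d ->
    Cmod (f s - f x - RtoC (s - x) * l)%C <= eps * Rabs (s - x)) -> rdiff f x l.
Proof.
  intros H. split; split; try apply is_linear_scal_l; intros y Hy eps;
  assert (Ex : x = y) by (apply (is_filter_lim_locally_unique (V := R_NormedModule)); exact Hy);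
  rewrite <- Ex in *; destruct (H eps (cond_pos eps)) as [d [Hd Hdd]];
  exists (mkposreal d Hd); intros s Hs; specialize (Hdd s Hs);
  (eapply Rle_trans; [|exact Hdd]).
  - change (Rabs (Re (f s) - Re (f x) - (s - x) * Re l) <= Cmod (f s - f x - RtoC (s - x) * l)%C).
    eapply Rle_trans; [|apply re_le_Cmod]. right; f_equal. unfold Re, Im; simpl. ring.
  - change (Rabs (Im (f s) - Im (f x) - (s - x) * Im l) <= Cmod (f s - f x - RtoC (s - x) * l)%C).
    eapply Rle_trans; [|apply im_le_Cmod]. right; f_equal. unfold Re, Im; simpl. ring.
Qed.

(* Prolonging the trajectory by its tangent line for [t < 0] makes it two-sided differentiable at 0. *)
Lemma solution_extension (g : C -> C) (z : C) (v : R -> C) : cauchy_solution g z v ->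
  exists w, w 0 = z /\ forall t, 0 <= t -> w t = v t /\ unit_disk (w t) /\ rdiff w t (- g (w t))%C.
Proof.
  intros Hv. pose proof Hv as [Hv0 Hv1].
  set (w := fun t => if Rle_dec 0 t then v t else (v 0%R - t * g (v 0%R))%C).
  assert (Hw : forall t, 0 <= t -> w t = v t) by (intros; unfold w; destruct Rle_dec; [auto|lra]).
  assert (Hwn : forall t, t < 0 -> w t = (v 0%R - t * g (v 0%R))%C) by (intros; unfold w; destruct Rle_dec; [lra|auto]).
  exists w. split; [rewrite Hw by lra; auto|]. intros t Ht. split; [now apply Hw|].
  rewrite (Hw t Ht). split; [now apply Hv1|]. apply rdiff_eps. intros eps Heps.
  destruct (cauchy_solution_eps g z v t Hv Ht eps Heps) as [d [Hd Hdd]].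
  destruct (Rle_lt_or_eq_dec 0 t Ht) as [Hpos|<-].
  - exists (Rmin d t). split; [now apply Rmin_pos|]. intros s Hs.
    pose proof (Rlt_le_trans _ _ _ Hs (Rmin_l _ _)) as H1. pose proof (Rlt_le_trans _ _ _ Hs (Rmin_r _ _)) as H2.
    apply Rabs_def2 in H2. rewrite !Hw by lra.
    replace (v s - v t - RtoC (s - t) * - g (v t))%C with (v s - v t + RtoC (s - t) * g (v t))%C by ring.
    apply Hdd; auto; lra.
  - exists d. split; auto. intros s Hs. rewrite (Hw 0) by lra.
    destruct (Rle_lt_dec 0 s) as [Hs0|Hs0].
    + rewrite Hw by auto.
      replace (v s - v 0%R - RtoC (s - 0) * - g (v 0%R))%C with (v s - v 0%R + RtoC (s - 0) * g (v 0%R))%C by ring.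
      now apply Hdd.
    + rewrite Hwn by auto. replace (v 0%R - s * g (v 0%R) - v 0%R - RtoC (s - 0) * - g (v 0%R))%C with (RtoC 0).
      * rewrite Cmod_0. apply Rmult_le_pos; [lra|apply Rabs_pos].
      * rewrite Rminus_0_r. ring.
Qed.

Definition trajectory (g : C -> C) (w : R -> C) : Prop :=
  forall t, 0 <= t -> unit_disk (w t) /\ rdiff w t (- g (w t))%C.

Lemma trajectory_ccont_field (g : C -> C) (w : R -> C) (t : R) :
  holomorphic_on unit_disk g -> trajectory g w -> 0 <= t -> ccont (fun s => - g (w s))%C t.
Proof.
  intros Hg Hw Ht. rewrite holomorphic_cdiff in Hg. destruct (Hw t Ht) as [Hu Hd]. destruct (Hg _ Hu) as [k Hk].
  apply (ccont_ext (fun s => - (1) * g (w s))%C); [intros; ring|].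
  apply ccont_mult; [apply ccont_const|]. eapply ccont_cdiff_comp; eauto. eapply rdiff_ccont; eauto.
Qed.

Lemma trajectory_bounded (g : C -> C) (w : R -> C) (T : R) : trajectory g w -> 0 <= T ->
  exists r, 0 < r < 1 /\ forall t, 0 <= t <= T -> Cmod (w t) <= r.
Proof.
  intros Hw HT.
  destruct (continuity_ab_maj (fun t => Cmod (w t)) 0 T HT) as [m [Hm1 Hm2]].
  - intros t Ht. apply Cmod_continuity_pt. eapply rdiff_ccont. apply Hw; lra.
  - destruct (Hw m ltac:(lra)) as [Hu _]. unfold unit_disk in Hu. pose proof (Cmod_ge_0 (w m)).
    exists ((1 + Cmod (w m)) / 2). split; [lra|]. intros t Ht. specialize (Hm1 t Ht). lra.
Qed.

(** The local error of an Euler step, by two uses of the mean value inequality: the curve moves by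
    at most [M * s], so its velocity changes by at most [L * M * s]. No second derivative of the
    curve is needed. *)
Lemma trajectory_truncation (g : C -> C) (w : R -> C) (T r L M : R) : holomorphic_on unit_disk g ->
  trajectory g w -> 0 <= L ->
  (forall a b, Cmod a <= r -> Cmod b <= r -> Cmod (g b - g a)%C <= L * Cmod (b - a)%C) ->
  (forall a, Cmod a <= r -> Cmod (g a) <= M) ->
  (forall t, 0 <= t <= T -> Cmod (w t) <= r) ->
  forall t s, 0 <= t -> 0 <= s -> t + s <= T ->
    Cmod (w (t + s)%R - w t + s * g (w t))%C <= L * M * s ^ 2.
Proof.
  intros Hg Hw HL0 HL HM Hr t s Ht Hs Hts.
  assert (Hlip : forall x, t <= x <= t + s -> Cmod (w x - w t)%C <= M * s).
  { intros x Hx. apply Rle_trans with ((x - t) * M).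
    - apply curve_lipschitz with (df := fun y => (- g (w y))%C); [lra| | |].
      + intros y Hy. apply Hw; lra.
      + intros y Hy. apply trajectory_ccont_field; auto; lra.
      + intros y Hy. rewrite Cmod_opp. apply HM, Hr; lra.
    - assert (0 <= M) by (eapply Rle_trans; [apply Cmod_ge_0|apply (HM (w t)), Hr; lra]). nra. }
  pose (phi := fun y : R => (w y + RtoC y * g (w t))%C).
  assert (H : Cmod (phi (t + s)%R - phi t)%C <= (t + s - t) * (L * (M * s))).
  { apply curve_lipschitz with (df := fun y => (- g (w y) + g (w t))%C); [lra| | |].
    - intros y Hy. unfold phi. apply rdiff_plus; [apply Hw; lra|].
      eapply rdiff_eq; [apply rdiff_mult; [apply rdiff_RtoC|apply rdiff_const]|]. cbv beta. ring.
    - intros y Hy. apply ccont_plus; [|apply ccont_const]. apply trajectory_ccont_field; auto; lra.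
    - intros y Hy. replace (- g (w y) + g (w t))%C with (- (g (w y) - g (w t)))%C by ring. rewrite Cmod_opp.
      eapply Rle_trans; [apply HL; apply Hr; lra|]. apply Rmult_le_compat_l; auto. }
  unfold phi in H.
  replace (w (t + s)%R + RtoC (t + s) * g (w t) - (w t + t * g (w t)))%C with (w (t + s)%R - w t + s * g (w t))%C in H
    by (rewrite RtoC_plus; ring).
  eapply Rle_trans; [exact H|]. right; ring.
Qed.

(** Another discrete Gronwall argument, now with an initial error [z - w 0]. It is also a bootstrap:
    the smallness hypothesis keeps each iterate in the disk of radius [r'], where the Lipschitz
    bound for the next step is valid. *)
Lemma euler_close (f : C -> C) (w : R -> C) (z : C) (h r r' L K : R) (n : nat) : 0 <= L -> 0 <= K -> 0 <= h ->
  (forall a b, Cmod a <= r' -> Cmod b <= r' -> Cmod (f b - f a)%C <= L * Cmod (b - a)%C) ->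
  (forall t, 0 <= t <= INR n * h -> Cmod (w t) <= r) -> r <= r' ->
  (forall t s, 0 <= t -> 0 <= s -> t + s <= INR n * h -> Cmod (w (t + s)%R - w t + s * f (w t))%C <= K * s ^ 2) ->
  exp (INR n * (L * h)) * (Cmod (z - w 0%R)%C + INR n * (K * h ^ 2)) <= r' - r ->
  forall j, (j <= n)%nat -> Cmod (euler f h j z) <= r' /\
    Cmod (euler f h j z - w (INR j * h)%R)%C <= exp (INR n * (L * h)) * (Cmod (z - w 0%R)%C + INR n * (K * h ^ 2)).
Proof.
  intros HL0 HK0 Hh HL Hr Hrr HK Hsmall.
  set (x := L * h) in *. assert (Hx : 0 <= x) by (now apply Rmult_le_pos).
  set (e := K * h ^ 2) in *. assert (He : 0 <= e) by (apply Rmult_le_pos; auto; nra).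
  set (d0 := Cmod (z - w 0%R)%C) in *. assert (Hd0 : 0 <= d0) by apply Cmod_ge_0.
  assert (Hbase : forall j, (j <= n)%nat -> (1 + x) ^ j * (d0 + INR j * e) <= exp (INR n * x) * (d0 + INR n * e)).
  { intros j Hj. pose proof (le_INR _ _ Hj). pose proof (pos_INR j).
    apply Rmult_le_compat; [apply pow_le; lra|assert (0 <= INR j * e) by (now apply Rmult_le_pos); lra| |].
    - eapply Rle_trans; [now apply pow_1_plus_le_exp|]. apply exp_le_mono. now apply Rmult_le_compat_r.
    - apply Rplus_le_compat_l. now apply Rmult_le_compat_r. }
  assert (Hin : forall j, (j <= n)%nat -> 0 <= INR j * h <= INR n * h).
  { intros j Hj. pose proof (le_INR _ _ Hj). pose proof (pos_INR j). split; [now apply Rmult_le_pos|now apply Rmult_le_compat_r]. }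
  assert (Hball : forall j, (j <= n)%nat -> Cmod (euler f h j z - w (INR j * h)%R)%C <= (1 + x) ^ j * (d0 + INR j * e) ->
     Cmod (euler f h j z) <= r').
  { intros j Hj HH. pose proof (Cmod_sub_le (euler f h j z) (w (INR j * h)%R)). specialize (Hr _ (Hin j Hj)).
    specialize (Hbase j Hj). lra. }
  assert (Hind : forall j, (j <= n)%nat -> Cmod (euler f h j z - w (INR j * h)%R)%C <= (1 + x) ^ j * (d0 + INR j * e)).
  { induction j as [|j IH]; intros Hj.
    - cbn [euler pow INR]. rewrite Rmult_0_l. fold d0. lra.
    - specialize (IH ltac:(lia)). pose proof (Hball j ltac:(lia) IH) as HB.
      rewrite S_INR. replace ((INR j + 1) * h) with (INR j * h + h) by ring. cbn [euler].
      set (a := euler f h j z) in *. set (b := w (INR j * h)%R) in *.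
      pose proof (Hin j ltac:(lia)) as I1. pose proof (Hin (S j) Hj) as I2. rewrite S_INR in I2.
      pose proof (HK (INR j * h) h ltac:(lra) Hh ltac:(lra)) as HT. fold b e in HT.
      pose proof (Hr _ I1) as Hb. fold b in Hb.
      pose proof (HL b a ltac:(lra) HB) as HLb.
      set (d := Cmod (a - b)%C) in *.
      replace (a - h * f a - w (INR j * h + h)%R)%C with (a - b - h * (f a - f b) - (w (INR j * h + h)%R - b + h * f b))%C by ring.
      pose proof (Cmod_triangle (a - b - h * (f a - f b))%C (- (w (INR j * h + h)%R - b + h * f b))%C) as T1.
      pose proof (Cmod_triangle (a - b)%C (- (h * (f a - f b)))%C) as T2.
      rewrite Cmod_opp in T1, T2. rewrite Cmod_mult, Cmod_R, (Rabs_pos_eq h) in T2 by auto. fold d in T2.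
      assert (h * Cmod (f a - f b)%C <= x * d).
      { unfold x. replace (L * h * d) with (h * (L * d)) by ring. now apply Rmult_le_compat_l. }
      apply Rle_trans with ((1 + x) * d + e). { unfold Cminus in *. lra. }
      assert (Hp : 1 <= (1 + x) ^ (S j)) by (apply pow_R1_Rle; lra).
      assert ((1 + x) * d <= (1 + x) * ((1 + x) ^ j * (d0 + INR j * e))) by (apply Rmult_le_compat_l; lra).
      replace ((1 + x) ^ S j * (d0 + (INR j + 1) * e)) with ((1 + x) * ((1 + x) ^ j * (d0 + INR j * e)) + (1 + x) ^ S j * e) by (simpl; ring).
      assert (1 * e <= (1 + x) ^ S j * e) by (apply Rmult_le_compat_r; auto). lra. }
  intros j Hj. split; [now apply Hball; auto|]. eapply Rle_trans; [apply Hind|apply Hbase]; auto.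
Qed.

Lemma half_pow_mono (n m : nat) : (n <= m)%nat -> (/ 2) ^ m <= (/ 2) ^ n.
Proof.
  intros H. induction H; [lra|]. simpl. assert (0 < (/ 2) ^ m) by (apply pow_lt; lra). lra.
Qed.

(** Identifies the limit of the iterates with the given trajectory, and gives a neighbourhood of its
    starting point on which one level [k0] and one radius [r] serve all points. *)
Lemma euler2_near_trajectory (g : C -> C) (w : R -> C) (T : R) : holomorphic_on unit_disk g ->
  trajectory g w -> 0 <= T -> exists r d, 0 < r < 1 /\ 0 < d /\
  (exists k0, forall z, Cmod (z - w 0%R)%C <= d -> euler2_bounded g T z r k0) /\
  cconv (fun k => euler2 g T k (w 0)) (w T).
Proof.
  intros Hg Hw HT.
  destruct (trajectory_bounded g w T Hw HT) as [r [Hr Hwr]].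
  set (r' := (1 + r) / 2). assert (Hr' : r < r' < 1) by (unfold r'; lra).
  destruct (holomorphic_disk_bounds g r' Hg ltac:(lra)) as [L [M [HL0 [HM0 [HL HM]]]]].
  pose proof (trajectory_truncation g w T r' L M Hg Hw HL0 HL HM (fun t Ht => Rle_trans _ _ _ (Hwr t Ht) (Rlt_le _ _ (proj1 Hr')))) as HK.
  set (K := L * M) in *. assert (HK0 : 0 <= K) by (now apply Rmult_le_pos).
  set (E := exp (L * T)). assert (HE : 0 < E) by apply exp_pos.
  assert (HKT : 0 <= K * T ^ 2) by (apply Rmult_le_pos; auto; nra).
  assert (HEK : 0 <= E * (K * T ^ 2)) by (apply Rmult_le_pos; lra).
  assert (Hmain : forall k z, E * (Cmod (z - w 0%R)%C + K * T ^ 2 * (/ 2) ^ k) <= r' - r ->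
    forall j, (j <= 2 ^ k)%nat -> Cmod (euler g (T * RtoC ((/ 2) ^ k))%C j z) <= r' /\
      Cmod (euler g (T * RtoC ((/ 2) ^ k))%C j z - w (INR j * (T * (/ 2) ^ k))%R)%C <= E * (Cmod (z - w 0%R)%C + K * T ^ 2 * (/ 2) ^ k)).
  { intros k z Hs. pose proof (INR_pow2 k) as Hn. assert (Hp : 0 < (/ 2) ^ k) by (apply pow_lt; lra).
    set (p := (/ 2) ^ k) in *. set (n := (2 ^ k)%nat) in *.
    assert (E1 : INR n * (L * (T * p)) = L * T) by (replace (INR n * (L * (T * p))) with (L * T * (INR n * p)) by ring; rewrite Hn; ring).
    assert (E2 : INR n * (K * (T * p) ^ 2) = K * T ^ 2 * p) by (replace (INR n * (K * (T * p) ^ 2)) with (K * T ^ 2 * p * (INR n * p)) by ring; rewrite Hn; ring).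
    assert (E3 : INR n * (T * p) = T) by (replace (INR n * (T * p)) with (T * (INR n * p)) by ring; rewrite Hn; ring).
    rewrite <- RtoC_mult.
    assert (HX := euler_close g w z (T * p) r r' L K n HL0 HK0 ltac:(nra) HL).
    rewrite E1, E2, E3 in HX. fold E in HX. apply HX; auto; lra. }
  (* Half of the gap [r' - r] is spent on the displacement of the starting point, the other half on
     the truncation error from level [k0] on. *)
  exists r', ((r' - r) / (2 * E)). split; [lra|]. split; [apply Rdiv_lt_0_compat; lra|].
  destruct (half_pow_small (E * (K * T ^ 2)) ((r' - r) / 2)) as [k0 Hk0]; [auto|lra|].
  split.
  - exists k0. intros z Hz k Hk j Hj. apply Hmain; auto.
    pose proof (half_pow_mono k0 k Hk).
    apply Rmult_le_compat_l with (r := E) in Hz; [|lra].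
    replace (E * ((r' - r) / (2 * E))) with ((r' - r) / 2) in Hz by (field; lra).
    assert (E * (K * T ^ 2) * (/ 2) ^ k <= E * (K * T ^ 2) * (/ 2) ^ k0) by (now apply Rmult_le_compat_l). lra.
  - intros eps Heps.
    destruct (half_pow_small (E * (K * T ^ 2)) (Rmin eps (r' - r))) as [k1 Hk1]; [auto|apply Rmin_pos; lra|].
    exists k1. intros k Hk. pose proof (half_pow_mono k1 k Hk).
    assert (E * (K * T ^ 2) * (/ 2) ^ k <= E * (K * T ^ 2) * (/ 2) ^ k1) by (now apply Rmult_le_compat_l).
    assert (H00 : Cmod (w 0%R - w 0%R)%C = 0) by (replace (w 0%R - w 0%R)%C with (RtoC 0) by ring; apply Cmod_0).
    pose proof (Rmin_l eps (r' - r)). pose proof (Rmin_r eps (r' - r)).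
    destruct (Hmain k (w 0)) with (j := (2 ^ k)%nat) as [_ HH]; [rewrite H00; lra|auto|].
    rewrite H00 in HH.
    replace (INR (2 ^ k) * (T * (/ 2) ^ k)) with T in HH.
    2: { replace (INR (2 ^ k) * (T * (/ 2) ^ k)) with (T * (INR (2 ^ k) * (/ 2) ^ k)) by ring. rewrite INR_pow2; ring. }
    unfold euler2. lra.
Qed.

Lemma euler_fixpoint (f : C -> C) (h : C) (n : nat) : f 0 = 0 -> euler f h n 0 = 0.
Proof. intros Hf. induction n as [|n IH]; [auto|]. cbn [euler]. rewrite IH, Hf. ring. Qed.

Lemma generator_trajectory (f : C -> C) (z : C) : is_generator f -> unit_disk z ->
  exists w, w 0 = z /\ trajectory f w.
Proof.
  intros [_ Hf] Hz. destruct (Hf z Hz) as [v [Hv _]].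
  destruct (solution_extension f z v Hv) as [w [Hw0 Hw]]. exists w. split; auto.
  intros t Ht. apply Hw; auto.
Qed.

(* The time-[T] map of the flow is a locally uniform limit of Euler iterates, hence holomorphic in the
   initial point, and Schwarz's lemma applies to it. *)
Lemma generator_flow_contracts (f : C -> C) (w : R -> C) (T : R) : is_generator f -> f 0 = 0 ->
  trajectory f w -> 0 <= T -> Cmod (w T) <= Cmod (w 0).
Proof.
  intros Hf Hf0 Hw HT.
  set (F := fun x => limC (fun k => euler2 f T k x)).
  assert (HF : forall w, trajectory f w -> F (w 0) = w T).
  { intros w' Hw'. destruct (euler2_near_trajectory f w' T (proj1 Hf) Hw' HT) as [r [d [_ [_ [_ H]]]]].
    now apply limC_correct. }
  rewrite <- (HF w Hw). apply schwarz.
  - apply holomorphic_cdiff. intros z Hz.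
    destruct (generator_trajectory f z Hf Hz) as [w' [<- Hw']].
    destruct (euler2_near_trajectory f w' T (proj1 Hf) Hw' HT) as [r [d [Hr [Hd [[k0 Hk0] _]]]]].
    apply (euler2_limit_cdiff f (fun _ => RtoC T) (fun x => x) (w' 0) d r k0); auto.
    + apply Hf.
    + intros x Hx. split; [eexists; apply cdiff_const|]. split; [eexists; apply cdiff_id|auto].
  - unfold F. apply limC_correct. intros eps Heps. exists 0%nat. intros k _. unfold euler2.
    rewrite euler_fixpoint by auto. replace (0 - 0)%C with (RtoC 0) by ring. now rewrite Cmod_0.
  - intros z Hz. destruct (generator_trajectory f z Hf Hz) as [w' [<- Hw']]. rewrite HF by auto.
    apply Rlt_le. now apply (Hw' T HT).
  - apply (Hw 0). lra.
Qed.

Lemma Cmod_sqr (z : C) : Cmod z ^ 2 = Re z * Re z + Im z * Im z.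
Proof. rewrite Cmod2_alt. ring. Qed.

(** The derivative of the squared modulus along a trajectory from [z] is, at time 0, minus twice
    this real part; were it positive, the modulus would increase, against
    [generator_flow_contracts]. *)
Lemma generator_accretive (f : C -> C) (z : C) : is_generator f -> f 0 = 0 -> unit_disk z ->
  0 <= Re (Cconj z * f z)%C.
Proof.
  intros Hf Hf0 Hz. destruct (generator_trajectory f z Hf Hz) as [w [Hw0 Hw]].
  destruct (Hw 0 (Rle_refl 0)) as [_ [D1 D2]].
  set (phi := fun t => Re (w t) * Re (w t) + Im (w t) * Im (w t)).
  assert (Hphi : is_derive phi 0 (- (2 * Re (Cconj z * f z)%C))).
  { pose proof (is_derive_mult (K := R_AbsRing) _ _ _ _ _ D1 D1 Rmult_comm) as P1.
    pose proof (is_derive_mult (K := R_AbsRing) _ _ _ _ _ D2 D2 Rmult_comm) as P2.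
    pose proof (is_derive_plus (V := R_NormedModule) _ _ _ _ _ P1 P2) as P3.
    evar_last; [exact P3|]. unfold Re, Im. cbn. rewrite !Hw0. ring. }
  apply Rnot_lt_le. intros Hneg.
  set (c := - (2 * Re (Cconj z * f z)%C)) in *. assert (Hc : 0 < c) by (unfold c; lra).
  apply is_derive_Reals in Hphi. destruct (Hphi c Hc) as [d Hd].
  pose proof (cond_pos d) as Hdp.
  specialize (Hd (d / 2) ltac:(lra) ltac:(rewrite Rabs_pos_eq; lra)).
  apply Rabs_def2 in Hd. rewrite Rplus_0_l in Hd.
  assert (Hle : phi (d / 2) <= phi 0).
  { pose proof (generator_flow_contracts f w (d / 2) Hf Hf0 Hw ltac:(lra)) as H.
    unfold phi. rewrite <- !Cmod_sqr. apply pow_incr. split; auto using Cmod_ge_0. }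
  assert ((phi (d / 2) - phi 0) / (d / 2) <= 0).
  { apply Rmult_le_reg_r with (d / 2); [lra|]. unfold Rdiv at 1. rewrite Rmult_assoc, Rinv_l by lra. lra. }
  lra.
Qed.

(** * Geometry of the resolvent *)

Lemma generator_quotient (f : C -> C) (q : C) : is_generator f -> f 0 = 0 -> cdiff f 0 q -> 0 < Re q ->
  exists p, holomorphic_on unit_disk p /\ p 0 = q /\ (forall z, f z = (z * p z)%C) /\
    forall z, unit_disk z -> 0 <= Re (p z).
Proof.
  intros Hf Hf0 Hq Hq0. destruct (divide_by_z f q (proj1 Hf) Hf0 Hq) as [p [Hp [Hp0 Hfp]]].
  exists p. repeat split; auto. intros z Hz.
  destruct (Ceq_dec z 0) as [->|Hnz]; [rewrite Hp0; lra|].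
  pose proof (generator_accretive f z Hf Hf0 Hz) as H.
  rewrite Hfp in H. replace (Cconj z * (z * p z))%C with (RtoC (Cmod z ^ 2) * p z)%C in H.
  2: { rewrite Cmod2_conj. ring. }
  assert (0 < Cmod z ^ 2) by (apply pow_lt; now apply Cmod_gt_0).
  replace (Re (RtoC (Cmod z ^ 2) * p z)%C) with (Cmod z ^ 2 * Re (p z)) in H by (unfold Re; simpl; ring).
  apply Rmult_le_reg_l with (Cmod z ^ 2); lra.
Qed.

(** Schwarz's lemma after the Cayley map [(a - q) / (a + Cconj q)], which sends the right half-plane
    to the disk and [q] to 0. *)
Lemma schwarz_half_plane (p : C -> C) (q z : C) : holomorphic_on unit_disk p -> p 0 = q -> 0 < Re q ->
  (forall z, unit_disk z -> 0 <= Re (p z)) -> unit_disk z ->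
  Cmod (p z - q)%C <= Cmod z * Cmod (p z + Cconj q)%C.
Proof.
  intros Hp Hp0 Hq Hre Hz.
  assert (Hn : forall z, unit_disk z -> (p z + Cconj q)%C <> 0).
  { intros w Hw E. apply (f_equal Re) in E. specialize (Hre w Hw).
    unfold Re in *; simpl in E. lra. }
  assert (Hle : forall z, unit_disk z -> Cmod (p z - q)%C <= Cmod (p z + Cconj q)%C).
  { intros w Hw. apply Rsqr_incr_0_var; [|apply Cmod_ge_0]. unfold Rsqr.
    replace (Cmod (p w - q)%C * Cmod (p w - q)%C) with (Cmod (p w - q)%C ^ 2) by ring.
    replace (Cmod (p w + Cconj q)%C * Cmod (p w + Cconj q)%C) with (Cmod (p w + Cconj q)%C ^ 2) by ring.
    rewrite !Cmod_sqr. specialize (Hre w Hw). unfold Re, Im in *. simpl. nra. }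
  pose proof (schwarz (fun z => ((p z - q) / (p z + Cconj q))%C)) as HS. cbv beta in HS.
  assert (H : Cmod ((p z - q) / (p z + Cconj q))%C <= Cmod z).
  { apply HS; auto.
    - rewrite holomorphic_cdiff in *. intros w Hw. destruct (Hp w Hw) as [k Hk].
      eapply cdiff_div; auto; (apply cdiff_plus; [exact Hk|apply cdiff_const]).
    - rewrite Hp0. replace (q - q)%C with (RtoC 0) by ring. unfold Cdiv. ring.
    - intros w Hw. rewrite Cmod_div by auto.
      assert (0 < Cmod (p w + Cconj q)%C) by (apply Cmod_gt_0; auto).
      apply Rmult_le_reg_r with (Cmod (p w + Cconj q)%C); auto.
      unfold Rdiv. rewrite Rmult_assoc, Rinv_l, Rmult_1_r, Rmult_1_l by lra. auto. }
  rewrite Cmod_div in H by auto.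
  assert (H0 : 0 < Cmod (p z + Cconj q)%C) by (apply Cmod_gt_0; auto).
  apply Rmult_le_compat_r with (r := Cmod (p z + Cconj q)%C) in H; [|lra].
  unfold Rdiv in H. rewrite Rmult_assoc, Rinv_l, Rmult_1_r in H by lra. exact H.
Qed.

(** The hypothesis confines [a] to a hyperbolic disk about [q]. The two conclusions are Harnack's
    lower bound for the real part and the Borel-Caratheodory bound for the distance to [q]. *)
Lemma half_plane_bounds (a q : C) (s : R) : 0 < Re q -> 0 <= Re a -> 0 <= s < 1 ->
  Cmod (a - q)%C <= s * Cmod (a + Cconj q)%C ->
  Re q * (1 - s) <= Re a * (1 + s) /\ Cmod (a - q)%C * (1 - s) <= 2 * Re q * s.
Proof.
  intros Hq Ha Hs H. split.
  - assert (H2 : Cmod (a - q)%C ^ 2 <= s ^ 2 * Cmod (a + Cconj q)%C ^ 2).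
    { rewrite <- Rpow_mult_distr. apply pow_incr. split; auto using Cmod_ge_0. }
    rewrite !Cmod_sqr in H2. destruct a as [a1 a2], q as [q1 q2]; unfold Re, Im in *; simpl in *.
    set (y := a2 + - q2) in *. replace (a2 + - q2) with y in H2 by reflexivity.
    assert (Hy : 0 <= y * y * (1 - s * s)) by (apply Rmult_le_pos; nra).
    apply Rnot_lt_le. intros Hlt.
    assert (s * (a1 + q1) < q1 - a1) by lra.
    assert (0 <= s * (a1 + q1)) by (apply Rmult_le_pos; lra).
    nra.
  - assert (Cmod (a + Cconj q)%C <= Cmod (a - q)%C + 2 * Re q).
    { replace (a + Cconj q)%C with (a - q + RtoC (2 * Re q))%C.
      2: { destruct a, q; unfold Re, Cconj, Cminus, Cplus, Copp, RtoC; simpl; f_equal; ring. }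
      eapply Rle_trans; [apply Cmod_triangle|]. rewrite Cmod_R, Rabs_pos_eq; lra. }
    nra.
Qed.

(** With [s < 1 / (x - 1)] one has [s / (1 - s) < 1 / (x - 2)], so Borel-Caratheodory gives
    [r * Cmod (p z - q) <= 2 * x / (x - 2)]; division by [Cmod (1 + r * q) >= x + 1] gives this
    formula. *)
Definition delta_ (x : R) : R := 2 * x / ((x - 2) * (x + 1)).

(* Harnack's inequality confines [G w] to the disk of radius [1 / (x - 1)], where Borel-Caratheodory
   bounds the oscillation of [p]. *)
Lemma resolvent_quotient (q : C) (r : R) (G : C -> C) : 0 < Re q -> 6 <= r * Re q -> resolvent_class q r G ->
  forall w, unit_disk w -> exists e, Cmod e <= delta_ (r * Re q) /\
    1 <= Re ((1 + r * q) * (1 + e))%C /\ (G w * ((1 + r * q) * (1 + e)))%C = w.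
Proof.
  intros Hq Hx [f [Hf [Hf0 [Hfq [HG1 HG2]]]]] w Hw.
  apply cdiff_is_derive in Hfq.
  destruct (generator_quotient f q Hf Hf0 Hfq Hq) as [p [Hp [Hp0 [Hfp Hre]]]].
  set (x := r * Re q) in *.
  assert (Hr : 0 < r) by (unfold x in Hx; nra).
  destruct (HG2 w Hw) as [Hz HGw]. set (z := G w) in *. rewrite Hfp in HGw.
  pose proof (Hre z Hz) as Hrez.
  pose proof (schwarz_half_plane p q z Hp Hp0 Hq Hre Hz) as HS.
  unfold unit_disk in Hz, Hw. set (s := Cmod z) in *. assert (Hs : 0 <= s) by apply Cmod_ge_0.
  destruct (half_plane_bounds (p z) q s Hq Hrez (conj Hs Hz) HS) as [H1 H2].
  assert (HwE : (z * (1 + r * p z))%C = w) by (rewrite <- HGw; ring).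
  assert (HReM : Re (1 + r * p z)%C = 1 + r * Re (p z)) by (unfold Re; simpl; ring).
  assert (HQre : Re (1 + r * q)%C = 1 + x) by (unfold x, Re; simpl; ring).
  assert (Hlt : s * (1 + r * Re (p z)) < 1).
  { apply Rle_lt_trans with (Cmod w); auto. rewrite <- HwE, Cmod_mult. apply Rmult_le_compat_l; auto.
    rewrite <- HReM. eapply Rle_trans; [apply Rle_abs|apply re_le_Cmod]. }
  (* Harnack's inequality turns [Hlt] into [s * x * (1 - s) < (1 - s) * (1 + s)]; then [1 - s > 0]
     is cancelled. *)
  assert (Hsx : s * (x - 1) < 1).
  { apply Rmult_le_compat_l with (r := r) in H1; [|lra].
    replace (r * (Re q * (1 - s))) with (x * (1 - s)) in H1 by (unfold x; ring).
    assert (s * (x * (1 - s)) <= s * (r * (Re (p z) * (1 + s)))) by (apply Rmult_le_compat_l; lra).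
    nra. }
  assert (HQ : 1 + x <= Cmod (1 + r * q)%C).
  { rewrite <- HQre. eapply Rle_trans; [apply Rle_abs|apply re_le_Cmod]. }
  assert (HQ0 : (1 + r * q)%C <> 0) by (apply Cmod_gt_0; lra).
  set (e := (r * (p z - q) / (1 + r * q))%C).
  assert (He : ((1 + r * q) * (1 + e) = 1 + r * p z)%C) by (unfold e; field; auto).
  exists e. rewrite He. split; [|split; auto].
  - unfold e. rewrite Cmod_div, Cmod_mult, Cmod_R, Rabs_pos_eq by (auto; lra).
    apply Rmult_le_compat_l with (r := r) in H2; [|lra].
    replace (r * (2 * Re q * s)) with (2 * x * s) in H2 by (unfold x; ring).
    assert (Hb : (r * Cmod (p z - q)%C) * (x - 2) <= 2 * x).
    { set (y := r * Cmod (p z - q)%C) in *. assert (Hy0 : 0 <= y) by (apply Rmult_le_pos; [lra|apply Cmod_ge_0]).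
      replace (r * (Cmod (p z - q)%C * (1 - s))) with (y * (1 - s)) in H2 by (unfold y; ring).
      assert (Hs2 : s * (x - 2) <= 1 - s) by lra.
      assert (y * (1 - s) * (x - 2) <= 2 * x * s * (x - 2)) by (apply Rmult_le_compat_r; lra).
      assert (2 * x * s * (x - 2) <= 2 * x * (1 - s)) by (replace (2 * x * s * (x - 2)) with (2 * x * (s * (x - 2))) by ring; apply Rmult_le_compat_l; lra).
      apply Rmult_le_reg_r with (1 - s); lra. }
    unfold delta_. set (y := r * Cmod (p z - q)%C) in *.
    apply Rmult_le_reg_r with (Cmod (1 + r * q)%C); [lra|].
    unfold Rdiv at 1. rewrite Rmult_assoc, Rinv_l, Rmult_1_r by lra.
    apply Rle_trans with (2 * x / ((x - 2) * (x + 1)) * (1 + x)).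
    + replace (2 * x / ((x - 2) * (x + 1)) * (1 + x)) with (2 * x / (x - 2)) by (field; lra).
      apply Rmult_le_reg_r with (x - 2); [lra|]. unfold Rdiv. rewrite Rmult_assoc, Rinv_l; lra.
    + apply Rmult_le_compat_l; auto. apply Rdiv_le_0_compat; nra.
  - rewrite HReM. assert (0 <= r * Re (p z)) by (apply Rmult_le_pos; lra). lra.
Qed.

(** * Numerical bounds for [delta_] and [gamma_] *)

Lemma delta_bound (x : R) : 6 <= x -> 0 < delta_ x <= 3 / 7.
Proof.
  intros Hx. unfold delta_. split.
  - apply Rdiv_lt_0_compat; nra.
  (* [delta_] decreases for [x > 2] and equals 3/7 at 6. *)
  - apply Rmult_le_reg_r with ((x - 2) * (x + 1)); [nra|]. unfold Rdiv at 1. rewrite Rmult_assoc, Rinv_l by nra. nra.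
Qed.

(** This is [A x < 1], hence the positivity of [gamma_]. The difference of the two sides is a cubic
    that is still positive at 6, where it equals 4. *)
Lemma A_den_pos (x : R) : 6 <= x -> 6 * x * (1 + x) < (1 + x) ^ 3 - 3 * (5 * x - 1).
Proof.
  intros Hx. assert (H : 0 < x ^ 3 - 3 * x ^ 2 - 18 * x + 4).
  { replace (x ^ 3 - 3 * x ^ 2 - 18 * x + 4) with ((x - 6) * (x * x + 3 * x) + 4) by ring.
    assert (0 <= (x - 6) * (x * x + 3 * x)) by (apply Rmult_le_pos; nra). lra. }
  nra.
Qed.

(** Since [1 - gamma = 2 * A / (1 + A)], the last inequality is between rational functions of [x].
    The factor 9/4 is slightly less than the quotient of [1 - gamma] by [delta_] at [x = 6], which
    is about 2.31. *)
Lemma gamma_bounds (q : C) (r : R) : 6 <= r * Re q ->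
  0 < gamma_ q r < 1 /\ 9 / 4 * delta_ (r * Re q) <= 1 - gamma_ q r.
Proof.
  intros Hx. unfold gamma_. set (x := r * Re q) in *.
  pose proof (A_den_pos x Hx) as HD. set (D := (1 + x) ^ 3 - 3 * (5 * x - 1)) in *.
  assert (HN : 0 < 6 * x * (1 + x)) by nra.
  assert (HA : A x = 6 * x * (1 + x) / D) by reflexivity.
  assert (HD0 : 0 < D) by lra.
  assert (HA0 : 0 < A x) by (rewrite HA; apply Rdiv_lt_0_compat; lra).
  assert (HA1 : A x < 1).
  { rewrite HA. apply Rmult_lt_reg_r with D; auto. unfold Rdiv. rewrite Rmult_assoc, Rinv_l; lra. }
  assert (Hg1 : (1 - A x) / (1 + A x) < 1).
  { apply Rmult_lt_reg_r with (1 + A x); [lra|]. unfold Rdiv. rewrite Rmult_assoc, Rinv_l; lra. }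
  split; [split; auto; apply Rdiv_lt_0_compat; lra|].
  replace (1 - (1 - A x) / (1 + A x)) with (2 * (6 * x * (1 + x)) / (D + 6 * x * (1 + x))).
  2: { rewrite HA. field. split; lra. }
  unfold delta_.
  apply Rmult_le_reg_r with ((x - 2) * (x + 1) * (D + 6 * x * (1 + x))); [apply Rmult_lt_0_compat; nra|].
  replace (9 / 4 * (2 * x / ((x - 2) * (x + 1))) * ((x - 2) * (x + 1) * (D + 6 * x * (1 + x))))
    with (9 / 2 * x * (D + 6 * x * (1 + x))) by (field; lra).
  replace (2 * (6 * x * (1 + x)) / (D + 6 * x * (1 + x)) * ((x - 2) * (x + 1) * (D + 6 * x * (1 + x))))
    with (12 * x * ((1 + x) * ((x - 2) * (x + 1)))) by (field; lra).
  (* After clearing denominators the two sides differ by [x / 2] times this cubic. *)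
  assert (HP : 0 <= 15 * x ^ 3 - 81 * x ^ 2 - 18 * x - 84).
  { replace (15 * x ^ 3 - 81 * x ^ 2 - 18 * x - 84) with ((x - 6) * (15 * x ^ 2 + 9 * x + 36) + 132) by ring.
    assert (0 <= (x - 6) * (15 * x ^ 2 + 9 * x + 36)) by (apply Rmult_le_pos; nra). lra. }
  unfold D.
  assert (0 <= x * (15 * x ^ 3 - 81 * x ^ 2 - 18 * x - 84)) by (apply Rmult_le_pos; lra). nra.
Qed.

(** * Arguments of complex numbers and log-concavity of the cosine *)

Lemma Carg_polar (z : C) : z <> 0 -> z = (Cmod z * cis (Carg z))%C.
Proof.
  intros Hz. pose proof (proj1 (Cmod_gt_0 z) Hz) as Hm.
  pose proof (re_le_Cmod z) as Hre. apply Rabs_le_between in Hre.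
  set (c := Re z / Cmod z).
  assert (Hc : -1 <= c <= 1).
  { unfold c. split; apply Rmult_le_reg_r with (Cmod z); auto; unfold Rdiv; rewrite Rmult_assoc, Rinv_l; lra. }
  assert (Hs : sin (acos c) = Rabs (Im z) / Cmod z).
  { rewrite sin_acos by auto. rewrite <- (sqrt_Rsqr (Rabs (Im z) / Cmod z)).
    2: { apply Rdiv_le_0_compat; auto. apply Rabs_pos. }
    f_equal. unfold c, Rsqr.
    replace (Rabs (Im z) / Cmod z * (Rabs (Im z) / Cmod z)) with (Rabs (Im z) * Rabs (Im z) / (Cmod z ^ 2)) by (field; lra).
    replace (1 - Re z / Cmod z * (Re z / Cmod z)) with ((Cmod z ^ 2 - Re z * Re z) / (Cmod z ^ 2)) by (field; lra).
    f_equal. rewrite Cmod_sqr, <- Rabs_mult, Rabs_pos_eq by nra. ring. }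
  assert (E : forall a, cos a = Re z / Cmod z -> sin a = Im z / Cmod z -> z = (Cmod z * cis a)%C).
  { intros a Ha Hb. unfold cis. rewrite Ha, Hb. rewrite (surjective_pairing z) at 1.
    unfold Cmult, RtoC; simpl. unfold Re, Im. f_equal; field; lra. }
  apply E; unfold Carg; fold c; destruct (Rle_dec 0 (Im z)).
  - now rewrite cos_acos.
  - rewrite cos_neg. now rewrite cos_acos.
  - rewrite Hs, Rabs_pos_eq; auto.
  - rewrite sin_neg, Hs, Rabs_left by lra. field. lra.
Qed.

Lemma Carg_right_half_plane (z : C) : 0 < Re z -> Rabs (Carg z) < PI / 2.
Proof.
  intros Hz.
  assert (Hm : 0 < Cmod z). { eapply Rlt_le_trans; [exact Hz|]. eapply Rle_trans; [apply Rle_abs|apply re_le_Cmod]. }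
  assert (H : 0 < cos (acos (Re z / Cmod z)) ).
  { pose proof (re_le_Cmod z) as Hre. apply Rabs_le_between in Hre.
    rewrite cos_acos; [apply Rdiv_lt_0_compat; auto|].
    split; apply Rmult_le_reg_r with (Cmod z); auto; unfold Rdiv; rewrite Rmult_assoc, Rinv_l; lra. }
  pose proof (acos_bound (Re z / Cmod z)) as Hb. set (a := acos (Re z / Cmod z)) in *.
  assert (Ha : a < PI / 2).
  { apply Rnot_le_lt. intros Hle. pose proof (cos_le_0 a Hle). lra. }
  unfold Carg. fold a. destruct Rle_dec; apply Rabs_def1; lra.
Qed.

Lemma sin_ge_cubic (x : R) : 0 <= x <= 4 -> x - x ^ 3 / 6 <= sin x.
Proof.
  intros Hx. destruct (pre_sin_bound x 0) as [H _]; try lra.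
  unfold sin_approx, sin_term in H. simpl in H. lra.
Qed.

Lemma cos_ge_quadratic (x : R) : -2 <= x <= 2 -> 1 - x ^ 2 / 2 <= cos x.
Proof.
  intros Hx. destruct (pre_cos_bound x 0) as [H _]; try lra.
  unfold cos_approx, cos_term in H. simpl in H. lra.
Qed.

(** Seen from 0, the disk of radius [d] about 1 has half-angle [asin d]. The factor 11/10 is a
    linear replacement for the arcsine, valid up to 3/7. *)
Lemma Carg_near_1 (e : C) (d : R) : Cmod e <= d -> 0 < d <= 3 / 7 -> Rabs (Carg (1 + e)%C) <= 11 / 10 * d.
Proof.
  intros He Hd.
  pose proof (re_le_Cmod e) as Hre. apply Rabs_le_between in Hre.
  assert (HRe : Re (1 + e)%C = 1 + Re e) by reflexivity.
  assert (HIm : Im (1 + e)%C = Im e) by (unfold Im; simpl; ring).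
  assert (Hpos : 0 < Re (1 + e)%C) by lra.
  assert (Hm : 0 < Cmod (1 + e)%C). { eapply Rlt_le_trans; [exact Hpos|]. eapply Rle_trans; [apply Rle_abs|apply re_le_Cmod]. }
  pose proof (Carg_right_half_plane _ Hpos) as Hb.
  pose proof (Carg_polar (1 + e)%C (proj2 (Cmod_gt_0 _) Hm)) as HP.
  set (h := Carg (1 + e)%C) in *.
  apply (f_equal Im) in HP.
  replace (Im (Cmod (1 + e) * cis h)%C) with (Cmod (1 + e)%C * sin h) in HP by (unfold Im; simpl; ring).
  assert (Hsin : Rabs (sin h) <= d).
  { apply Rsqr_incr_0_var; [|lra]. rewrite <- Rsqr_abs. unfold Rsqr.
    assert (Hsq : Cmod e ^ 2 <= d ^ 2) by (apply pow_incr; split; auto using Cmod_ge_0).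
    rewrite Cmod_sqr in Hsq.
    pose proof (Cmod_sqr (1 + e)%C) as HC. rewrite HRe, HIm in HC. rewrite HIm in HP.
    apply Rmult_le_reg_l with (Cmod (1 + e)%C ^ 2); [now apply pow_lt|].
    replace (Cmod (1 + e)%C ^ 2 * (sin h * sin h)) with ((Cmod (1 + e)%C * sin h) * (Cmod (1 + e)%C * sin h)) by ring.
    rewrite <- HP, HC. set (a := Re e) in *. set (y := Im e) in *.
    (* With [y * y <= d ^ 2 - a * a], the claim [y * y <= d * d * ((1 + a) ^ 2 + y * y)] reduces to
       the square of [a + d * d] being nonnegative. *)
    assert (y * y * (1 - d * d) <= (d ^ 2 - a * a) * (1 - d * d)) by (apply Rmult_le_compat_r; nra).
    pose proof (Rle_0_sqr (a + d * d)) as Hsq2. unfold Rsqr in Hsq2. nra. }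
  apply Rnot_lt_le. intros Hlt.
  assert (Hs : sin (11 / 10 * d) < Rabs (sin h)).
  { apply Rabs_def2 in Hb. pose proof PI2_3_2.
    destruct (Rle_lt_dec 0 h).
    - rewrite Rabs_pos_eq in Hlt by auto. eapply Rlt_le_trans; [|apply Rle_abs]. apply sin_increasing_1; lra.
    - rewrite Rabs_left in Hlt by auto. eapply Rlt_le_trans; [|rewrite <- Rabs_Ropp; apply Rle_abs].
      rewrite <- sin_neg. apply sin_increasing_1; lra. }
  pose proof (sin_ge_cubic (11 / 10 * d) ltac:(lra)) as Hc.
  assert (d <= 11 / 10 * d - (11 / 10 * d) ^ 3 / 6).
  { assert (d * d <= 9 / 49) by nra.
    replace (11 / 10 * d - (11 / 10 * d) ^ 3 / 6) with (d * (11 / 10 - 1331 / 6000 * (d * d))) by field. nra. }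
  lra.
Qed.

Lemma ln_cos_tangent (a m : R) : - (PI / 2) < a < PI / 2 -> - (PI / 2) < m < PI / 2 ->
  ln (cos a) <= ln (cos m) - tan m * (a - m).
Proof.
  intros Ha Hm.
  assert (Hd : forall t, - (PI / 2) < t < PI / 2 -> is_derive (fun t => ln (cos t) + tan m * t) t (- tan t + tan m)).
  { intros t Ht. assert (0 < cos t) by (apply cos_gt_0; lra).
    assert (0 < cos m) by (apply cos_gt_0; lra). auto_derive; auto. unfold tan. field. lra. }
  destruct (MVT_gen (fun t => ln (cos t) + tan m * t) m a (fun t => - tan t + tan m)) as [c [Hc HE]].
  - intros t Ht. apply Hd. unfold Rmin, Rmax in Ht. destruct Rle_dec; lra.
  - intros t Ht. apply derivable_continuous_pt. exists (- tan t + tan m). apply is_derive_Reals, Hd.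
    unfold Rmin, Rmax in Ht. destruct Rle_dec; lra.
  - cbv beta in HE.
    assert (Hmono : forall x y, - (PI / 2) < x -> x <= y -> y < PI / 2 -> tan x <= tan y).
    { intros x y Hx Hxy Hy. destruct Hxy as [Hlt| ->]; [left; apply tan_increasing; lra|lra]. }
    assert ((- tan c + tan m) * (a - m) <= 0).
    { unfold Rmin, Rmax in Hc. destruct Rle_dec.
      - pose proof (Hmono m c ltac:(lra) ltac:(lra) ltac:(lra)). nra.
      - pose proof (Hmono c m ltac:(lra) ltac:(lra) ltac:(lra)). nra. }
    nra.
Qed.

(** Jensen's inequality for [ln cos]: both points are compared with the tangent at their weighted
    mean [m], where the linear terms cancel. *)
Lemma cos_log_concave (a b g : R) : - (PI / 2) < a < PI / 2 -> - (PI / 2) < b < PI / 2 -> 0 < g < 1 ->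
  Rpower (cos a) g * Rpower (cos b) (1 - g) <= cos (g * a + (1 - g) * b).
Proof.
  intros Ha Hb Hg. set (m := g * a + (1 - g) * b).
  assert (Hm : - (PI / 2) < m < PI / 2) by (unfold m; nra).
  assert (Hc : 0 < cos m) by (apply cos_gt_0; lra).
  rewrite <- (exp_ln (cos m)) by auto. unfold Rpower. rewrite <- exp_plus. apply exp_le_mono.
  pose proof (ln_cos_tangent a m Ha Hm) as H1. pose proof (ln_cos_tangent b m Hb Hm) as H2.
  apply Rmult_le_compat_l with (r := g) in H1; [|lra]. apply Rmult_le_compat_l with (r := 1 - g) in H2; [|lra].
  assert (E : g * (tan m * (a - m)) + (1 - g) * (tan m * (b - m)) = 0) by (unfold m; ring). lra.
Qed.

Lemma cis_plus (a b : R) : cis (a + b) = (cis a * cis b)%C.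
Proof. unfold cis, Cmult; simpl. rewrite cos_plus, sin_plus. f_equal; ring. Qed.

Lemma Re_quotient_polar (a b c : C) : a <> 0 -> b <> 0 -> c <> 0 ->
  Re (a / (b * c))%C = Cmod a / (Cmod b * Cmod c) * cos (Carg a - Carg b - Carg c).
Proof.
  intros Ha Hb Hc.
  pose proof (proj1 (Cmod_gt_0 b) Hb) as Hbm. pose proof (proj1 (Cmod_gt_0 c) Hc) as Hcm.
  assert (E : (a / (b * c) = RtoC (Cmod a / (Cmod b * Cmod c)) * cis (Carg a - Carg b - Carg c))%C).
  { assert (Hb0 : RtoC (Cmod b) <> 0) by (apply RtoC_neq; lra).
    assert (Hc0 : RtoC (Cmod c) <> 0) by (apply RtoC_neq; lra).
    assert (E1 : cis (Carg a) = (cis (Carg a - Carg b - Carg c) * (cis (Carg b) * cis (Carg c)))%C).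
    { rewrite <- !cis_plus. f_equal. ring. }
    rewrite (Carg_polar a Ha) at 1. rewrite (Carg_polar b Hb) at 1. rewrite (Carg_polar c Hc) at 1.
    rewrite E1. unfold Rdiv. rewrite RtoC_mult, RtoC_inv, RtoC_mult by nra.
    field. repeat split; auto using cis_neq_0. }
  rewrite E. unfold Re, cis; simpl. ring.
Qed.

Lemma Carg_1 : Carg 1 = 0.
Proof.
  unfold Carg. rewrite Cmod_1. replace (Re 1 / 1) with 1 by (unfold Re; simpl; field).
  rewrite acos_1. destruct Rle_dec; ring.
Qed.

Lemma Cmod_1_plus_le (e : C) (d : R) : Cmod e <= d -> Cmod (1 + e)%C <= 1 + d.
Proof. intros He. pose proof (Cmod_triangle 1 e) as H. rewrite Cmod_1 in H. lra. Qed.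

Lemma one_plus_neq_0 (e : C) (d : R) : Cmod e <= d -> d <= 3 / 7 -> (1 + e)%C <> 0.
Proof.
  intros He Hd. apply Cmod_gt_0. pose proof (Cmod_sub_le 1 (1 + e)%C) as H.
  replace (1 - (1 + e))%C with (- e)%C in H by ring. rewrite Cmod_1, Cmod_opp in H. lra.
Qed.

Lemma one_plus_rq (q : C) (r : R) : Re (1 + r * q)%C = 1 + r * Re q.
Proof. unfold Re; simpl; ring. Qed.

(* The level [(2 cos b)^beta] at [b = eta / beta] absorbs the factor [|1 + e|]; log-concavity of the
   cosine does the rest. *)
Lemma kappa_le_Re (q : C) (r : R) (e : C) : 0 < Re q -> 6 <= r * Re q ->
  Rabs (Carg (1 + r * q)%C) < PI * gamma_ q r / 2 -> Cmod e <= delta_ (r * Re q) ->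
  kappa_ q r <= Re (1 / ((1 + r * q) * (1 + e)))%C.
Proof.
  intros Hq Hx Hth He.
  destruct (gamma_bounds q r Hx) as [Hg Hgd]. destruct (delta_bound _ Hx) as [Hd0 Hd1].
  set (d := delta_ (r * Re q)) in *.
  assert (Hr : 0 < r) by nra.
  assert (HQm : 0 < Cmod (1 + r * q)%C).
  { pose proof (re_le_Cmod (1 + r * q)%C). pose proof (Rle_abs (Re (1 + r * q)%C)). rewrite one_plus_rq in *. nra. }
  assert (HQ0 : (1 + r * q)%C <> 0) by (now apply Cmod_gt_0).
  pose proof (one_plus_neq_0 e d He Hd1) as He0. pose proof (proj1 (Cmod_gt_0 _) He0) as Hem.
  rewrite Re_quotient_polar; auto; [|apply RtoC_neq; lra]. rewrite Carg_1, Cmod_1.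
  pose proof (Carg_near_1 e d He (conj Hd0 Hd1)) as Heta.
  unfold kappa_, Cpower. unfold Re at 1. simpl fst.
  set (g := gamma_ q r) in *. set (th := Carg (1 + r * q)%C) in *. set (eta := Carg (1 + e)%C) in *.
  set (Q := Cmod (1 + r * q)%C) in *. set (E := Cmod (1 + e)%C) in *.
  assert (HPI : 3 < PI) by (pose proof PI2_3_2; lra).
  (* Chosen so that [th + eta = g * a + (1 - g) * b], while [cos a] is the cosine inside
     [kappa_]. *)
  set (a := 1 / g * th). set (b := eta / (1 - g)).
  assert (Ha : - (PI / 2) < a < PI / 2).
  { assert (Ea : th = a * g) by (unfold a; field; lra). rewrite Ea in Hth. apply Rabs_def2 in Hth.
    split; apply Rmult_lt_reg_r with g; lra. }
  (* The quotient of the constants 11/10 and 9/4. *)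
  assert (Hb : Rabs b <= 44 / 90).
  { unfold b, Rdiv. rewrite Rabs_mult, (Rabs_pos_eq (/ (1 - g))) by (left; apply Rinv_0_lt_compat; lra).
    apply Rmult_le_reg_r with (1 - g); [lra|]. rewrite Rmult_assoc, Rinv_l by lra. lra. }
  assert (Hb' : - (44 / 90) <= b <= 44 / 90) by (apply Rabs_le_between; exact Hb).
  assert (Hca : 0 < cos a) by (apply cos_gt_0; lra).
  assert (Hcb : 7 / 8 <= cos b) by (pose proof (cos_ge_quadratic b ltac:(lra)); nra).
  pose proof (cos_log_concave a b g Ha ltac:(lra) Hg) as HL.
  replace (g * a + (1 - g) * b) with (th + eta) in HL by (unfold a, b; field; lra).
  replace (0 - th - eta) with (- (th + eta)) by ring. rewrite cos_neg.
  assert (HE : E <= Rpower 2 (1 - g) * Rpower (cos b) (1 - g)).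
  { rewrite Rpower_mult_distr by lra.
    apply Rle_trans with (1 + d); [now apply Cmod_1_plus_le|].
    apply Rle_trans with (exp d); [apply exp_ineq1_le|].
    unfold Rpower. apply exp_le_mono.
    (* As [2 * cos b >= 7 / 4] and [(7 / 4) ^ 2 >= 3 >= exp 1]. Together with [1 - g >= 9 / 4 * d]
       this gives [d <= (1 - g) * ln (2 * cos b)]. *)
    assert (Hln : 1 / 2 <= ln (2 * cos b)).
    { apply Rmult_le_reg_l with 2; [lra|]. replace (2 * (1 / 2)) with 1 by field.
      replace (2 * ln (2 * cos b)) with (ln (2 * cos b) + ln (2 * cos b)) by ring.
      rewrite <- ln_mult by lra. rewrite <- (ln_exp 1). apply ln_le; [apply exp_pos|].
      pose proof exp_le_3. nra. }
    nra. }
  assert (HB0 : Rpower (Rpower Q (1 / g) * cos a) g = Q * Rpower (cos a) g).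
  { rewrite <- Rpower_mult_distr; auto; [|apply exp_pos]. rewrite Rpower_mult.
    replace (1 / g * g) with 1 by (field; lra). rewrite Rpower_1; auto. }
  rewrite HB0.
  assert (H2 : 0 < Rpower 2 (1 - g)) by apply exp_pos.
  assert (HA : 0 < Rpower (cos a) g) by apply exp_pos.
  assert (HBp : 0 < Rpower (cos b) (1 - g)) by apply exp_pos.
  apply Rmult_le_reg_r with (Rpower 2 (1 - g) * Q * E); [apply Rmult_lt_0_compat; auto; now apply Rmult_lt_0_compat|].
  replace (Q * Rpower (cos a) g / (Rpower 2 (1 - g) * Q ^ 2) * (Rpower 2 (1 - g) * Q * E)) with (Rpower (cos a) g * E) by (field; lra).
  replace (1 / (Q * E) * cos (th + eta) * (Rpower 2 (1 - g) * Q * E)) with (Rpower 2 (1 - g) * cos (th + eta)) by (field; lra).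
  apply Rle_trans with (Rpower (cos a) g * (Rpower 2 (1 - g) * Rpower (cos b) (1 - g))).
  - apply Rmult_le_compat_l; lra.
  - replace (Rpower (cos a) g * (Rpower 2 (1 - g) * Rpower (cos b) (1 - g))) with
      (Rpower 2 (1 - g) * (Rpower (cos a) g * Rpower (cos b) (1 - g))) by ring.
    apply Rmult_le_compat_l; lra.
Qed.

(** The argument of the quotient is less than [PI * gamma / 2 + 11 / 10 * delta] in absolute value.
    The second term is at most [44 / 90 * (1 - gamma)], so the total stays below [PI / 2]. *)
Lemma sector_Re_ge_0 (q : C) (r : R) (e t : C) : 0 < Re q -> 6 <= r * Re q ->
  sector (Carg (1 + r * q)%C) (PI * gamma_ q r / 2) t -> Cmod e <= delta_ (r * Re q) ->
  0 <= Re (t / ((1 + r * q) * (1 + e)))%C.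
Proof.
  intros Hq Hx [Ht Hth] He.
  destruct (gamma_bounds q r Hx) as [Hg Hgd]. destruct (delta_bound _ Hx) as [Hd0 Hd1].
  assert (Hr : 0 < r) by nra.
  assert (HQm : 0 < Cmod (1 + r * q)%C).
  { pose proof (re_le_Cmod (1 + r * q)%C). pose proof (Rle_abs (Re (1 + r * q)%C)). rewrite one_plus_rq in *. nra. }
  assert (HQ0 : (1 + r * q)%C <> 0) by (now apply Cmod_gt_0).
  pose proof (one_plus_neq_0 e _ He Hd1) as He0. pose proof (proj1 (Cmod_gt_0 _) He0) as Hem.
  rewrite Re_quotient_polar; auto.
  pose proof (Carg_near_1 e _ He (conj Hd0 Hd1)) as Heta.
  apply Rmult_le_pos.
  - apply Rdiv_le_0_compat; [apply Cmod_ge_0|now apply Rmult_lt_0_compat].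
  - apply Rabs_def2 in Hth. apply Rabs_le_between in Heta.
    assert (HPI : 3 < PI) by (pose proof PI2_3_2; lra).
    apply cos_ge_0; nra.
Qed.

(** * Decay of trajectories and Euler iterates in complex directions *)

Lemma accretive_decay (g : C -> C) (w : R -> C) (c : R) : trajectory g w ->
  (forall z, unit_disk z -> c * Cmod z ^ 2 <= Re (Cconj z * g z)%C) ->
  forall t, 0 <= t -> Cmod (w t) <= Cmod (w 0) * exp (- (c * t)).
Proof.
  intros Hw Hc t Ht.
  (* The squared modulus multiplied by [exp (2 * c * s)]; the hypothesis on [g] says exactly that it
     does not increase. *)
  set (phi := fun s => (Re (w s) * Re (w s) + Im (w s) * Im (w s)) * exp (2 * c * s)).
  set (dphi := fun s => (- (2 * Re (Cconj (w s) * g (w s))%C) + 2 * c * Cmod (w s) ^ 2) * exp (2 * c * s)).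
  assert (Hd : forall s, 0 <= s -> is_derive phi s (dphi s)).
  { intros s Hs. destruct (Hw s Hs) as [_ [D1 D2]].
    assert (P1 : is_derive (fun s : R => Re (w s) * Re (w s) + Im (w s) * Im (w s)) s (- (2 * Re (Cconj (w s) * g (w s))%C))).
    { pose proof (is_derive_mult (K := R_AbsRing) _ _ _ _ _ D1 D1 Rmult_comm) as P1.
      pose proof (is_derive_mult (K := R_AbsRing) _ _ _ _ _ D2 D2 Rmult_comm) as P2.
      pose proof (is_derive_plus (V := R_NormedModule) _ _ _ _ _ P1 P2) as P3.
      evar_last; [exact P3|]. unfold Re, Im. cbn. ring. }
    assert (P2 : is_derive (fun s : R => exp (2 * c * s)) s (2 * c * exp (2 * c * s))).
    { auto_derive; auto. ring. }
    pose proof (is_derive_mult (K := R_AbsRing) _ _ _ _ _ P1 P2 Rmult_comm) as P3.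
    evar_last; [exact P3|]. unfold dphi. rewrite Cmod_sqr. unfold plus, mult; simpl. unfold Re, Im; simpl. ring. }
  assert (Hle : phi t <= phi 0).
  { destruct (MVT_gen phi 0 t dphi) as [s [Hs HE]].
    - intros s Hs. rewrite Rmin_left, Rmax_right in Hs by auto. apply Hd; lra.
    - intros s Hs. rewrite Rmin_left, Rmax_right in Hs by auto.
      apply derivable_continuous_pt. exists (dphi s). apply is_derive_Reals, Hd; lra.
    - rewrite Rmin_left, Rmax_right in Hs by auto.
      assert (dphi s <= 0).
      { unfold dphi. pose proof (exp_pos (2 * c * s)). pose proof (Hc (w s) (proj1 (Hw s (proj1 Hs)))). nra. }
      nra. }
  unfold phi in Hle. rewrite <- !Cmod_sqr in Hle. rewrite Rmult_0_r, exp_0, Rmult_1_r in Hle.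
  apply Rsqr_incr_0_var; [|apply Rmult_le_pos; [apply Cmod_ge_0|left; apply exp_pos]].
  unfold Rsqr.
  pose proof (exp_pos (2 * c * t)) as Hp.
  apply Rmult_le_reg_r with (exp (2 * c * t)); auto.
  replace (Cmod (w 0) * exp (- (c * t)) * (Cmod (w 0) * exp (- (c * t))) * exp (2 * c * t))
    with (Cmod (w 0) ^ 2 * (exp (- (c * t)) * exp (- (c * t)) * exp (2 * c * t))) by ring.
  rewrite <- !exp_plus. replace (- (c * t) + - (c * t) + 2 * c * t) with 0 by ring. rewrite exp_0.
  lra.
Qed.

(** The infinitesimal condition for the flow in the complex time direction [t] not to increase
    moduli. It is linear in [t], so such directions form a convex cone. *)
Definition accretive_direction (g : C -> C) (t : C) : Prop :=
  forall w, unit_disk w -> 0 <= Re (t * (Cconj w * g w))%C.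

(** In the direction [t0] the first-order term of the squared modulus has the good sign, so only the
    term of order [p ^ 2] counts, and [p * Cmod t0 ^ 2 <= d] makes it at most of size [p * d].
    Replacing [t0] by [t] costs another [p * d]. *)
Lemma euler_step_bound (g : C -> C) (t t0 w : C) (p d : R) : unit_disk w -> Cmod (g w) <= Cmod w ->
  accretive_direction g t0 -> Cmod (t - t0)%C <= d -> 0 <= p -> p * Cmod t0 ^ 2 <= d ->
  Cmod (w - t * p * g w)%C <= Cmod w * (1 + p * (2 * d)).
Proof.
  intros Hw Hg Ht0 Ht Hp Hpd. pose proof (Cmod_ge_0 w) as Hw0. pose proof (Cmod_ge_0 (g w)) as Hg0.
  specialize (Ht0 w Hw). set (B := Cmod t0) in *. assert (HB : 0 <= B) by apply Cmod_ge_0.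
  assert (Hpos : 0 <= p * B ^ 2) by (apply Rmult_le_pos; auto; nra).
  assert (H1 : Cmod (w - t0 * p * g w)%C <= Cmod w * (1 + p * (p * B ^ 2))).
  { apply Rsqr_incr_0_var; [|apply Rmult_le_pos; nra].
    unfold Rsqr.
    assert (E : Cmod (w - t0 * p * g w)%C ^ 2 = Cmod w ^ 2 - 2 * p * Re (t0 * (Cconj w * g w))%C + p ^ 2 * (B ^ 2 * Cmod (g w) ^ 2)).
    { unfold B. rewrite !Cmod_sqr. destruct w as [w1 w2], t0 as [a b], (g (w1, w2)) as [g1 g2]. unfold Re, Im; simpl. ring. }
    replace (Cmod (w - t0 * p * g w)%C * Cmod (w - t0 * p * g w)%C) with (Cmod (w - t0 * p * g w)%C ^ 2) by ring.
    rewrite E.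
    assert (Cmod (g w) ^ 2 <= Cmod w ^ 2) by (apply pow_incr; auto).
    assert (p ^ 2 * (B ^ 2 * Cmod (g w) ^ 2) <= p ^ 2 * (B ^ 2 * Cmod w ^ 2)).
    { apply Rmult_le_compat_l; [nra|]. apply Rmult_le_compat_l; [nra|auto]. }
    set (y := p * (p * B ^ 2)). assert (0 <= y) by (now apply Rmult_le_pos).
    replace (p ^ 2 * (B ^ 2 * Cmod w ^ 2)) with (Cmod w ^ 2 * y) in H0 by (unfold y; ring).
    replace (Cmod w * (1 + y) * (Cmod w * (1 + y))) with (Cmod w ^ 2 + Cmod w ^ 2 * y + Cmod w ^ 2 * (y + y * y)) by ring.
    assert (0 <= Cmod w ^ 2 * (y + y * y)) by (apply Rmult_le_pos; nra).
    assert (0 <= 2 * p * Re (t0 * (Cconj w * g w))%C) by (apply Rmult_le_pos; lra). lra. }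
  replace (w - t * p * g w)%C with (w - t0 * p * g w + - ((t - t0) * p * g w))%C by ring.
  eapply Rle_trans; [apply Cmod_triangle|]. rewrite Cmod_opp, !Cmod_mult, Cmod_R, (Rabs_pos_eq p) by auto.
  assert (Cmod (t - t0)%C * p * Cmod (g w) <= d * p * Cmod w).
  { apply Rmult_le_compat; auto; [apply Rmult_le_pos; auto using Cmod_ge_0|now apply Rmult_le_compat_r]. }
  assert (p * (p * B ^ 2) <= p * d) by (now apply Rmult_le_compat_l).
  assert (Cmod w * (1 + p * (p * B ^ 2)) <= Cmod w * (1 + p * d)) by (apply Rmult_le_compat_l; lra).
  lra.
Qed.

(** The step bound, iterated at most [2 ^ k] times with [p = (/ 2) ^ k], multiplies the modulus by
    at most [exp (2 * d)], whatever the level. *)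
Lemma euler2_bounded_direction (g : C -> C) (t t0 z : C) (d r : R) (k0 : nat) :
  (forall w, unit_disk w -> Cmod (g w) <= Cmod w) -> accretive_direction g t0 ->
  Cmod (t - t0)%C <= d -> Cmod t0 ^ 2 * (/ 2) ^ k0 <= d -> Cmod z * exp (2 * d) <= r -> r < 1 ->
  euler2_bounded g t z r k0.
Proof.
  intros Hg Ht0 Ht Hk0 Hr Hr1 k Hk j Hj.
  assert (Hd : 0 <= d) by (eapply Rle_trans; [apply Cmod_ge_0|exact Ht]).
  assert (Hp : 0 < (/ 2) ^ k) by (apply pow_lt; lra).
  pose proof (half_pow_mono k0 k Hk) as Hmono. pose proof (INR_pow2 k) as Hn.
  assert (HB : 0 <= Cmod t0 ^ 2) by (apply pow_le, Cmod_ge_0).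
  set (p := (/ 2) ^ k) in *.
  assert (Hpd : p * Cmod t0 ^ 2 <= d). { assert (Cmod t0 ^ 2 * p <= Cmod t0 ^ 2 * (/ 2) ^ k0) by (now apply Rmult_le_compat_l). lra. }
  assert (Hexp : forall i, (i <= 2 ^ k)%nat -> Cmod z * (1 + p * (2 * d)) ^ i <= r).
  { intros i Hi. eapply Rle_trans; [|exact Hr]. apply Rmult_le_compat_l; [apply Cmod_ge_0|].
    eapply Rle_trans; [apply pow_1_plus_le_exp; nra|]. apply exp_le_mono.
    apply le_INR in Hi. assert (INR i * p <= 1) by (rewrite <- Hn; apply Rmult_le_compat_r; lra). nra. }
  assert (Hind : forall i, (i <= 2 ^ k)%nat -> Cmod (euler g (t * RtoC p)%C i z) <= Cmod z * (1 + p * (2 * d)) ^ i).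
  { induction i as [|i IH]; intros Hi; [simpl; lra|].
    specialize (IH ltac:(lia)). specialize (Hexp i ltac:(lia)). cbn [euler].
    set (w := euler g (t * RtoC p)%C i z) in *.
    assert (Hw : unit_disk w) by (unfold unit_disk; lra).
    eapply Rle_trans; [apply (euler_step_bound g t t0 w p d); auto; lra|].
    simpl pow. replace (Cmod z * ((1 + p * (2 * d)) * (1 + p * (2 * d)) ^ i)) with (Cmod z * (1 + p * (2 * d)) ^ i * (1 + p * (2 * d))) by ring.
    apply Rmult_le_compat_r; auto. nra. }
  eapply Rle_trans; [apply Hind; auto|auto].
Qed.

(** * Connected open domains and the analytic extension of the flow *)

Lemma open_Cmod (D : C -> Prop) :
  open D <-> forall x, D x -> exists d, 0 < d /\ forall y, Cmod (y - x)%C < d -> D y.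
Proof.
  split.
  - intros H x Dx. destruct (H x Dx) as [d Hd]. exists d. split; [apply cond_pos|].
    intros y Hy. apply Hd. now apply C_NormedModule_mixin_compat1.
  - intros H x Dx. destruct (H x Dx) as [d [Hd Hy]].
    assert (Hd2 : 0 < d / 2) by lra. exists (mkposreal _ Hd2). intros y By. apply Hy.
    apply C_NormedModule_mixin_compat2 in By. simpl in By.
    eapply Rlt_le_trans; [exact By|].
    assert (sqrt 2 <= 2). { rewrite <- (sqrt_square 2) at 2 by lra. apply sqrt_le_1_alt. lra. }
    nra.
Qed.

(** Take a segment from [U] to [V] and the supremum of the parameters up to which it remains in [U].
    The point there lies in [U] or in [V], and either case contradicts openness or disjointness. *)
Lemma convex_connected (D : C -> Prop) :
  (forall a b s, D a -> D b -> 0 <= s <= 1 -> D (RtoC (1 - s) * a + RtoC s * b)%C) -> Cconnected D.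
Proof.
  intros HD U V HU HV Hcov [a [Da Ua]] [b [Db Vb]].
  apply NNPP. intros Hno.
  assert (Hdisj : forall t, D t -> U t -> V t -> False) by (intros t H1 H2 H3; apply Hno; exists t; auto).
  rewrite open_Cmod in HU, HV.
  set (gam := fun s : R => (RtoC (1 - s) * a + RtoC s * b)%C).
  assert (Hg : forall s, 0 <= s <= 1 -> D (gam s)) by (intros; apply HD; auto).
  set (N := Cmod (b - a)%C + 1). assert (HN : 0 < N) by (pose proof (Cmod_ge_0 (b - a)%C); unfold N; lra).
  assert (Hlip : forall s t d, 0 < d -> Rabs (s - t) < d / N -> Cmod (gam s - gam t)%C < d).
  { intros s t d Hd Hst. unfold gam.
    replace (RtoC (1 - s) * a + RtoC s * b - (RtoC (1 - t) * a + RtoC t * b))%C with (RtoC (s - t) * (b - a))%C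
      by (rewrite !RtoC_minus; ring).
    rewrite Cmod_mult, Cmod_R. apply Rmult_lt_compat_r with (r := N) in Hst; auto.
    replace (d / N * N) with d in Hst by (field; lra).
    pose proof (Rabs_pos (s - t)). unfold N in Hst. nra. }
  set (E := fun s => 0 <= s <= 1 /\ forall s', 0 <= s' <= s -> U (gam s')).
  assert (g0 : gam 0 = a) by (unfold gam; rewrite Rminus_0_r; ring).
  assert (g1 : gam 1 = b) by (unfold gam; replace (1 - 1) with 0 by ring; ring).
  destruct (completeness E) as [s [Hs1 Hs2]].
  - exists 1. intros x [Hx _]. lra.
  - exists 0. split; [lra|]. intros s' Hs'. replace s' with 0 by lra. now rewrite g0.
  - assert (H0 : 0 <= s). { apply Hs1. split; [lra|]. intros s' Hs'. replace s' with 0 by lra. now rewrite g0. }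
    assert (H1 : s <= 1). { apply Hs2. intros x [Hx _]. lra. }
    assert (Hbelow : forall s', 0 <= s' < s -> U (gam s')).
    { intros s' Hs'. apply NNPP. intros Hn. assert (s <= s'); [|lra]. apply Hs2. intros x [Hx1 Hx2].
      apply Rnot_lt_le. intros Hlt. apply Hn, Hx2. lra. }
    destruct (Hcov (gam s) (Hg s (conj H0 H1))) as [HUs|HVs].
    + destruct (Req_dec s 1) as [->|Hne].
      { apply (Hdisj (gam 1)); [apply Hg; lra|exact HUs|now rewrite g1]. }
      destruct (HU _ HUs) as [d [Hd Hdd]].
      set (s2 := Rmin 1 (s + d / N / 2)).
      assert (HdN : 0 < d / N) by (now apply Rdiv_lt_0_compat).
      assert (Hs2' : s < s2) by (apply Rmin_glb_lt; lra).
      assert (Hs21 : s2 <= 1) by apply Rmin_l. assert (Hs22 : s2 <= s + d / N / 2) by apply Rmin_r.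
      assert (E s2).
      { split; [lra|]. intros s' Hs'. destruct (Rlt_le_dec s' s); [apply Hbelow; lra|].
        apply Hdd, Hlip; auto. rewrite Rabs_pos_eq; lra. }
      specialize (Hs1 _ H). lra.
    + destruct (Req_dec s 0) as [->|Hne].
      { apply (Hdisj (gam 0)); [apply Hg; lra|now rewrite g0|exact HVs]. }
      destruct (HV _ HVs) as [d [Hd Hdd]].
      assert (HdN : 0 < d / N) by (now apply Rdiv_lt_0_compat).
      set (s2 := Rmax 0 (s - d / N / 2)).
      assert (Hs2' : s2 < s) by (apply Rmax_lub_lt; lra).
      assert (Hs21 : 0 <= s2) by apply Rmax_l. assert (Hs22 : s - d / N / 2 <= s2) by apply Rmax_r.
      apply (Hdisj (gam s2)); [apply Hg; lra|apply Hbelow; lra|].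
      apply Hdd, Hlip; auto. rewrite Rabs_minus_sym, Rabs_pos_eq; lra.
Qed.

Lemma Re_scal_plus (s t : R) (a b c : C) :
  Re ((RtoC s * a + RtoC t * b) * c)%C = s * Re (a * c)%C + t * Re (b * c)%C.
Proof. unfold Re; simpl. ring. Qed.

(* The extension lives on the [d]-neighbourhood of the convex cone of accretive directions. *)
Lemma flow_extends (g : C -> C) (S : C -> Prop) (v : R -> C) (z : C) : holomorphic_on unit_disk g ->
  (forall w, unit_disk w -> Cmod (g w) <= Cmod w) ->
  (forall w, unit_disk w -> 0 <= Re (Cconj w * g w)%C) ->
  (forall t, S t -> accretive_direction g t) ->
  unit_disk z -> cauchy_solution g z v -> extends_analytically_to S v.
Proof.
  intros Hg Hle Hre HS Hz Hv. unfold unit_disk in Hz. set (s := Cmod z) in *.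
  assert (Hs : 0 <= s) by apply Cmod_ge_0.
  (* With [r] the midpoint of [s] and 1, this [d] gives [s <= r * (1 - 2 * d)], hence
     [s * exp (2 * d) <= r]: the iterates stay in a fixed disk. *)
  set (d := (1 - s) / 8). assert (Hd : 0 < d) by (unfold d; lra).
  set (r := (1 + s) / 2). assert (Hr : 0 < r < 1) by (unfold r; lra).
  assert (Hexp : s * exp (2 * d) <= r).
  { assert (H1 : 1 - 2 * d <= exp (- (2 * d))) by (apply exp_ineq1_le).
    assert (H2 : exp (2 * d) * exp (- (2 * d)) = 1) by (rewrite <- exp_plus, Rplus_opp_r; apply exp_0).
    pose proof (exp_pos (2 * d)) as H3.
    assert (H4 : exp (2 * d) * (1 - 2 * d) <= 1) by (rewrite <- H2; apply Rmult_le_compat_l; lra).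
    assert (H5 : s <= r * (1 - 2 * d)) by (unfold r, d; nra).
    apply Rmult_le_reg_r with (1 - 2 * d); [unfold d; lra|]. nra. }
  exists (fun t => exists t0, accretive_direction g t0 /\ Cmod (t - t0)%C < d), (fun t => limC (fun k => euler2 g t k z)).
  assert (Hin : forall t, accretive_direction g t -> exists t0, accretive_direction g t0 /\ Cmod (t - t0)%C < d).
  { intros t Ht. exists t. split; auto. replace (t - t)%C with (RtoC 0) by ring. now rewrite Cmod_0. }
  split; [|split; [|split; [|split]]].
  - apply open_Cmod. intros t [t0 [Ht0 Ht]]. exists (d - Cmod (t - t0)%C). split; [lra|].
    intros y Hy. exists t0. split; auto. pose proof (Cmod_triangle (y - t)%C (t - t0)%C) as HT.
    replace (y - t + (t - t0))%C with (y - t0)%C in HT by ring. lra.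
  - apply convex_connected. intros a b l [a0 [Ha0 Ha]] [b0 [Hb0 Hb]] Hl.
    exists (RtoC (1 - l) * a0 + RtoC l * b0)%C. split.
    + intros w Hw. rewrite Re_scal_plus. specialize (Ha0 w Hw). specialize (Hb0 w Hw).
      apply Rplus_le_le_0_compat; apply Rmult_le_pos; lra.
    + replace (RtoC (1 - l) * a + RtoC l * b - (RtoC (1 - l) * a0 + RtoC l * b0))%C
        with (RtoC (1 - l) * (a - a0) + RtoC l * (b - b0))%C by ring.
      eapply Rle_lt_trans; [apply Cmod_triangle|]. rewrite !Cmod_mult, !Cmod_R, !Rabs_pos_eq by lra.
      destruct (Req_dec l 0) as [->|Hl0]; [lra|].
      assert (l * Cmod (b - b0)%C < l * d) by (apply Rmult_lt_compat_l; lra).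
      assert ((1 - l) * Cmod (a - a0)%C <= (1 - l) * d) by (apply Rmult_le_compat_l; lra). lra.
  - intros t Ht. apply Hin. auto.
  - intros t Ht. split.
    + apply Hin. intros w Hw. specialize (Hre w Hw).
      replace (Re (RtoC t * (Cconj w * g w))%C) with (t * Re (Cconj w * g w)%C) by (unfold Re; simpl; ring).
      now apply Rmult_le_pos.
    + destruct (solution_extension g z v Hv) as [w [Hw0 Hw]].
      assert (Htr : trajectory g w) by (intros x Hx; apply Hw; auto).
      destruct (euler2_near_trajectory g w t Hg Htr Ht) as [_ [_ [_ [_ [_ Hc]]]]].
      rewrite Hw0 in Hc. rewrite (limC_correct _ _ Hc). now apply Hw.
  - apply holomorphic_cdiff. intros t [t0 [Ht0 Ht]].
    destruct (half_pow_small (Cmod t0 ^ 2) d) as [k0 Hk0]; [apply pow_le, Cmod_ge_0|auto|].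
    (* Half of the remaining distance keeps every nearby [x] within [d] of the same direction [t0],
       so one level [k0] serves them all. *)
    apply (euler2_limit_cdiff g (fun t => t) (fun _ => z) t ((d - Cmod (t - t0)%C) / 2) r k0); auto; [lra|].
    intros x Hx. split; [eexists; apply cdiff_id|]. split; [eexists; apply cdiff_const|].
    apply (euler2_bounded_direction g x t0 z d r k0); auto; try lra.
    pose proof (Cmod_triangle (x - t)%C (t - t0)%C) as HT.
    replace (x - t + (t - t0))%C with (x - t0)%C in HT by ring. lra.
Qed.

(** Turns bounds on [Re (t / m)] into accretivity of [G]. The multiplicative form [a * m = w] avoids
    the quotient [a / w], so [w = 0] is no exception. *)
Lemma conj_mult_quotient (w a m : C) : m <> 0 -> (a * m)%C = w ->
  forall t, Re (t * (Cconj w * a))%C = Cmod w ^ 2 * Re (t / m)%C.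
Proof.
  intros Hm HE t.
  replace (t * (Cconj w * a))%C with (RtoC (Cmod w ^ 2) * (t / m))%C.
  - unfold Re; simpl. ring.
  - assert (Ha : a = (w / m)%C) by (rewrite <- HE; field; auto).
    rewrite Cmod2_conj, Ha. field. auto.
Qed.

Theorem theorem3p3 (q : C) (hq : 0 < Re q)
    (r : R) (hr : r >= 6 / Re q)
    (G : C -> C) (hG : resolvent_class q r G)
    (u : R -> C -> C) (hu : generates_semigroup G u) :
  (converges_uniformly_to_0 u /\
   (Rabs (Carg (1 + r * q)%C) < PI * gamma_ q r / 2 ->
    exponential_squeezing_coefficient u (kappa_ q r))) /\
  (forall z : C, unit_disk z ->
    extends_analytically_to
      (sector (Carg (1 + r * q)%C) (PI * gamma_ q r / 2))
      (fun t : R => u t z)).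
Proof.
  assert (Hx : 6 <= r * Re q).
  { apply Rge_le in hr. apply Rmult_le_compat_r with (r := Re q) in hr; [|lra].
    replace (6 / Re q * Re q) with 6 in hr by (field; lra). exact hr. }
  assert (Hr : 0 < r) by nra.
  pose proof (resolvent_quotient q r G hq Hx hG) as HQ.
  destruct (delta_bound _ Hx) as [Hd0 Hd1].
  set (Q := (1 + r * q)%C) in *.
  assert (HQm : 7 <= Cmod Q).
  { pose proof (re_le_Cmod Q) as H. pose proof (Rle_abs (Re Q)).
    pose proof (one_plus_rq q r : Re Q = _). lra. }
  assert (Hnz : forall e, Cmod e <= delta_ (r * Re q) -> (Q * (1 + e))%C <> 0).
  { intros e He. apply Cmult_neq_0; [apply Cmod_gt_0; lra|]. now apply one_plus_neq_0 with (delta_ (r * Re q)). }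
  assert (HGhol : holomorphic_on unit_disk G) by (destruct hG as [f [_ [_ [_ [H _]]]]]; exact H).
  (* A crude rate from [Re (1 / m) = Re m / Cmod m ^ 2] with [Re m >= 1] and [Cmod m <= 2 * Cmod Q].
     The convergence claim, which carries no condition on the argument, rests on it, and so does
     accretivity at real times. *)
  assert (Hre0 : forall w, unit_disk w -> / (4 * Cmod Q ^ 2) * Cmod w ^ 2 <= Re (Cconj w * G w)%C).
  { intros w Hw. destruct (HQ w Hw) as [e [He [Hm HE]]].
    rewrite <- (Cmult_1_l (Cconj w * G w)%C), (conj_mult_quotient w (G w) _ (Hnz e He) HE).
    rewrite Rmult_comm. apply Rmult_le_compat_l; [apply pow_le, Cmod_ge_0|].
    set (m := (Q * (1 + e))%C) in *.
    assert (Hm0 : 0 < Cmod m) by (apply Cmod_gt_0; unfold m; auto).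
    assert (Hm2 : Cmod m ^ 2 <= 4 * Cmod Q ^ 2).
    { replace (4 * Cmod Q ^ 2) with ((Cmod Q * 2) ^ 2) by ring. apply pow_incr. split; [lra|].
      unfold m. rewrite Cmod_mult. apply Rmult_le_compat_l; [lra|].
      pose proof (Cmod_1_plus_le e _ He). lra. }
    assert (Hm2p : 0 < Cmod m ^ 2) by (now apply pow_lt).
    assert (E : Re (1 / m)%C = Re m / Cmod m ^ 2).
    { rewrite Cmod_sqr. destruct m as [m1 m2]. unfold Re, Im, Cdiv, Cinv; simpl. rewrite Cmod_sqr in Hm2p.
      unfold Re, Im in Hm2p; simpl in Hm2p. field. nra. }
    rewrite E. apply Rle_trans with (/ Cmod m ^ 2); [now apply Rinv_le_contravar|].
    unfold Rdiv. rewrite <- (Rmult_1_l (/ Cmod m ^ 2)) at 1. apply Rmult_le_compat_r; auto.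
    left; now apply Rinv_0_lt_compat. }
  assert (Hc0 : 0 < / (4 * Cmod Q ^ 2)) by (apply Rinv_0_lt_compat; nra).
  assert (Hdecay : forall c, (forall w, unit_disk w -> c * Cmod w ^ 2 <= Re (Cconj w * G w)%C) ->
    forall t z, 0 <= t -> unit_disk z -> Cmod (u t z) <= Cmod z * exp (- (c * t))).
  { intros c Hc t z Ht Hz. destruct (solution_extension G z _ (hu z Hz)) as [w [Hw0 Hw]].
    rewrite <- (proj1 (Hw t Ht)), <- Hw0. apply (accretive_decay G w c); auto.
    intros x Hx'. apply Hw; auto. }
  split; [split|].
  - intros eps Heps. set (c := / (4 * Cmod Q ^ 2)) in *.
    exists (- ln eps / c). intros t Ht HT z Hz.
    eapply Rle_lt_trans; [apply (Hdecay c Hre0 t z Ht Hz)|].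
    apply Rmult_le_compat_r with (r := c) in HT; [|lra].
    replace (- ln eps / c * c) with (- ln eps) in HT by (field; lra).
    assert (exp (- (c * t)) <= eps) by (rewrite <- (exp_ln eps) by auto; apply exp_le_mono; lra).
    pose proof (exp_pos (- (c * t))). unfold unit_disk in Hz. pose proof (Cmod_ge_0 z). nra.
  - intros Harg. split.
    { unfold kappa_. fold Q. apply Rdiv_lt_0_compat; [apply exp_pos|].
      apply Rmult_lt_0_compat; [apply exp_pos|apply pow_lt; lra]. }
    intros t z Ht Hz. apply Hdecay; auto; [|lra]. intros w Hw.
    destruct (HQ w Hw) as [e [He [_ HE]]].
    rewrite <- (Cmult_1_l (Cconj w * G w)%C), (conj_mult_quotient w (G w) _ (Hnz e He) HE).
    rewrite Rmult_comm. apply Rmult_le_compat_l; [apply pow_le, Cmod_ge_0|].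
    apply kappa_le_Re; auto.
  - intros z Hz. apply flow_extends with (g := G) (z := z); auto.
    (* The factor [m] has real part at least 1, so dividing by it does not increase moduli. *)
    + intros w Hw. destruct (HQ w Hw) as [e [He [Hm HE]]].
      rewrite <- HE at 2. rewrite Cmod_mult.
      assert (1 <= Cmod (Q * (1 + e))%C) by (eapply Rle_trans; [exact Hm|]; eapply Rle_trans; [apply Rle_abs|apply re_le_Cmod]).
      pose proof (Cmod_ge_0 (G w)). nra.
    + intros w Hw. eapply Rle_trans; [|apply Hre0; auto]. apply Rmult_le_pos; [lra|apply pow_le, Cmod_ge_0].
    + intros t Ht w Hw. destruct (HQ w Hw) as [e [He [_ HE]]].
      rewrite (conj_mult_quotient w (G w) _ (Hnz e He) HE).
      apply Rmult_le_pos; [apply pow_le, Cmod_ge_0|]. apply sector_Re_ge_0; auto.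
Qed.
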